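(* Let $f:[0,1]\to\mathbb{C}$ be a function with $f(0)=0$ and $\lim_{x\to0^+}\frac{|f(x)|}{x}=\infty$, and let $B\subseteq\mathbb{R}$ be a measurable set with finite and positive measure. Then there exists a measurable set $A\subseteq\mathbb{R}$ of finite measure such that $f(S_{A,B})$ is not trace class.
   Context: The Fourier transform on $L^2(\mathbb{R})$ is $\mathcal{F}f(\xi)=\int_{\mathbb{R}}e^{-2\pi i x\xi}f(x)\,dx$. For a measurable set $A\subset\mathbb{R}$, $P_A$ is multiplication by the indicator $1_A$ and $Q_A=\mathcal{F}^{-1}P_A\mathcal{F}$. For measurable $A,B\subset\mathbb{R}$ of finite measure, $S_{A,B}=P_AQ_BP_A$ is a non-negative self-adjoint trace class operator on $L^2(\mathbb{R})$ with norm at most $1$; $\lambda_1(A,B)\ge\lambda_2(A,B)\ge\dots\ge0$ are its eigenvalues with multiplicity. For $f:[0,1]\to\mathbb{C}$ with $f(0)=0$, $f(S_{A,B})v=\sum_nf(\lambda_n)\langle v,v_n\rangle v_n$, with $(v_n)$ the corresponding orthonormal eigenvectors; it is trace class when $\sum_nf(\lambda_n(A,B))$ converges absolutely. *)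

(* Defs.v *)
From mathcomp Require Import all_boot all_order all_algebra.
From mathcomp Require Import all_classical all_reals all_analysis.
From mathcomp Require Export complex.

Set Implicit Arguments.
Unset Strict Implicit.
Unset Printing Implicit Defensive.

Import Order.TTheory GRing.Theory Num.Theory numFieldNormedType.Exports.

Local Open Scope classical_set_scope.
Local Open Scope ring_scope.
Local Open Scope complex_scope.

(* The real line with the sigma-algebra of Lebesgue (not only Borel) measurable
   sets, i.e. the domain of [completed_lebesgue_measure]. *)
Definition lebesgueType (R : realType) := caratheodory_type (@wlength R idfun)^*%mu.

Notation leb := completed_lebesgue_measure.

Definition lebesgue_measurable (R : realType) (A : set R) : Prop :=
  measurable (A : set (lebesgueType R)).

Notation normc := ComplexField.Normc.normc.

Definition cmeasurable (R : realType) (u : R -> R[i]) : Prop :=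
  measurable_fun [set: lebesgueType R] (fun x => complex.Re (u x)) /\
  measurable_fun [set: lebesgueType R] (fun x => complex.Im (u x)).

Definition cintegral (R : realType) (u : R -> R[i]) : R[i] :=
  (\int[leb]_x complex.Re (u x)) +i* (\int[leb]_x complex.Im (u x)).

Definition L1 (R : realType) (u : R -> R[i]) : Prop :=
  cmeasurable u /\ (\int[leb]_x (normc (u x))%:E < +oo)%E.

(* Elements of L^2(R) are represented by square-integrable functions; equality
   in L^2(R) is equality almost everywhere. *)
Definition L2 (R : realType) (u : R -> R[i]) : Prop :=
  cmeasurable u /\ (\int[leb]_x (normc (u x) ^+ 2)%:E < +oo)%E.

Definition eqae (R : realType) (u v : R -> R[i]) : Prop :=
  {ae leb, forall x, u x = v x}.

Definition inner (R : realType) (u v : R -> R[i]) : R[i] :=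
  cintegral (fun x => u x * (v x)^*).

Definition cvgL2 (R : realType) (un : nat -> R -> R[i]) (u : R -> R[i]) : Prop :=
  (\int[leb]_x (normc (un n x - u x) ^+ 2)%:E)%E @[n --> \oo] --> 0%E.

Definition fourierL1 (R : realType) (u : R -> R[i]) (xi : R) : R[i] :=
  cintegral (fun x =>
    (cos (2 * pi * x * xi) -i* sin (2 * pi * x * xi)) * u x).

(* [g] is the Fourier transform of [u] in L^2(R): the continuous extension of
   the integral formula from the dense subspace of L^1 and L^2 functions. *)
Definition is_fourier (R : realType) (u g : R -> R[i]) : Prop :=
  [/\ L2 u, L2 g &
      exists un : nat -> R -> R[i],
        [/\ forall n, L1 (un n) /\ L2 (un n),
            cvgL2 un u &
            cvgL2 (fun n => fourierL1 (un n)) g] ].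

(* [xget] selects a representative of the (by Plancherel's theorem unique) class
   in L^2(R); the default value 0 is only reached outside L^2(R). *)
Definition fourier (R : realType) (u : R -> R[i]) : R -> R[i] :=
  xget (fun=> 0) [set g | is_fourier u g].

Definition inv_fourier (R : realType) (g : R -> R[i]) : R -> R[i] :=
  xget (fun=> 0) [set u | is_fourier u g].

Definition opP (R : realType) (A : set R) (u : R -> R[i]) : R -> R[i] :=
  fun x => (\1_A x)%:C * u x.

Definition opQ (R : realType) (A : set R) (u : R -> R[i]) : R -> R[i] :=
  inv_fourier (opP A (fourier u)).

Definition opS (R : realType) (A B : set R) (u : R -> R[i]) : R -> R[i] :=
  opP A (opQ B (opP A u)).

(* [lam] lists the eigenvalues of S_{A,B} with multiplicity in nonincreasing
   order and [v] is a corresponding orthonormal sequence of eigenvectors. The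
   expansion of S_{A,B} ensures that no nonzero eigenvalue is missing; when the
   rank is finite, [lam] ends with zeros. When it is infinite, [lam] is positive
   and eigenvectors of eigenvalue 0 are not listed. *)
Definition spectral_system (R : realType) (A B : set R)
    (lam : nat -> R) (v : nat -> R -> R[i]) : Prop :=
  [/\ (forall n, 0 <= lam n <= 1) /\ (forall n, lam n.+1 <= lam n),
      forall n, L2 (v n),
      forall m n, inner (v m) (v n) = (m == n)%:R,
      forall n, eqae (opS A B (v n)) (fun x => (lam n)%:C * v n x) &
      forall u, L2 u ->
        cvgL2 (fun n x => \sum_(k < n) (lam k)%:C * inner u (v k) * v k x)
              (opS A B u)].

(* f(S_{A,B}) is trace class: f(lambda_1), f(lambda_2), ... is absolutely
   summable. The choice of the spectral system is immaterial, since [lam] is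
   determined by A and B. As [lam] takes its values in [0, 1], only the
   restriction of [f] to [0, 1] matters. *)
Definition fS_trace_class (R : realType) (f : R -> R[i]) (A B : set R) : Prop :=
  exists (lam : nat -> R) (v : nat -> R -> R[i]),
    spectral_system A B lam v /\
    (\sum_(0 <= n <oo) (normc (f (lam n)))%:E < +oo)%E.

(* Main.v *)
(* With c = |B|/8, A is a union over m of N_m disjoint intervals of total length 2^-(m+1).
   The family of index m consists of intervals ]j/(2K), j/(2K) + d] with d very small, and
   phi_j = d^(-1/2) 1_(]j/(2K), j/(2K) + d]).  Since |F phi_j|^2 is close to d on [-K, K],
   sum_j <S phi_j, phi_j> is at least N d c = 2^-(m+1) c; on the other hand F phi_j is F phi_0
   times exp(-2 i pi j xi / (2K)), and these exponentials are orthogonal on ]-K, K], so that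
   <S g, g> <= eta |g|^2 on the span of the phi_j, where eta is as small as we like: 2Kd bounds
   the contribution of the window and N d |B \ [-K, K]| that of its complement.  Hence every
   eigenvalue can account for at most eta of the sum above, and the eigenvalues of index >= r
   have a sum of the order of 2^-m c, for any r prescribed beforehand.  As lambda_n <= |A||B|/n
   we can choose r so that |f(x)| >= 4^m x at all these eigenvalues, so the sum of the
   |f(lambda_n)| is at least of the order of 2^m c for every m.

   The quadratic form of S is <S u, u> = int_B |F (1_A u)|^2 by Plancherel's theorem, which is
   obtained from Fubini's theorem for the integrals damped by exp(-2 pi e |xi|): the defect is
   the energy of u against the Poisson kernel, and it tends to 0 with e, first for indicators
   of intervals, then by density for all of L^2. *)

Require Import Defs.
From mathcomp Require Import all_boot all_order all_algebra.
From mathcomp Require Import all_classical all_reals all_analysis.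
From mathcomp Require Import measurable_realfun.
From mathcomp Require Import ring lra.
Set Implicit Arguments.
Unset Strict Implicit.
Unset Printing Implicit Defensive.
Import Order.TTheory GRing.Theory Num.Theory numFieldNormedType.Exports.
Local Open Scope classical_set_scope.
Local Open Scope ring_scope.
Local Open Scope complex_scope.
Local Open Scope ring_scope.

(** The order of the choices is what avoids a circle. The function f gives the threshold [eps m]
    below which |f(x)| >= 4^m x; the threshold gives the index [r m] through |A| <= 1, a bound that
    is fixed before A is; [r m] gives [eta m]; only then are N, K and d chosen. The factor 4^m is
    there to beat the total length 2^-(m+1) of the m-th family. Families of different indices are
    never compared: the phi_j of one family are supported in A, so that multiplication by 1_A fixes
    them, whatever the rest of A is. No eigenvalue is ever computed; all information comes from the
    quadratic form on the span of one family and from the trace bound. Since [fourier] and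
    [inv_fourier] select a representative by choice, [opS] is only accessible up to null sets, and
    everything about it is stated through inner products. The spectral system is the one supplied by
    the trace class assumption that is being refuted, so all spectral estimates are made for an
    arbitrary one. *)

Section lebesgue_borel.
Context {R : realType}.
Local Notation T := (lebesgueType R).

(** * Integrals for the completed and for the Borel Lebesgue measure *)

Lemma measurable_leb (A : set R) : measurable A -> lebesgue_measurable A.
Proof. exact: sub_caratheodory. Qed.

Lemma measurable_fun_leb d (U : measurableType d) (f : R -> U) :
  measurable_fun [set: R] f -> measurable_fun [set: T] (f : T -> U).
Proof. by move=> mf _ Y mY; apply: measurable_leb; exact: mf. Qed.

Lemma lebE (A : set R) : leb A = lebesgue_measure A.
Proof. by []. Qed.

(** The identity from the completed to the Borel sigma-algebra is measurable and pushes [leb]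
    forward to [lebesgue_measure]. This opens the way to the fundamental theorem of calculus and to
    substitution, which are stated for Borel integrals. *)
Lemma ge0_integral_leb (D : set R) (f : R -> \bar R) :
  measurable D -> measurable_fun D f ->
  (forall x, D x -> (0 <= f x)%E) ->
  (\int[leb]_(x in D) f x = \int[lebesgue_measure]_(x in D) f x)%E.
Proof.
move=> mD mf f0.
have mid : measurable_fun [set: T] (id : T -> measurableTypeR R) by exact: measurable_fun_leb.
transitivity (\int[pushforward leb (id : T -> measurableTypeR R)]_(x in D) f x)%E.
  rewrite ge0_integral_pushforward//; last by move=> x /[!inE] /f0.
by apply: eq_measure_integral => A mA _.
Qed.

Lemma integral_leb (f : R -> \bar R) :
  measurable_fun [set: R] f -> leb.-integrable [set: T] f ->
  (\int[leb]_x f x = \int[lebesgue_measure]_x f x)%E.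
Proof.
move=> mf fi.
have mid : measurable_fun [set: T] (id : T -> measurableTypeR R) by exact: measurable_fun_leb.
transitivity (\int[pushforward leb (id : T -> measurableTypeR R)]_x f x)%E.
  by rewrite integral_pushforward.
by apply: eq_measure_integral => A mA _.
Qed.

End lebesgue_borel.

(** * The Poisson kernel and its energy form *)

Section explicit_integrals.
Context {R : realType}.
Local Notation mu := (@lebesgue_measure R).

Lemma ge0_FTC0y (f F : R -> R) (l : R) : (forall x, 0 <= x -> 0 <= f x) ->
  (forall x : R, is_derive x 1 F (f x)) -> continuous f -> F x @[x --> +oo] --> l ->
  (\int[mu]_(x in `[0%R, +oo[) (f x)%:E = (l - F 0)%:E)%E.
Proof.
move=> f0 dF cf Fl; rewrite (@ge0_continuous_FTC2y _ f F 0 l) ?EFinB//.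
- exact: continuous_subspaceT.
- apply: cvg_at_right_filter; apply: differentiable_continuous.
  by apply/derivable1_diffP.
- by move=> x _; rewrite derive1E derive_val.
Qed.

Lemma ge0_integral_split0 (f : R -> R) : measurable_fun [set: R] f ->
  (forall x, 0 <= f x) ->
  (\int[leb]_x (f x)%:E = \int[mu]_(x in `[0%R, +oo[) (f x)%:E +
    \int[mu]_(x in `[0%R, +oo[) (f (- x))%:E)%E.
Proof.
move=> mf f0; have mEf : measurable_fun [set: R] (EFin \o f) by exact/measurable_EFinP.
rewrite ge0_integral_leb//; last by move=> x _; rewrite lee_fin.
have -> : [set: R] = `[0, +oo[ `|` `]-oo, 0[.
  by rewrite -(setUv `[0%R, +oo[) setCitvr.
rewrite ge0_integral_setU//=.
- congr (_ + _)%E.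
  rewrite (@ge0_integration_by_substitution0 _ (fun x => (f (- x))%:E)).
  + rewrite integral_itv_bndo_bndc; last exact: measurable_funTS.
    by apply: eq_integral => x _; rewrite opprK.
  + apply/measurable_EFinP; apply: (measurableT_comp mf); exact: oppr_measurable.
  + by move=> r; rewrite lee_fin.
- exact: measurable_funTS.
- by move=> x _; rewrite lee_fin.
- rewrite disj_set2E; apply/eqP; rewrite -subset0 => x /=.
  by rewrite !in_itv/= andbT => -[]; rewrite leNgt => /negP.
Qed.

Lemma expR_mulN_cvgy (c : R) : 0 < c -> expR (- (c * x)) @[x --> +oo] --> 0.
Proof.
move=> c0; apply: (@cvg_comp _ _ _ (fun x => c * x) (fun x => expR (- x)) _ +oo).
  by apply: gt0_cvgMry.
exact: cvgr_expR.
Qed.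

(* An antiderivative of [exp (- c x) (1 + p cos (b x) + q sin (b x))]. *)
Definition exptrig_prim (c b p q x : R) : R :=
  expR (- (c * x)) * (- c^-1 + (- (c * p + b * q) * cos (b * x)
    + (b * p - c * q) * sin (b * x)) / (c ^+ 2 + b ^+ 2)).

Lemma is_derive_exptrig (c b p q x : R) : 0 < c ->
  is_derive x 1 (exptrig_prim c b p q)
    (expR (- (c * x)) * (1 + p * cos (b * x) + q * sin (b * x))).
Proof.
move=> c0; rewrite /exptrig_prim.
have cn0 : c != 0 by rewrite gt_eqF.
have d0 : c ^+ 2 + b ^+ 2 != 0.
  by rewrite gt_eqF// ltr_pwDl ?sqr_ge0// exprn_gt0.
apply: is_derive_eq.
rewrite /GRing.scale/=; field.
by apply/andP; split.
Qed.

Lemma cvg_exptrig_prim (c b p q : R) : 0 < c -> exptrig_prim c b p q x @[x --> +oo] --> 0.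
Proof.
move=> c0; pose M := `|c^-1| + (`|c * p + b * q| + `|b * p - c * q|) / `|c ^+ 2 + b ^+ 2|.
have bnd x : `|exptrig_prim c b p q x| <= expR (- (c * x)) * M.
  rewrite /exptrig_prim normrM (ger0_norm (expR_ge0 _)) ler_wpM2l ?expR_ge0//.
  rewrite (le_trans (ler_normD _ _))// normrN lerD2l normrM normfV ler_wpM2r//.
  rewrite (le_trans (ler_normD _ _))// !normrM normrN lerD// ler_piMr//.
    exact: cos_max.
  exact: sin_max.
apply/norm_cvg0P; apply: (@squeeze_cvgr _ _ _ _ (fun=> 0) (fun x => expR (- (c * x)) * M)).
- by apply: nearW => x; rewrite normr_ge0 bnd.
- exact: cvg_cst.
- rewrite -[X in _ --> X](mul0r M); apply: cvgMl; exact: expR_mulN_cvgy.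
Qed.

(** The constant 1 is there for the sign: with p = 1 or q = 1 the integrand is nonnegative, as
    integration on a half-line by [ge0_FTC0y] requires. The integrals of the damped cosine and sine
    are then recovered by subtracting the case p = q = 0. *)
Lemma integral0y_exptrig (c b p q : R) : 0 < c ->
  (forall x, 0 <= 1 + p * cos (b * x) + q * sin (b * x)) ->
  (\int[mu]_(x in `[0%R, +oo[) (expR (- (c * x)) *
     (1 + p * cos (b * x) + q * sin (b * x)))%:E =
   (c^-1 + (c * p + b * q) / (c ^+ 2 + b ^+ 2))%:E)%E.
Proof.
move=> c0 f0.
have dF (x : R) : is_derive x 1 (exptrig_prim c b p q)
    (expR (- (c * x)) * (1 + p * cos (b * x) + q * sin (b * x))).
  exact: is_derive_exptrig.
rewrite (@ge0_FTC0y _ (exptrig_prim c b p q) 0 _ dF); last 3 first.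
- by move=> x _; rewrite mulr_ge0// expR_ge0.
- move=> x; apply: differentiable_continuous; apply/derivable1_diffP.
  exact: ex_derive.
- exact: cvg_exptrig_prim.
congr EFin; rewrite /exptrig_prim !mulr0 oppr0 expR0 cos0 sin0.
by rewrite mulr0 addr0 mulr1 mul1r sub0r opprD opprK mulNr opprK.
Qed.

Definition expabs (c x : R) : R := expR (- (c * `|x|)).

Lemma continuous_expabs c : continuous (expabs c).
Proof.
move=> x; apply: continuous_comp; last exact: continuous_expR.
by apply: cvgN; apply: cvgMr; exact: norm_continuous.
Qed.

Lemma expabs_ge0 c x : 0 <= expabs c x. Proof. exact: expR_ge0. Qed.

Lemma ge0_integral_expabs_trig (c b p q : R) : 0 < c ->
  (forall x, 0 <= 1 + p * cos (b * x) + q * sin (b * x)) ->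
  (\int[leb]_x (expabs c x * (1 + p * cos (b * x) + q * sin (b * x)))%:E =
   (2 / c + p * (2 * c / (c ^+ 2 + b ^+ 2)))%:E)%E.
Proof.
move=> c0 f0; rewrite ge0_integral_split0; last 2 first.
- have ct : continuous (fun x => 1 + p * cos (b * x) + q * sin (b * x)).
    move=> x; apply: differentiable_continuous; apply/derivable1_diffP.
    exact: ex_derive.
  apply: continuous_measurable_fun => x; apply: cvgM; last exact: ct.
  exact: continuous_expabs.
- by move=> x; rewrite mulr_ge0// expabs_ge0.
(* Reflecting the negative half-line changes q into -q, so the sine terms cancel. *)
have -> : (2 / c + p * (2 * c / (c ^+ 2 + b ^+ 2)))%:E =
   ((c^-1 + (c * p + b * q) / (c ^+ 2 + b ^+ 2))%:E +
   (c^-1 + (c * p + b * - q) / (c ^+ 2 + b ^+ 2))%:E)%E.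
  by rewrite -EFinD; congr EFin; ring.
have f0' x : 0 <= 1 + p * cos (b * x) + - q * sin (b * x).
  by have := f0 (- x); rewrite mulrN cosN sinN mulrN mulNr.
rewrite -!integral0y_exptrig//; congr (_ + _)%E; apply: eq_integral => x.
  by rewrite inE/= in_itv/= andbT => x0; rewrite /expabs ger0_norm.
rewrite inE/= in_itv/= andbT => x0.
by rewrite /expabs normrN ger0_norm// mulrN cosN sinN mulrN mulNr.
Qed.

End explicit_integrals.

(** * Translation invariance of the integral *)

Section shift.
Context {R : realType}.
Local Notation T := (lebesgueType R).
Local Notation mu := (@lebesgue_measure R).

Lemma lebesgue_measure_shift (h : R) (A : set R) : measurable A ->
  pushforward mu ((fun x => x + h) : _ -> measurableTypeR R) A = mu A.
Proof.
move=> mA; apply/esym/lebesgue_measure_unique => //=.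
  exact: (@measurable_funD _ R R setT id (cst h)).
move=> mh _ [[a b]] _ <-.
rewrite /pushforward.
have -> : (fun x => x + h) @^-1` `]a, b] = `]a - h, b - h]%classic.
  by apply/seteqP; split => x /=; rewrite !in_itv/= ltrBlDr lerBrDr.
rewrite !lebesgue_measure_itv/= !lte_fin ltrD2r.
by case: ifP => // _; congr EFin; ring.
Qed.

Lemma ge0_integral_shift (f : R -> \bar R) (h : R) : measurable_fun [set: R] f ->
  (forall x, (0 <= f x)%E) -> (\int[leb]_x f ((x : R) + h)%R = \int[leb]_x f x)%E.
Proof.
move=> mf f0.
have mh : measurable_fun [set: R] (fun x : R => x + h) by exact: measurable_funD.
rewrite !ge0_integral_leb//; last exact: (measurableT_comp mf).
transitivity (\int[pushforward mu (+%R^~ h : _ -> measurableTypeR R)]_x f x)%E.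
  by rewrite ge0_integral_pushforward.
by apply: eq_measure_integral => A mA _; exact: lebesgue_measure_shift.
Qed.

Lemma integral_shift (f : R -> \bar R) (h : R) : measurable_fun [set: R] f ->
  leb.-integrable [set: T] f -> (\int[leb]_x f ((x : R) + h)%R = \int[leb]_x f x)%E.
Proof.
move=> mf fi.
rewrite integralE [RHS]integralE; congr (_ - _)%E.
  rewrite -(@ge0_integral_shift (f^\+)%E h)//; last exact: measurable_funepos.
  by apply: eq_integral => x _; rewrite !funeposE.
rewrite -(@ge0_integral_shift (f^\-)%E h)//; last exact: measurable_funeneg.
by apply: eq_integral => x _; rewrite !funenegE.
Qed.
End shift.

(** * The two-sided exponential and its transform, the Poisson kernel *)

Section kernels.
Context {R : realType}.
Local Notation T := (lebesgueType R).

Lemma measurable_expabs c : measurable_fun [set: R] (expabs c).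
Proof. by apply: continuous_measurable_fun; exact: continuous_expabs. Qed.

Lemma integral_expabs (c : R) : 0 < c -> (\int[leb]_x (expabs c x)%:E = (2 / c)%:E)%E.
Proof.
move=> c0; rewrite -[RHS](_ : (2 / c + 0 * (2 * c / (c ^+ 2 + 0 ^+ 2)))%:E = _); last first.
  by rewrite mul0r addr0.
rewrite -(@ge0_integral_expabs_trig _ c 0 0 0)//.
by apply: eq_integral => x _; rewrite !mul0r !addr0 mulr1.
Qed.

Lemma integrable_expabs (c : R) : 0 < c -> leb.-integrable [set: T] (EFin \o expabs c).
Proof.
move=> c0; apply/integrableP; split.
  by apply/measurable_EFinP; apply: measurable_fun_leb; exact: measurable_expabs.
under eq_integral do rewrite /= ger0_norm ?expabs_ge0//.
by rewrite integral_expabs// ltry.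
Qed.

Lemma integrable_expabs_bounded (c : R) (g : R -> R) : 0 < c ->
  measurable_fun [set: R] g -> (forall x, `|g x| <= 1) ->
  leb.-integrable [set: T] (EFin \o (fun x => expabs c x * g x)).
Proof.
move=> c0 mg g1; have := integrable_expabs c0; apply: le_integrable.
- exact: measurableT.
- apply/measurable_EFinP; apply: measurable_fun_leb.
  by apply: measurable_funM => //; exact: measurable_expabs.
- by move=> x _ /=; rewrite lee_fin normrM ler_piMr.
Qed.

Lemma continuous_cosM (b : R) : continuous (fun x => cos (b * x)).
Proof.
move=> x; apply: differentiable_continuous; apply/derivable1_diffP; exact: ex_derive.
Qed.

Lemma continuous_sinM (b : R) : continuous (fun x => sin (b * x)).
Proof.
move=> x; apply: differentiable_continuous; apply/derivable1_diffP; exact: ex_derive.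
Qed.

Lemma Rintegral_expabs_cos (c b : R) : 0 < c ->
  \int[leb]_x (expabs c x * cos (b * x)) = 2 * c / (c ^+ 2 + b ^+ 2).
Proof.
move=> c0; have i1 := integrable_expabs c0.
have i2 : leb.-integrable [set: T] (EFin \o (fun x => expabs c x * cos (b * x))).
  apply: integrable_expabs_bounded => // [|x]; last exact: cos_max.
  by apply: continuous_measurable_fun; exact: continuous_cosM.
have f0 (x : R) : 0 <= 1 + 1 * cos (b * x) + 0 * sin (b * x).
  by rewrite mul1r mul0r addr0 -lerBlDl sub0r cos_geN1.
have := ge0_integral_expabs_trig c0 f0.
under eq_integral do rewrite mul1r mul0r addr0 mulrDr mulr1 EFinD.
rewrite integralD// integral_expabs// mul1r /Rintegral.
have := integrable_fin_num measurableT i2.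
by case: (integral _ _ _) => // r _ [/addrI].
Qed.

Lemma Rintegral_expabs_sin (c b : R) : 0 < c ->
  \int[leb]_x (expabs c x * sin (b * x)) = 0.
Proof.
move=> c0; have i1 := integrable_expabs c0.
have i2 : leb.-integrable [set: T] (EFin \o (fun x => expabs c x * sin (b * x))).
  apply: integrable_expabs_bounded => // [|x]; last exact: sin_max.
  by apply: continuous_measurable_fun; exact: continuous_sinM.
have f0 (x : R) : 0 <= 1 + 0 * cos (b * x) + 1 * sin (b * x).
  by rewrite mul1r mul0r addr0 -lerBlDl sub0r sin_geN1.
have := ge0_integral_expabs_trig c0 f0.
under eq_integral do rewrite mul1r mul0r addr0 mulrDr mulr1 EFinD.
rewrite integralD// integral_expabs// mul0r addr0 /Rintegral.
have := integrable_fin_num measurableT i2.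
case: (integral _ _ _) => // r _ [] /= H.
by apply: (addrI (2 / c)); rewrite H addr0.
Qed.

(** The Poisson kernel of the half-plane at height e, of total mass 1. With the 2 pi in the exponent
    of the Fourier kernel, it is the transform of exp (-2 pi e |xi|). *)
Definition poisson (e t : R) : R := e / (pi * (e ^+ 2 + t ^+ 2)).

Lemma poisson_ge0 e t : 0 <= e -> 0 <= poisson e t.
Proof. by move=> e0; rewrite divr_ge0// mulr_ge0 ?pi_ge0// addr_ge0// sqr_ge0. Qed.

Lemma poissonN e t : poisson e (- t) = poisson e t.
Proof. by rewrite /poisson sqrrN. Qed.

Lemma continuous_poisson e : 0 < e -> continuous (poisson e).
Proof.
move=> e0 x; apply: cvgM; first exact: cvg_cst.
apply: cvgV.
  by rewrite mulf_neq0 ?gt_eqF ?pi_gt0// ltr_pwDl ?sqr_ge0// exprn_gt0.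
apply: cvgM; first exact: cvg_cst.
by apply: cvgD; [exact: cvg_cst|exact: exprn_continuous].
Qed.

Lemma measurable_poisson e : 0 < e -> measurable_fun [set: R] (poisson e).
Proof. by move=> e0; apply: continuous_measurable_fun; exact: continuous_poisson. Qed.

Lemma is_derive_atan_poisson (e a x : R) : 0 < e ->
  is_derive x 1 (fun y => atan ((y - a) / e) / pi) (poisson e (x - a)).
Proof.
move=> e0; have e0' : e != 0 by rewrite gt_eqF.
have p0 : (pi : R) != 0 by rewrite gt_eqF ?pi_gt0.
have d0 : e ^+ 2 + (x - a) ^+ 2 != 0.
  by rewrite gt_eqF// ltr_pwDl ?sqr_ge0// exprn_gt0.
apply: is_derive_eq.
rewrite /GRing.scale/= /poisson; move: (pi : R) p0 => q q0; field.
by rewrite d0 q0 e0'.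
Qed.

Lemma cvg_atan_poisson (e : R) : 0 < e ->
  atan ((y - 0) / e) / pi @[y --> +oo] --> (2^-1 : R).
Proof.
move=> e0; have -> : 2^-1 = (pi / 2) / pi :> R.
  by rewrite mulrAC divff ?mul1r// gt_eqF ?pi_gt0.
apply: cvgMl.
apply: (@cvg_comp _ _ _ (fun y => (y - 0) / e) atan _ +oo); last exact: cvgy_atan.
apply: gt0_cvgMly; first by rewrite invr_gt0.
by under eq_fun do rewrite subr0; exact: cvg_id.
Qed.

Lemma integral_poisson (e a : R) : 0 < e ->
  (\int[leb]_x (poisson e ((x : R) - a)%R)%:E = 1%:E)%E.
Proof.
move=> e0.
rewrite (@ge0_integral_shift _ (EFin \o poisson e)); last 2 first.
- by apply/measurable_EFinP; exact: measurable_poisson.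
- by move=> x; rewrite lee_fin poisson_ge0// ltW.
rewrite ge0_integral_split0; last 2 first.
- exact: measurable_poisson.
- by move=> x; rewrite poisson_ge0// ltW.
under [X in (_ + X)%E]eq_integral do rewrite poissonN.
have dF (x : R) : is_derive x 1 (fun y => atan ((y - 0) / e) / pi) (poisson e x).
  by rewrite -{2}(subr0 x); exact: is_derive_atan_poisson.
rewrite (@ge0_FTC0y _ _ _ 2^-1 _ dF).
- by rewrite subrr mul0r atan0 mul0r subr0 -EFinD; congr EFin; field.
- by move=> x _; rewrite poisson_ge0// ltW.
- exact: continuous_poisson.
- exact: cvg_atan_poisson.
Qed.

Lemma integral_itv_poisson (e a b x : R) : 0 < e -> a < b ->
  (\int[leb]_(y in `]a, b]) (poisson e ((y : R) - x)%R)%:E =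
   (atan ((b - x) / e) / pi - atan ((a - x) / e) / pi)%:E)%E.
Proof.
move=> e0 ab.
have cp : continuous (fun y => poisson e (y - x)).
  move=> y; apply: (@continuous_comp _ _ _ (fun y => y - x) (poisson e));
    last exact: continuous_poisson.
  by apply: cvgB; [exact: cvg_id|exact: cvg_cst].
have mp : measurable_fun [set: R] (fun y => (poisson e (y - x))%:E).
  by apply/measurable_EFinP; exact: continuous_measurable_fun.
rewrite ge0_integral_leb//; last 2 first.
- exact: measurable_funTS.
- by move=> y _; rewrite lee_fin poisson_ge0// ltW.
rewrite integral_itv_obnd_cbnd; last exact: measurable_funTS.
have dF (y : R) := is_derive_atan_poisson x y e0.
rewrite (@continuous_FTC2 _ _ (fun y => atan ((y - x) / e) / pi))//.
- exact: continuous_subspaceT.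
- have cF : continuous (fun y => atan ((y - x) / e) / pi).
    move=> y; apply: differentiable_continuous; apply/derivable1_diffP.
    exact: ex_derive.
  by split=> [y _| |]; [exact: ex_derive|apply: cvg_at_right_filter; exact: cF|
    apply: cvg_at_left_filter; exact: cF].
- by move=> y _; rewrite derive1E derive_val.
Qed.

End kernels.

Lemma ge0_le_integral_lincomb (dX : measure_display) (X : measurableType dX)
    (K : realType) (m : {measure set X -> \bar K}) (c d : K) (h f g : X -> \bar K) :
  0 <= c -> 0 <= d ->
  measurable_fun [set: X] h -> measurable_fun [set: X] f -> measurable_fun [set: X] g ->
  (forall x, (0 <= h x)%E) -> (forall x, (0 <= f x)%E) -> (forall x, (0 <= g x)%E) ->
  (forall x, (h x <= c%:E * f x + d%:E * g x)%E) ->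
  (\int[m]_x h x <= c%:E * \int[m]_x f x + d%:E * \int[m]_x g x)%E.
Proof.
move=> c0 d0 mh mf mg h0 f0 g0 hfg.
have mcf : measurable_fun [set: X] (fun x => c%:E * f x)%E by exact: measurable_funeM.
have mdg : measurable_fun [set: X] (fun x => d%:E * g x)%E by exact: measurable_funeM.
rewrite -!ge0_integralZl// -ge0_integralD//; last 2 first.
- by move=> x _; rewrite mule_ge0.
- by move=> x _; rewrite mule_ge0.
by apply: ge0_le_integral => //; exact: emeasurable_funD.
Qed.

(** * The energy of a real function against the Poisson kernel *)

Section energy.
Context {R : realType}.
Local Notation T := (lebesgueType R).

Lemma measurable_id_leb : measurable_fun [set: T] (fun x : T => (x : R)).
Proof. by apply: measurable_fun_leb; exact: measurable_id. Qed.

Lemma measurable_fst_leb (u : T -> R) : measurable_fun [set: T] u ->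
  measurable_fun [set: T * T] (fun p => u p.1).
Proof. by move=> mu_; exact: (measurableT_comp mu_ measurable_fst). Qed.

Lemma measurable_snd_leb (u : T -> R) : measurable_fun [set: T] u ->
  measurable_fun [set: T * T] (fun p => u p.2).
Proof. by move=> mu_; exact: (measurableT_comp mu_ measurable_snd). Qed.

Lemma measurable_poisson_diff (e : R) : 0 < e ->
  measurable_fun [set: T * T] (fun p => poisson e ((p.2 : R) - (p.1 : R))).
Proof.
move=> e0.
have md : measurable_fun [set: T * T] (fun p => (p.2 : R) - (p.1 : R)).
  apply: measurable_funB.
    exact: (measurable_snd_leb measurable_id_leb).
  exact: (measurable_fst_leb measurable_id_leb).
exact: (measurableT_comp (measurable_poisson e0) md).
Qed.

(** Expanding the square gives 2 |u|^2 - 2 <P_e * u, u>, twice the loss of norm caused by the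
    damping. Written with increments of u it is visibly nonnegative and can be compared
    pointwise. *)
Definition energy (e : R) (u : T -> R) : \bar R :=
  (\int[leb]_x \int[leb]_y (poisson e ((y : R) - (x : R))%R * (u x - u y)^+ 2)%:E)%E.

Variables (e : R) (e0 : 0 < e).
Implicit Types (u v : T -> R).

Lemma measurable_energy_integrand u : measurable_fun [set: T] u ->
  measurable_fun [set: T * T] (fun p =>
    (poisson e ((p.2 : R) - (p.1 : R)) * (u p.1 - u p.2) ^+ 2)%:E).
Proof.
move=> m_u; apply/measurable_EFinP; apply: measurable_funM.
  exact: measurable_poisson_diff.
apply: measurable_funX; apply: measurable_funB.
  exact: measurable_fst_leb.
exact: measurable_snd_leb.
Qed.

Lemma energy_prod u : measurable_fun [set: T] u -> energy e u =
  (\int[leb \x leb]_p (poisson e ((p.2 : R) - (p.1 : R))%R * (u p.1 - u p.2) ^+ 2)%:E)%E.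
Proof.
move=> m_u; rewrite fubini_tonelli1//; first exact: measurable_energy_integrand.
by move=> p; rewrite lee_fin mulr_ge0 ?sqr_ge0// poisson_ge0// ltW.
Qed.

Lemma poisson_weight_fst (h : T -> \bar R) : measurable_fun [set: T] h ->
  (forall x, (0 <= h x)%E) ->
  (\int[leb]_x \int[leb]_y ((poisson e ((y : R) - (x : R))%R)%:E * h x) =
   \int[leb]_x h x)%E.
Proof.
move=> mh h0; apply: eq_integral => x _.
rewrite ge0_integralZr; [by rewrite integral_poisson// mul1e|by []| |..]; last first.
- exact: h0.
- by move=> y _; rewrite lee_fin poisson_ge0// ltW.
- apply/measurable_EFinP; apply: measurable_fun_leb.
  apply: continuous_measurable_fun => y.
  apply: (@continuous_comp _ _ _ (fun y => y - x) (poisson e)).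
    by apply: cvgB; [exact: cvg_id|exact: cvg_cst].
  exact: continuous_poisson.
Qed.

Lemma poisson_weight_snd (h : T -> \bar R) : measurable_fun [set: T] h ->
  (forall x, (0 <= h x)%E) ->
  (\int[leb]_x \int[leb]_y ((poisson e ((y : R) - (x : R))%R)%:E * h y) =
   \int[leb]_x h x)%E.
Proof.
move=> mh h0.
rewrite (fubini_tonelli (fun p : T * T => (poisson e ((p.2 : R) - (p.1 : R))%R)%:E * h p.2)%E)/=.
- rewrite -[RHS](poisson_weight_fst mh h0).
  apply: eq_integral => x _; apply: eq_integral => y _.
  by rewrite -poissonN opprB.
- apply: emeasurable_funM; first by apply/measurable_EFinP; exact: measurable_poisson_diff.
  exact: (measurableT_comp mh measurable_snd).
- by move=> p; rewrite mule_ge0// lee_fin poisson_ge0// ltW.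
Qed.

Lemma energy_ge0 u : (0 <= energy e u)%E.
Proof.
apply: integral_ge0 => x _; apply: integral_ge0 => y _.
by rewrite lee_fin mulr_ge0 ?sqr_ge0// poisson_ge0// ltW.
Qed.

Lemma le_energy (c d : R) (w u v : T -> R) : 0 <= c -> 0 <= d ->
  measurable_fun [set: T] w -> measurable_fun [set: T] u -> measurable_fun [set: T] v ->
  (forall x y, (w x - w y) ^+ 2 <= c * (u x - u y) ^+ 2 + d * (v x - v y) ^+ 2) ->
  (energy e w <= c%:E * energy e u + d%:E * energy e v)%E.
Proof.
move=> c0 d0 mw m_u mv wuv; rewrite !energy_prod//.
have h0 (u' : T -> R) (p : T * T) :
    (0 <= (poisson e ((p.2 : R) - (p.1 : R))%R * (u' p.1 - u' p.2) ^+ 2)%:E)%E.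
  by rewrite lee_fin mulr_ge0 ?sqr_ge0// poisson_ge0// ltW.
apply: ge0_le_integral_lincomb => //; try exact: measurable_energy_integrand.
move=> p; rewrite -!EFinM -EFinD lee_fin.
apply: le_trans (ler_wpM2l (poisson_ge0 _ (ltW e0)) (wuv p.1 p.2)) _.
by rewrite mulrDr mulrCA [X in _ + X <= _]mulrCA.
Qed.

(** This is (a - b)^2 <= 2 a^2 + 2 b^2 and the unit mass of the kernel in each variable. The bound
    does not depend on e, which is what makes density arguments possible. *)
Lemma energy_le_norm u : measurable_fun [set: T] u ->
  (energy e u <= 4%:E * \int[leb]_x ((u x) ^+ 2)%:E)%E.
Proof.
move=> m_u.
have mu2 : measurable_fun [set: T] (fun x => (u x ^+ 2)%:E).
  by apply/measurable_EFinP; exact: measurable_funX.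
have u0 x : (0 <= (u x ^+ 2)%:E)%E by rewrite lee_fin sqr_ge0.
pose h1 (p : T * T) := ((poisson e ((p.2 : R) - (p.1 : R))%R)%:E * (u p.1 ^+ 2)%:E)%E.
pose h2 (p : T * T) := ((poisson e ((p.2 : R) - (p.1 : R))%R)%:E * (u p.2 ^+ 2)%:E)%E.
have P0 (p : T * T) : 0 <= poisson e ((p.2 : R) - (p.1 : R)) by rewrite poisson_ge0// ltW.
have h10 p : (0 <= h1 p)%E by rewrite mule_ge0 ?lee_fin ?sqr_ge0.
have h20 p : (0 <= h2 p)%E by rewrite mule_ge0 ?lee_fin ?sqr_ge0.
have mp : measurable_fun [set: T * T] (fun p : T * T => (poisson e ((p.2 : R) - (p.1 : R)))%:E).
  by apply/measurable_EFinP; exact: measurable_poisson_diff.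
have mh1 : measurable_fun [set: T * T] h1.
  by apply: emeasurable_funM => //; exact: (measurableT_comp mu2 measurable_fst).
have mh2 : measurable_fun [set: T * T] h2.
  by apply: emeasurable_funM => //; exact: (measurableT_comp mu2 measurable_snd).
have -> : (4%:E * \int[leb]_x ((u x) ^+ 2)%:E =
   2%:E * \int[leb \x leb]_p h1 p + 2%:E * \int[leb \x leb]_p h2 p)%E.
  rewrite (fubini_tonelli1 h1)// (fubini_tonelli1 h2)//.
  rewrite [X in (_ = _ * X + _)%E](poisson_weight_fst mu2 u0).
  rewrite [X in (_ = _ + _ * X)%E](poisson_weight_snd mu2 u0).
  by rewrite -ge0_muleDl// -EFinD -natrD.
rewrite energy_prod//.
apply: ge0_le_integral_lincomb => //.
- exact: measurable_energy_integrand.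
- by move=> p; rewrite lee_fin mulr_ge0 ?sqr_ge0.
- move=> p; rewrite /h1 /h2 -!EFinM -EFinD lee_fin.
  rewrite [X in _ <= X + _]mulrCA [X in _ <= _ + X]mulrCA -mulrDr ler_wpM2l//.
  move: (u p.1) (u p.2) => a b.
  by rewrite -subr_ge0 (_ : _ - _ = (a + b) ^+ 2) ?sqr_ge0//; ring.
Qed.

End energy.

(** * Functions whose energy tends to 0; indicators of intervals *)

Section vanishing.
Context {R : realType}.
Local Notation T := (lebesgueType R).
Implicit Types (u v w : T -> R).

Lemma cvge0_nearP (a : nat -> \bar R) : (forall n, (0 <= a n)%E) ->
  a n @[n --> \oo] --> 0%E <-> (forall h : R, 0 < h -> \forall n \near \oo, (a n <= h%:E)%E).
Proof.
move=> a0; split=> [/fine_cvgP[afin aZ] h h0|H].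
  have /cvgr0Pnorm_le/(_ _ h0) := aZ.
  apply: filterS2 afin => n af /= /(le_trans (ler_norm _)).
  by rewrite -lee_fin fineK.
apply/fine_cvgP; split.
  apply: filterS (H 1 ltr01) => n /le_lt_trans -/(_ _ (ltry _)) an.
  by rewrite ge0_fin_numE.
apply/cvgr0Pnorm_le => h h0; apply: filterS (H h h0) => n an /=.
have af : a n \is a fin_num by rewrite ge0_fin_numE// (le_lt_trans an)// ltry.
by rewrite ger0_norm ?fine_ge0// -lee_fin fineK.
Qed.

Definition vanishing u := energy n.+1%:R^-1 u @[n --> \oo] --> 0%E.

Let e0 n : 0 < n.+1%:R^-1 :> R.
Proof. by rewrite invr_gt0. Qed.

(** This plays the part of linearity: domination of increments covers sums (c = d = 2), multiples (d
    = 0) and unions of sets (c = d = 1). *)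
Lemma vanishing_le (c d : R) w u v : 0 <= c -> 0 <= d ->
  measurable_fun [set: T] w -> measurable_fun [set: T] u -> measurable_fun [set: T] v ->
  (forall x y, (w x - w y) ^+ 2 <= c * (u x - u y) ^+ 2 + d * (v x - v y) ^+ 2) ->
  vanishing u -> vanishing v -> vanishing w.
Proof.
move=> c0 d0 mw m_u mv wuv vu vv.
apply: (@squeeze_cvge _ _ _ _ (fun=> 0%E) _
  (fun n => c%:E * energy n.+1%:R^-1 u + d%:E * energy n.+1%:R^-1 v)%E).
- by apply: nearW => n; rewrite energy_ge0//=; exact: le_energy.
- exact: cvg_cst.
- have -> : 0%E = (c%:E * 0 + d%:E * 0)%E :> \bar R by rewrite !mule0 adde0.
  apply: cvgeD; first by rewrite !mule0.
    by apply: cvgeZl; [|exact: vu].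
  by apply: cvgeZl; [|exact: vv].
Qed.

(** Write u = v + (u - v): the energy of v tends to 0, that of u - v is at most 4 |u - v|^2
    uniformly in e. *)
Lemma vanishing_closed u : measurable_fun [set: T] u ->
  (forall h : R, 0 < h -> exists v, [/\ measurable_fun [set: T] v, vanishing v &
    (\int[leb]_x ((u x - v x) ^+ 2)%:E <= h%:E)%E]) ->
  vanishing u.
Proof.
move=> m_u H; apply/cvge0_nearP => [n|h h0]; first exact: energy_ge0.
(* The two tolerances satisfy 2 (h/4) + 2 * 4 (h/16) = h. *)
have h16 : 0 < h / 16 by rewrite divr_gt0.
have h4 : 0 < h / 4 by rewrite divr_gt0.
have [v [mv vv uv]] := H _ h16.
move/cvge0_nearP : vv => /(_ (fun n => energy_ge0 (e0 n) v)) /(_ _ h4).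
apply: filterS => n vn.
have md : measurable_fun [set: T] (fun x => u x - v x) by exact: measurable_funB.
apply: (@le_trans _ _ (2%:E * energy n.+1%:R^-1 v +
   2%:E * energy n.+1%:R^-1 (fun x => u x - v x)%R)%E).
  apply: le_energy => // x y.
  move: (u x) (u y) (v x) (v y) => a b c d.
  by rewrite -subr_ge0 (_ : _ - _ = ((c - d) - (a - c - (b - d))) ^+ 2) ?sqr_ge0//; ring.
apply: (@le_trans _ _ (2%:E * (h / 4)%:E + 2%:E * (4%:E * (h / 16)%:E))%E).
  apply: leeD; first by rewrite lee_pmul2l.
  rewrite lee_pmul2l//; apply: le_trans (energy_le_norm (e0 n) md) _.
  by rewrite lee_pmul2l.
by rewrite -!EFinM -EFinD lee_fin; lra.
Qed.

Lemma vanishing0 : vanishing (fun=> 0).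
Proof.
rewrite /vanishing (_ : (fun n => _) = fun=> 0%E); first exact: cvg_cst.
apply/funext => n; rewrite /energy integral0_eq// => x _.
by rewrite integral0_eq// => y _; rewrite subrr expr0n mulr0.
Qed.

Lemma measurable_indic_leb (E : set R) : lebesgue_measurable E ->
  measurable_fun [set: T] (\1_E : T -> R).
Proof. by move=> mE; exact: measurable_indic. Qed.

(** If exactly one of x and y lies in the union, then exactly one of them lies in E, or exactly one
    in F. *)
Lemma vanishing_indicU (E F : set R) : lebesgue_measurable E -> lebesgue_measurable F ->
  vanishing \1_E -> vanishing \1_F -> vanishing \1_(E `|` F).
Proof.
move=> mE mF vE vF.
apply: (@vanishing_le 1 1 _ \1_E \1_F) => //; try exact: measurable_indic_leb.
  by apply: measurable_indic_leb; exact: measurableU.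
move=> x y; rewrite !mul1r !indicE !in_setU.
by case: (x \in E); case: (y \in E); case: (x \in F); case: (y \in F) => /=;
  rewrite ?mulr1n ?mulr0n; lra.
Qed.

Lemma integral_indic_leb (E : set R) : lebesgue_measurable E ->
  (\int[leb]_x (\1_E x)%:E = leb E)%E.
Proof. by move=> mE; rewrite (@integral_indic _ T R leb setT measurableT E)// setIT. Qed.

Lemma integrable_indic_leb (E : set R) : lebesgue_measurable E -> (leb E < +oo)%E ->
  leb.-integrable [set: T] (fun x => (\1_E x)%:E).
Proof.
move=> mE Efin; apply/integrableP; split.
  by apply/measurable_EFinP; exact: measurable_indic_leb.
rewrite (_ : (\int[_]_x _)%E = leb E)//.
rewrite -integral_indic_leb//; apply: eq_integral => x _.
by rewrite gee0_abs// lee_fin indicE.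
Qed.

Lemma leb_itv_oc (a b : R) : a <= b -> leb `]a, b] = (b - a)%:E.
Proof.
move=> ab; rewrite lebE lebesgue_measure_itv/= lte_fin.
case: ltP => // ba; rewrite (_ : b = a) ?subrr//; apply/eqP; rewrite eq_le ba.
exact: ab.
Qed.

Lemma leb_set1 (a : R) : leb [set a] = 0%E.
Proof. by rewrite lebE lebesgue_measure_set1. Qed.

(** The mass that the Poisson kernel centred at x, for e = 1/(n+1), leaves outside ]a, b], read off
    the arctangent primitive. *)
Definition itv_gap (a b : R) (n : nat) (x : R) : R :=
  1 - (atan ((b - x) / n.+1%:R^-1) / pi - atan ((a - x) / n.+1%:R^-1) / pi).

Lemma itv_gap_bounds (a b x : R) n : a < b -> 0 <= itv_gap a b n x <= 1.
Proof.
move=> ab; rewrite /itv_gap -mulrBl.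
rewrite subr_ge0 lerBlDr lerDl ler_pdivrMr ?pi_gt0// mul1r; apply/andP; split.
  have := atan_ltpi2 ((b - x) / n.+1%:R^-1).
  have := atan_gtNpi2 ((a - x) / n.+1%:R^-1); lra.
rewrite divr_ge0 ?pi_ge0// subr_ge0; apply: le_atan.
by rewrite invrK ler_wpM2r// lerD2r ltW.
Qed.

Lemma cvg_itv_gap (a b x : R) : a < x < b -> itv_gap a b n x @[n --> \oo] --> 0.
Proof.
move=> /andP[ax xb]; rewrite /itv_gap.
have cn (d : R) : 0 < d -> atan (d / n.+1%:R^-1) / pi @[n --> \oo] --> (2^-1 : R).
  move=> d0; have -> : 2^-1 = (pi / 2) / pi :> R.
    by rewrite mulrAC divff ?mul1r// gt_eqF ?pi_gt0.
  apply: cvgMl.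
  apply: (@cvg_comp _ _ _ (fun n => d / n.+1%:R^-1) atan _ +oo); last exact: cvgy_atan.
  under eq_fun do rewrite invrK.
  apply: (@cvg_comp _ _ _ (fun n : nat => n.+1%:R : R) (fun z => d * z) _ +oo).
    by rewrite (cvg_shiftS (fun n => n%:R : R)); exact: cvgr_idn.
  by apply: gt0_cvgMry.
rewrite -[X in _ --> X](_ : 1 - (2^-1 - - 2^-1) = 0); last by field.
apply: cvgB; first exact: cvg_cst.
apply: cvgB; first by apply: cn; rewrite subr_gt0.
have -> : (fun n => atan ((a - x) / n.+1%:R^-1) / pi) = (fun n => - (atan ((x - a) / n.+1%:R^-1) / pi)).
  by apply/funext => n; rewrite -opprB mulNr atanN mulNr.
by apply: cvgN; apply: cn; rewrite subr_gt0.
Qed.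

(** The square (1_I x - 1_I y)^2 is 1_I x (1 - 1_I y) plus the same with x and y exchanged. The two
    halves have the same integral, so the energy is twice the integral of [itv_gap] over I, and
    dominated convergence applies. *)
Lemma vanishing_itv (a b : R) : vanishing (\1_`]a, b] : T -> R).
Proof.
have [ab|ba] := ltP a b; last first.
  rewrite set_itv_ge -?leNgt ?bnd_simp// indic0; exact: vanishing0.
pose I := `]a, b]%classic.
have mI : lebesgue_measurable I by apply: measurable_leb; exact: measurable_itv.
have mI1 : measurable_fun [set: T] (\1_I : T -> R) by exact: measurable_indic_leb.
pose k n (p : T * T) := (poisson n.+1%:R^-1 ((p.2 : R) - (p.1 : R)) *
  (\1_I p.1 * (1 - \1_I p.2)))%:E.
have P0 n z : 0 <= poisson n.+1%:R^-1 z :> R by rewrite poisson_ge0// ltW.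
have I1 (x : R) : 0 <= 1 - \1_I x :> R by rewrite indicE; case: (_ \in _); rewrite /= ?subr0 ?subrr.
have I0 (x : R) : 0 <= \1_I x :> R by rewrite indicE.
have k0 n p : (0 <= k n p)%E.
  by rewrite lee_fin; apply: mulr_ge0; [exact: P0|apply: mulr_ge0].
have mk n : measurable_fun [set: T * T] (k n).
  apply/measurable_EFinP; apply: measurable_funM; first exact: measurable_poisson_diff.
  apply: measurable_funM; first exact: measurable_fst_leb.
  by apply: measurable_funB; [exact: measurable_cst|exact: measurable_snd_leb].
have mks n : measurable_fun [set: T * T] (fun p => k n (p.2, p.1)).
  apply/measurable_EFinP; apply: measurable_funM.
    rewrite (_ : (fun p => _) = (fun p : T * T => poisson n.+1%:R^-1 ((p.2 : R) - (p.1 : R)))).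
      exact: measurable_poisson_diff.
    by apply/funext => p /=; rewrite -poissonN opprB.
  apply: measurable_funM; first exact: measurable_snd_leb.
  by apply: measurable_funB; [exact: measurable_cst|exact: measurable_fst_leb].
have kE n (x : R) : (\int[leb]_y k n (x, y) = (\1_I x * itv_gap a b n x)%:E)%E.
  have mP : measurable_fun [set: T] (fun y : T => (poisson n.+1%:R^-1 ((y : R) - x))%:E).
    apply/measurable_EFinP; apply: measurable_fun_leb.
    apply: continuous_measurable_fun => y.
    apply: (@continuous_comp _ _ _ (fun y => y - x) (poisson n.+1%:R^-1)).
      by apply: cvgB; [exact: cvg_id|exact: cvg_cst].
    exact: continuous_poisson.
  pose h1 (y : T) := ((poisson n.+1%:R^-1 ((y : R) - x)%R)%:E * (\1_I y)%:E)%E.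
  pose h2 (y : T) := ((poisson n.+1%:R^-1 ((y : R) - x)%R)%:E * (1 - \1_I y)%:E)%E.
  have h10 y : (0 <= h1 y)%E by rewrite mule_ge0// lee_fin.
  have h20 y : (0 <= h2 y)%E by rewrite mule_ge0// lee_fin.
  have mh1 : measurable_fun [set: T] h1.
    by apply: emeasurable_funM; [exact: mP|exact/measurable_EFinP].
  have mh2 : measurable_fun [set: T] h2.
    apply: emeasurable_funM; [exact: mP|apply/measurable_EFinP].
    by apply: measurable_funB; [exact: measurable_cst|exact: mI1].
  have i1 : (\int[leb]_y h1 y = (1 - itv_gap a b n x)%:E)%E.
    rewrite /itv_gap subKr -integral_itv_poisson// [RHS]integral_mkcond.
    apply: eq_integral => y _; rewrite /h1 patchE indicE.
    by case: (y \in _); rewrite ?mule1 ?mule0.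
  have := integral_poisson x (e0 n).
  have -> : (\int[leb]_y (poisson n.+1%:R^-1 ((y : R) - x)%R)%:E =
      \int[leb]_y h1 y + \int[leb]_y h2 y)%E.
    rewrite -ge0_integralD//; apply: eq_integral => y _.
    by rewrite /h1 /h2 -!EFinM -EFinD -mulrDr subrKC mulr1.
  rewrite i1 => H.
  have i2 : (\int[leb]_y h2 y = (itv_gap a b n x)%:E)%E.
    move: H; case: (integral _ _ _) => // r [] H; congr EFin.
    by move: H; lra.
  rewrite EFinM -i2 -ge0_integralZl//.
  by apply: eq_integral => y _; rewrite /k /h2 /= -!EFinM; congr EFin; ring.
have energyE n : energy n.+1%:R^-1 (\1_I : T -> R) =
    (2%:E * \int[leb]_x (\1_I x * itv_gap a b n x)%:E)%E.
  transitivity (\int[leb \x leb]_p (k n p) + \int[leb \x leb]_p (k n (p.2, p.1)))%E.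
    rewrite -ge0_integralD//.
    rewrite energy_prod//.
    apply: eq_integral => -[x y] _; rewrite /k /= -EFinD; congr EFin.
    rewrite -(opprB (x : R) (y : R)) poissonN -mulrDr; congr (_ * _).
    by rewrite !indicE; case: (x \in I); case: (y \in I); rewrite /= ?mulr1n ?mulr0n; lra.
  rewrite (fubini_tonelli1 (k n))// (fubini_tonelli2 (fun p => k n (p.2, p.1)))//.
  rewrite /= -mule2n mule_natl.
  by congr (_ *+ 2)%E; apply: eq_integral => x _; exact: kE.
rewrite /vanishing (funext energyE) -(mule0 2%:E); apply: cvgeZl => //.
have := @dominated_convergence _ T R leb [set: T] measurableT
  (fun n x => (\1_I x * itv_gap a b n x)%:E) (cst 0%E) (fun x => (\1_I x)%:E).
case.
- move=> n; apply: (@eq_measurable_fun _ _ _ _ _ (fun x => (\int[leb]_y k n (x, y))%E)).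
    by move=> x _; exact: kE.
  exact: measurable_fun_fubini_tonelli_F.
- exact: measurable_cst.
(* At x = b, which belongs to ]a, b], the gap tends to 1/2; the endpoint is put in the exceptional
   null set. *)
- exists [set b]; split; first by apply: measurable_leb.
    exact: leb_set1.
  move=> x /= H; apply: contrapT => xb; apply: H => _.
  have [xI|xI] := boolP (x \in I).
    rewrite (_ : (fun n => _) = EFin \o (fun n => itv_gap a b n x)); last first.
      by apply/funext => n; rewrite indicE xI mul1r.
    apply: cvg_EFin; first exact: nearW.
    apply: cvg_itv_gap; move: xI; rewrite inE /I/= in_itv/= => /andP[-> xb'] /=.
    rewrite lt_neqAle xb' andbT; apply/eqP; exact: xb.
  rewrite (_ : (fun n => _) = fun=> 0%E); first exact: cvg_cst.
  by apply/funext => n; rewrite indicE (negbTE xI) mul0r.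
- by apply: integrable_indic_leb; rewrite // leb_itv_oc ?ltry// ltW.
- apply: aeW => x n _; have /andP[g0 g1] := itv_gap_bounds x n ab.
  by rewrite lee_fin normrM (ger0_norm (I0 x)) ler_piMr// ger0_norm.
- by move=> _ _; rewrite integral0.
Qed.

End vanishing.

(** * From intervals to all square-integrable functions *)

Section vanishing_L2.
Context {R : realType}.
Local Notation T := (lebesgueType R).
Implicit Types (u v w : T -> R).

Lemma integral_sqr_indicB (E F : set R) : lebesgue_measurable E -> lebesgue_measurable F ->
  (\int[leb]_x ((\1_E x - \1_F x) ^+ 2 : R)%:E <= leb (E `\` F) + leb (F `\` E))%E.
Proof.
move=> mE mF; have mEF : lebesgue_measurable (E `\` F) by exact: measurableD.
have mFE : lebesgue_measurable (F `\` E) by exact: measurableD.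
have mi (G : set R) : lebesgue_measurable G -> measurable_fun [set: T] (fun x => (\1_G x)%:E : \bar R).
  by move=> mG; apply/measurable_EFinP; exact: measurable_indic_leb.
rewrite -(integral_indic_leb mEF) -(integral_indic_leb mFE).
rewrite -(@ge0_integralD _ _ _ _ _ measurableT _ _ _ (mi _ mEF) _ (mi _ mFE)); last 2 first.
- by move=> x _; rewrite lee_fin indicE.
- by move=> x _; rewrite lee_fin indicE.
rewrite le_eqVlt; apply/orP; left; apply/eqP; apply: eq_integral => x _.
rewrite -EFinD; congr EFin; rewrite !indicE !in_setD.
by case: (x \in E); case: (x \in F); rewrite /= ?mulr1n ?mulr0n; lra.
Qed.

Lemma vanishing_bigU (F : nat -> set R) n :
  (forall k, exists ab : R * R, F k = `]ab.1, ab.2]%classic) ->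
  vanishing (\1_(\big[setU/set0]_(k < n) F k) : T -> R).
Proof.
move=> FI; have mF k : lebesgue_measurable (F k).
  by have [ab ->] := FI k; apply: measurable_leb; exact: measurable_itv.
elim: n => [|n ih]; first by rewrite big_ord0 indic0; exact: vanishing0.
rewrite big_ord_recr/=; apply: vanishing_indicU.
- by apply: (@bigsetU_measurable _ T) => k _; exact: mF.
- exact: mF.
- exact: ih.
- by have [ab ->] := FI n; exact: vanishing_itv.
Qed.

(** E is approximated by a finite union of half-open intervals: a countable cover of E exceeds it by
    at most h/2 in measure, and cutting the cover at a finite stage loses at most h/2, by continuity
    from above. *)
Lemma vanishing_indic (E : set R) : lebesgue_measurable E -> (leb E < +oo)%E ->
  vanishing (\1_E : T -> R).
Proof.
move=> mE Efin; apply: vanishing_closed; first exact: measurable_indic_leb.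
move=> h h0.
have Ef : leb E \is a fin_num by rewrite ge0_fin_numE.
have h2 : 0 < h / 2 by rewrite divr_gt0.
(* The completed measure is the outer measure itself, so [leb E] unfolds to this infimum over covers
   by half-open intervals. *)
have : ereal_inf [set (\sum_(0 <= k <oo) wlength idfun (A k))%E | A in
    @measurable_cover _ (ocitv_type R) E] \is a fin_num by exact: Ef.
move/lb_ereal_inf_adherent => /(_ _ h2)[_/= [F EF <-] hF].
pose U := \bigcup_k F k.
have FI k : exists ab : R * R, F k = `]ab.1, ab.2]%classic.
  by have [/(_ k)[ab _ <-] _] := EF; exists ab.
have mF k : lebesgue_measurable (F k).
  by have [ab ->] := FI k; apply: measurable_leb; exact: measurable_itv.
have mU : lebesgue_measurable U by exact: bigcupT_measurable.
have EU : E `<=` U by have [] := EF.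
have mV n : lebesgue_measurable (\big[setU/set0]_(k < n) F k).
  by apply: (@bigsetU_measurable _ T) => k _; exact: mF.
have lU : (leb U < leb E + (h / 2)%:E)%E.
  apply: le_lt_trans hF.
  apply: le_trans (outer_measure_sigma_subadditive (wlength idfun)^*%mu F) _.
  apply: lee_nneseries => // n _.
  rewrite -((measurable_mu_extE (wlength idfun)) (F n))//; have [/(_ n)] := EF.
  exact.
have Ufin : (leb U < +oo)%E.
  by apply: lt_trans lU _; rewrite lte_add_pinfty// ltry.
have lUE : (leb (U `\` E) <= (h / 2)%:E)%E.
  rewrite (@measureD _ T)// setIC (setIidl EU).
  rewrite leeBlDl//; exact: ltW.
have [n hn] : exists n, (leb (U `\` \big[setU/set0]_(k < n) F k) <= (h / 2)%:E)%E.
  pose D n := U `\` \big[setU/set0]_(k < n) F k.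
  have mD n : lebesgue_measurable (D n) by exact: (measurableD mU (mV n)).
  have D0 : \bigcap_n D n = set0.
    rewrite -subset0 => x Dx; have [[k _ Fx] _] := Dx 0%N I.
    have [_] := Dx k.+1 I; apply; rewrite big_ord_recr/=; by right.
  have cD : (leb \o D) n @[n --> \oo] --> 0%E.
    rewrite -(_ : leb (\bigcap_n D n) = 0%E); last by rewrite D0 measure0.
    apply: (@nonincreasing_cvg_mu _ T).
    - by rewrite /D big_ord0 setD0.
    - exact: mD.
    - exact: bigcapT_measurable.
    - move=> m p mp; apply/subsetPset; apply: setDS.
      exact: subset_bigsetU.
  move/cvge0_nearP : cD => /(_ (fun n => measure_ge0 _ _)) /(_ _ h2) [N _ HN].
  by exists N; apply: HN => /=.
exists (\1_(\big[setU/set0]_(k < n) F k)); split.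
- exact: measurable_indic_leb.
- exact: vanishing_bigU.
- apply: le_trans (integral_sqr_indicB mE (mV n)) _.
  rewrite (splitr h) EFinD leeD//.
    apply: le_trans hn; apply: le_measure; rewrite ?inE.
    + exact: (measurableD mE (mV n)).
    + exact: (measurableD mU (mV n)).
    + exact: setSD.
  apply: le_trans lUE; apply: le_measure; rewrite ?inE.
  + exact: (measurableD (mV n) mE).
  + exact: (measurableD mU mE).
  + apply: setSD; exact: bigsetU_bigcup.
Qed.

Lemma vanishingZ (c : R) u : measurable_fun [set: T] u -> vanishing u -> vanishing (fun x => c * u x).
Proof.
move=> m_u vu; apply: (@vanishing_le _ (c ^+ 2) 0 _ u u); [exact: sqr_ge0|exact: lexx|
  by apply: measurable_funM; [exact: measurable_cst|exact: m_u]|exact: m_u|exact: m_u| |exact: vu|exact: vu].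
by move=> x y; rewrite mul0r addr0 -mulrBr exprMn.
Qed.

Lemma vanishingD u v : measurable_fun [set: T] u -> measurable_fun [set: T] v ->
  vanishing u -> vanishing v -> vanishing (fun x => u x + v x).
Proof.
move=> m_u mv vu vv; apply: (@vanishing_le _ 2 2 _ u v); [by []|by []|
  by apply: measurable_funD; [exact: m_u|exact: mv]|exact: m_u|exact: mv| |exact: vu|exact: vv].
move=> x y; move: (u x) (u y) (v x) (v y) => a b c d.
by rewrite -subr_ge0 (_ : _ - _ = ((a - b) - (c - d)) ^+ 2) ?sqr_ge0//; ring.
Qed.

Lemma vanishing_sum (I : Type) (r : seq I) (f : I -> T -> R) :
  (forall i, measurable_fun [set: T] (f i)) -> (forall i, vanishing (f i)) ->
  vanishing (fun x => \sum_(i <- r) f i x).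
Proof.
move=> mf vf; elim: r => [|i r ih].
  rewrite (_ : (fun x => _) = fun=> 0); first exact: vanishing0.
  by apply/funext => x; rewrite big_nil.
rewrite (_ : (fun x => _) = fun x => f i x + \sum_(j <- r) f j x); last first.
  by apply/funext => x; rewrite big_cons.
apply: vanishingD; [exact: mf|exact: measurable_sum|exact: vf|exact: ih].
Qed.

Import HBNNSimple.

Lemma vanishing_nnsfun (f : {nnsfun T >-> R}) :
  (\int[leb]_x ((f x) ^+ 2)%:E < +oo)%E -> vanishing f.
Proof.
move=> ffin.
have mE (y : R) : lebesgue_measurable (f @^-1` [set y]).
  exact: measurable_funPTI.
rewrite (_ : (f : T -> R) = fun x => \sum_(y <- finmap.enum_fset (fset_set (range f))) y * \1_(f @^-1` [set y]) x); last first.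
  by apply/funext => x; rewrite fimfunE fsbig_finite.
apply: vanishing_sum => y.
  by apply: measurable_funM; [exact: measurable_cst|exact: measurable_indic_leb].
(* The value 0 is set apart because its level set may have infinite measure. For the other values
   Chebyshev's inequality bounds the measure of the level set by the integral of f^2 divided by
   y^2. *)
have [->|y0] := eqVneq y 0.
  by under eq_fun do rewrite mul0r; exact: vanishing0.
apply: vanishingZ; first exact: measurable_indic_leb.
apply: vanishing_indic; first exact: mE.
have y20 : 0 < y ^+ 2 by rewrite exprn_even_gt0.
have y2E : (0 < (y ^+ 2)%:E)%E by rewrite lte_fin.
rewrite -(@lte_pmul2l _ (y ^+ 2)%:E)// gt0_muley//.
apply: le_lt_trans ffin.
have mi : measurable_fun [set: T] (fun x => (\1_(f @^-1` [set y]) x)%:E : \bar R).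
  by apply/measurable_EFinP; exact: measurable_indic_leb.
have i0 (x : T) : [set: T] x -> (0 <= (\1_(f @^-1` [set y]) x : R)%:E)%E.
  by rewrite lee_fin indicE.
have mf2 : measurable_fun [set: T] (fun x => ((f x) ^+ 2)%:E).
  by apply/measurable_EFinP; exact: measurable_funX.
rewrite -(integral_indic_leb (mE y)).
rewrite -ge0_integralZl; [|exact: measurableT|exact: mi|exact: i0|exact: (ltW y2E)].
apply: ge0_le_integral; [exact: measurableT| |exact: measurable_funeM|exact: mf2| ].
  by move=> x _; rewrite -EFinM lee_fin mulr_ge0 ?indicE// ltW.
move=> x _; rewrite -EFinM lee_fin indicE.
have [/[!inE] xy|_] := boolP (x \in _); last by rewrite mulr0 sqr_ge0.
by rewrite mulr1 -(_ : f x = y).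
Qed.

(** The simple approximations satisfy 0 <= s_n <= u, so (u - s_n)^2 is dominated by u^2 and s_n
    tends to u in L^2. *)
Lemma vanishing_ge0 u : measurable_fun [set: T] u -> (forall x, 0 <= u x) ->
  (\int[leb]_x ((u x) ^+ 2)%:E < +oo)%E -> vanishing u.
Proof.
move=> m_u u0 ufin; apply: vanishing_closed; first exact: m_u.
move=> h h0.
have mEu : measurable_fun [set: T] (EFin \o u) by exact/measurable_EFinP.
pose s := nnsfun_approx measurableT mEu.
have Eu0 (x : T) : [set: T] x -> (0 <= (EFin \o u) x)%E by rewrite lee_fin.
have su n x : s n x <= u x.
  by rewrite -lee_fin /s nnsfun_approxE; exact: le_approx.
have s0 n x : 0 <= s n x by [].
have ms n : measurable_fun [set: T] (s n) by exact: measurable_funPT.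
have cs x : s n x @[n --> \oo] --> u x.
  have /fine_cvgP[_] := @cvg_nnsfun_approx _ _ _ _ measurableT _ mEu Eu0 x I.
  exact.
have ssu n x : 0 <= (u x - s n x) ^+ 2 <= u x ^+ 2.
  by rewrite sqr_ge0/= ler_sqr ?nnegrE ?u0 ?subr_ge0 ?su// lerBlDr lerDl.
have mu2 : measurable_fun [set: T] (fun x => u x ^+ 2) by exact: measurable_funX.
have H : (\int[leb]_x ((u x - s n x) ^+ 2)%:E @[n --> \oo] --> 0)%E.
  have := @dominated_convergence _ T R leb [set: T] measurableT
    (fun n x => ((u x - s n x) ^+ 2)%:E) (cst 0%E) (fun x => (u x ^+ 2)%:E).
  case.
  - move=> n; apply/measurable_EFinP; apply: measurable_funX.
    by apply: measurable_funB; [exact: m_u|exact: ms].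
  - exact: measurable_cst.
  - apply: aeW => x _; apply: cvg_EFin; first exact: nearW.
    rewrite -(_ : (u x - u x) * (u x - u x) = 0); last by rewrite subrr mul0r.
    by under eq_fun do rewrite expr2; apply: cvgM; (apply: cvgB; [exact: cvg_cst|exact: cs]).
  - apply/integrableP; split; first exact/measurable_EFinP.
    by under eq_integral do rewrite gee0_abs ?lee_fin ?sqr_ge0//.
  - apply: aeW => x n _; have /andP[s1 s2] := ssu n x.
    by rewrite gee0_abs lee_fin.
  - by move=> _ _; rewrite integral0.
have I0 n : (0 <= \int[leb]_x ((u x - s n x) ^+ 2)%:E)%E.
  by apply: integral_ge0 => x _; rewrite lee_fin sqr_ge0.
have [N _ HN] := (cvge0_nearP I0).1 H _ h0.
exists (s N); split; [exact: ms| |by apply: HN => /=].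
apply: vanishing_nnsfun; apply: le_lt_trans ufin.
apply: ge0_le_integral; [exact: measurableT| | | | ].
- by move=> x _; rewrite lee_fin sqr_ge0.
- by apply/measurable_EFinP; apply: measurable_funX; exact: ms.
- exact/measurable_EFinP.
- by move=> x _; rewrite lee_fin ler_sqr ?nnegrE.
Qed.

Lemma vanishing_L2 u : measurable_fun [set: T] u ->
  (\int[leb]_x ((u x) ^+ 2)%:E < +oo)%E -> vanishing u.
Proof.
move=> m_u ufin.
pose p x := Num.max (u x) 0; pose q x := Num.max (- u x) 0.
have mp : measurable_fun [set: T] p by apply: measurable_maxr; [exact: m_u|exact: measurable_cst].
have mN : measurable_fun [set: T] (fun x => - u x).
  exact: (measurableT_comp (@oppr_measurable R setT) m_u).
have mq : measurable_fun [set: T] q by apply: measurable_maxr; [exact: mN|exact: measurable_cst].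
rewrite (_ : u = fun x => p x + -1 * q x); last first.
  by apply/funext => x; rewrite /p /q !maxEle; case: ifP; case: ifP; lra.
have mu2 : measurable_fun [set: T] (fun x => (u x ^+ 2)%:E).
  by apply/measurable_EFinP; exact: measurable_funX.
have bnd (v : T -> R) : measurable_fun [set: T] v -> (forall x, v x ^+ 2 <= u x ^+ 2) ->
    (\int[leb]_x ((v x) ^+ 2)%:E < +oo)%E.
  move=> mv vu; apply: le_lt_trans ufin.
  apply: ge0_le_integral; [exact: measurableT| | | | ].
  - by move=> x _; rewrite lee_fin sqr_ge0.
  - by apply/measurable_EFinP; apply: measurable_funX; exact: mv.
  - exact: mu2.
  - by move=> x _; rewrite lee_fin vu.
apply: vanishingD; [exact: mp| | |].
- by apply: measurable_funM; [exact: measurable_cst|exact: mq].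
- apply: vanishing_ge0; [exact: mp| |apply: bnd; first exact: mp].
    by move=> x; rewrite le_max lexx orbT.
  by move=> x; rewrite /p maxEle; case: ifP => _; rewrite // expr0n sqr_ge0.
- apply: vanishingZ; first exact: mq.
  apply: vanishing_ge0; [exact: mq| |apply: bnd; first exact: mq].
    by move=> x; rewrite le_max lexx orbT.
  by move=> x; rewrite /q maxEle; case: ifP => _; rewrite ?sqrrN// expr0n sqr_ge0.
Qed.

End vanishing_L2.

(** * Complex square-integrable functions *)

Section complex_algebra.
Context {R : realType}.
Implicit Types z w : R[i].
Local Notation Re := complex.Re.
Local Notation Im := complex.Im.

Lemma cReD z w : Re (z + w) = Re z + Re w. Proof. by case: z; case: w. Qed.
Lemma cImD z w : Im (z + w) = Im z + Im w. Proof. by case: z; case: w. Qed.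
Lemma cReN z : Re (- z) = - Re z. Proof. by case: z. Qed.
Lemma cImN z : Im (- z) = - Im z. Proof. by case: z. Qed.
Lemma cReM z w : Re (z * w) = Re z * Re w - Im z * Im w.
Proof. by case: z; case: w. Qed.
Lemma cImM z w : Im (z * w) = Re z * Im w + Im z * Re w.
Proof. by case: z => a b; case: w. Qed.
(* [z^*] is [Num.conj z] here; [conjc z] is convertible to it. *)
Lemma conjcE z : z^* = conjc z. Proof. by []. Qed.

Lemma cReJ z : Re z^* = Re z. Proof. by rewrite conjcE; case: z. Qed.
Lemma cImJ z : Im z^* = - Im z. Proof. by rewrite conjcE; case: z. Qed.

Lemma conjcD z w : (z + w)^* = z^* + w^*. Proof. exact: rmorphD. Qed.
Lemma conjcM z w : (z * w)^* = z^* * w^*. Proof. exact: rmorphM. Qed.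
Lemma conjc_sum (I : Type) (r : seq I) (f : I -> R[i]) :
  (\sum_(i <- r) f i)^* = \sum_(i <- r) (f i)^*.
Proof. exact: rmorph_sum. Qed.

Lemma cReC (a : R) : Re a%:C = a. Proof. by []. Qed.
Lemma cImC (a : R) : Im a%:C = 0. Proof. by []. Qed.

Lemma complexP z w : Re z = Re w -> Im z = Im w -> z = w.
Proof. by case: z => a b; case: w => c d /= -> ->. Qed.

Lemma normc_ge0 z : 0 <= normc z. Proof. by case: z => a b; exact: sqrtr_ge0. Qed.

Lemma sqr_normcE z : normc z ^+ 2 = Re z ^+ 2 + Im z ^+ 2.
Proof. by case: z => a b /=; rewrite sqr_sqrtr// addr_ge0// sqr_ge0. Qed.

Lemma normc_conj z : normc z^* = normc z. Proof. by rewrite conjcE; case: z => a b /=; rewrite sqrrN. Qed.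

Lemma normc_real (a : R) : normc a%:C = `|a|.
Proof. by rewrite /= expr0n addr0 sqrtr_sqr. Qed.

Lemma normRe_le z : `|Re z| <= normc z.
Proof.
by rewrite -(@ler_pXn2r _ 2)// ?nnegrE ?normc_ge0// sqr_normcE real_normK ?num_real// lerDl sqr_ge0.
Qed.

Lemma normIm_le z : `|Im z| <= normc z.
Proof.
by rewrite -(@ler_pXn2r _ 2)// ?nnegrE ?normc_ge0// sqr_normcE real_normK ?num_real// lerDr sqr_ge0.
Qed.

Lemma normc_le_ReIm z : normc z <= `|Re z| + `|Im z|.
Proof.
rewrite -(@ler_pXn2r _ 2)// ?nnegrE ?normc_ge0 ?addr_ge0// sqr_normcE sqrrD.
by rewrite !real_normK ?num_real// lerD2r lerDl mulrn_wge0// mulr_ge0.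
Qed.

Lemma normcM_le z w : normc (z * w) <= normc z ^+ 2 + normc w ^+ 2.
Proof.
rewrite ComplexField.Normc.normcM -subr_ge0.
have := sqr_ge0 (normc z - normc w); have := sqr_ge0 (normc z); have := sqr_ge0 (normc w).
nra.
Qed.

Lemma sqr_normcD_le z w : normc (z + w) ^+ 2 <= 2 * normc z ^+ 2 + 2 * normc w ^+ 2.
Proof.
rewrite !sqr_normcE cReD cImD; move: (Re z) (Im z) (Re w) (Im w) => a b c d.
by rewrite -subr_ge0 (_ : _ - _ = (a - c) ^+ 2 + (b - d) ^+ 2) ?addr_ge0 ?sqr_ge0//; ring.
Qed.

Lemma mulcJ z : z * z^* = (normc z ^+ 2)%:C.
Proof.
by apply: complexP; rewrite ?cReM ?cImM cReJ cImJ /= ?sqr_normcE; ring.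
Qed.

End complex_algebra.

(** * Integrals of complex-valued functions *)

Section complex_functions.
Context {R : realType}.
Local Notation T := (lebesgueType R).
Local Notation Re := complex.Re.
Local Notation Im := complex.Im.
Implicit Types (u v w : R -> R[i]).

Lemma cmeasurable_cst (c : R[i]) : cmeasurable (fun=> c).
Proof. by split; exact: measurable_cst. Qed.

Lemma cmeasurableD u v : cmeasurable u -> cmeasurable v -> cmeasurable (fun x => u x + v x).
Proof.
move=> [u1 u2] [v1 v2]; split.
- by under eq_fun do rewrite cReD; exact: (measurable_funD u1 v1).
- by under eq_fun do rewrite cImD; exact: (measurable_funD u2 v2).
Qed.

Lemma cmeasurableM u v : cmeasurable u -> cmeasurable v -> cmeasurable (fun x => u x * v x).
Proof.
move=> [u1 u2] [v1 v2]; split.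
- under eq_fun do rewrite cReM.
  exact: (measurable_funB (measurable_funM u1 v1) (measurable_funM u2 v2)).
- under eq_fun do rewrite cImM.
  exact: (measurable_funD (measurable_funM u1 v2) (measurable_funM u2 v1)).
Qed.

Lemma cmeasurableZ (c : R[i]) u : cmeasurable u -> cmeasurable (fun x => c * u x).
Proof. by move=> m_u; apply: cmeasurableM m_u; exact: cmeasurable_cst. Qed.

Lemma cmeasurableJ u : cmeasurable u -> cmeasurable (fun x => (u x)^*).
Proof.
move=> [u1 u2]; split.
- by under eq_fun do rewrite cReJ; exact: u1.
- under eq_fun do rewrite cImJ.
  exact: (measurableT_comp (@oppr_measurable R setT) u2).
Qed.

Lemma cmeasurableB u v : cmeasurable u -> cmeasurable v -> cmeasurable (fun x => u x - v x).
Proof.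
move=> m_u mv; rewrite (_ : (fun x => _) = fun x => u x + -1 * v x).
  exact: (cmeasurableD m_u (cmeasurableZ (-1) mv)).
by apply/funext => x; rewrite mulN1r.
Qed.

Lemma cmeasurable_real (f : R -> R) : measurable_fun [set: T] (f : T -> R) ->
  cmeasurable (fun x => (f x)%:C).
Proof. by move=> mf; split; [exact: mf|exact: measurable_cst]. Qed.

Lemma measurable_sqr_normc u : cmeasurable u ->
  measurable_fun [set: T] (fun x => normc (u x) ^+ 2).
Proof.
move=> [u1 u2]; under eq_fun do rewrite sqr_normcE.
exact: (measurable_funD (measurable_funX 2 u1) (measurable_funX 2 u2)).
Qed.

Lemma measurable_normc u : cmeasurable u -> measurable_fun [set: T] (fun x => normc (u x)).
Proof.
move=> m_u; under eq_fun do rewrite -(ger0_norm (normc_ge0 _)) -sqrtr_sqr.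
have ms : measurable_fun [set: R] (@Num.sqrt R).
  by apply: continuous_measurable_fun; exact: sqrt_continuous.
exact: (measurableT_comp ms (measurable_sqr_normc m_u)).
Qed.

Lemma integrable_le (f g : T -> R) : measurable_fun [set: T] f -> (forall x, `|f x| <= g x) ->
  leb.-integrable [set: T] (EFin \o g) -> leb.-integrable [set: T] (EFin \o f).
Proof.
move=> mf fg; apply: le_integrable; [exact: measurableT|exact/measurable_EFinP|].
by move=> x _ /=; rewrite lee_fin (le_trans (fg x))// ler_norm.
Qed.

Lemma L1_normc u : L1 u -> leb.-integrable [set: T] (EFin \o (fun x => normc (u x))).
Proof.
move=> [m_u ufin]; apply/integrableP; split.
  by apply/measurable_EFinP; exact: measurable_normc.
by under eq_integral do rewrite /= ger0_norm ?normc_ge0//.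
Qed.

Lemma L1_Re u : L1 u -> leb.-integrable [set: T] (EFin \o (fun x => Re (u x))).
Proof.
move=> u1; apply: integrable_le (L1_normc u1); first by case: u1 => -[].
by move=> x; exact: normRe_le.
Qed.

Lemma L1_Im u : L1 u -> leb.-integrable [set: T] (EFin \o (fun x => Im (u x))).
Proof.
move=> u1; apply: integrable_le (L1_normc u1); first by case: u1 => -[].
by move=> x; exact: normIm_le.
Qed.

Lemma L1_le u (g : T -> R) : cmeasurable u -> (forall x, normc (u x) <= g x) ->
  leb.-integrable [set: T] (EFin \o g) -> L1 u.
Proof.
move=> m_u ug ig; split=> //.
have : leb.-integrable [set: T] (EFin \o (fun x => normc (u x))).
  apply: integrable_le ig; first exact: measurable_normc.
  by move=> x; rewrite ger0_norm// normc_ge0.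
move/integrableP => [_]; under eq_integral do rewrite /= ger0_norm ?normc_ge0//.
exact.
Qed.

Lemma L1D u v : L1 u -> L1 v -> L1 (fun x => u x + v x).
Proof.
move=> u1 v1; have [m_u _] := u1; have [mv _] := v1.
apply: (@L1_le _ (fun x => normc (u x) + normc (v x))); first exact: cmeasurableD.
  by move=> x; exact: le_normcD.
have := integrableD measurableT (L1_normc u1) (L1_normc v1).
by apply: eq_integrable.
Qed.

Lemma L1Z (c : R[i]) u : L1 u -> L1 (fun x => c * u x).
Proof.
move=> u1; have [m_u _] := u1.
apply: (@L1_le _ (fun x => normc c * normc (u x))); first exact: cmeasurableZ.
  by move=> x; rewrite ComplexField.Normc.normcM.
have := integrableZl measurableT (normc c) (L1_normc u1).
by apply: eq_integrable.
Qed.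

Lemma L1J u : L1 u -> L1 (fun x => (u x)^*).
Proof.
move=> u1; have [m_u _] := u1; apply: L1_le (L1_normc u1); first exact: cmeasurableJ.
by move=> x; rewrite normc_conj.
Qed.

Lemma cintegralD u v : L1 u -> L1 v ->
  cintegral (fun x => u x + v x) = cintegral u + cintegral v.
Proof.
move=> u1 v1; apply: complexP; rewrite ?cReD ?cImD /=.
- rewrite -RintegralD//; [|exact: L1_Re|exact: L1_Re].
  by apply: eq_Rintegral => x _; rewrite cReD.
- rewrite -RintegralD//; [|exact: L1_Im|exact: L1_Im].
  by apply: eq_Rintegral => x _; rewrite cImD.
Qed.

Lemma cintegralZ (c : R[i]) u : L1 u -> cintegral (fun x => c * u x) = c * cintegral u.
Proof.
move=> u1; have iR := L1_Re u1; have iI := L1_Im u1.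
have ZR (r : R) := integrableZl measurableT r iR.
have ZI (r : R) := integrableZl measurableT r iI.
apply: complexP; rewrite ?cReM ?cImM /=.
- rewrite -!RintegralZl// -RintegralB//; [|exact: ZR|exact: ZI].
  by apply: eq_Rintegral => x _; rewrite cReM.
- rewrite -!RintegralZl// -RintegralD//; [|exact: ZI|exact: ZR].
  by apply: eq_Rintegral => x _; rewrite cImM.
Qed.

Lemma cintegralJ u : L1 u -> cintegral (fun x => (u x)^*) = (cintegral u)^*.
Proof.
move=> u1; apply: complexP; rewrite ?cReJ ?cImJ /=.
- by apply: eq_Rintegral => x _; rewrite cReJ.
- rewrite -mulN1r -RintegralZl//; last exact: L1_Im.
  by apply: eq_Rintegral => x _; rewrite cImJ mulN1r.
Qed.

Lemma eq_cintegral u v : u =1 v -> cintegral u = cintegral v.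
Proof. by move=> uv; rewrite (funext uv). Qed.

(** The factor 2 comes from treating real and imaginary parts separately; it is harmless, as the
    estimate serves to see that the transform of an L^1 function is bounded. *)
Lemma normc_cintegral_le u : L1 u ->
  normc (cintegral u) <= 2 * \int[leb]_x (normc (u x)).
Proof.
move=> u1; apply: le_trans (normc_le_ReIm _) _; rewrite /= mulr_natl mulr2n.
have H (f : T -> R) : leb.-integrable [set: T] (EFin \o f) -> (forall x, `|f x| <= normc (u x)) ->
   `|\int[leb]_x f x| <= \int[leb]_x (normc (u x)).
  move=> fi fu; apply: le_trans (le_normr_Rintegral measurableT fi) _.
  apply: le_Rintegral => //; [exact: integrable_norm|exact: L1_normc].
by apply: lerD; apply: H; [exact: L1_Re|move=> x; exact: normRe_le|
  exact: L1_Im|move=> x; exact: normIm_le].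
Qed.

End complex_functions.

(** * The inner product of L^2 *)

Section inner_product.
Context {R : realType}.
Local Notation T := (lebesgueType R).
Local Notation Re := complex.Re.
Implicit Types (u v w : R -> R[i]).

(** A real integral takes the value 0 when the extended one is infinite, so this is the squared norm
    only in company of [L2 u]. *)
Definition sqn u : R := \int[leb]_x (normc (u x) ^+ 2).

Lemma sqn_ge0 u : 0 <= sqn u.
Proof. by apply: Rintegral_ge0 => x _; exact: sqr_ge0. Qed.

Lemma integral_sqr_normc u : L2 u -> (\int[leb]_x (normc (u x) ^+ 2)%:E = (sqn u)%:E)%E.
Proof.
move=> [m_u ufin]; rewrite /sqn /Rintegral fineK// ge0_fin_numE//.
by apply: integral_ge0 => x _; rewrite lee_fin sqr_ge0.
Qed.

Lemma L2_integrable u : L2 u -> leb.-integrable [set: T] (EFin \o (fun x => normc (u x) ^+ 2)).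
Proof.
move=> [m_u ufin]; apply/integrableP; split.
  by apply/measurable_EFinP; exact: measurable_sqr_normc.
by under eq_integral do rewrite /= ger0_norm ?sqr_ge0//.
Qed.

Lemma L2_le u (g : T -> R) : cmeasurable u -> (forall x, normc (u x) ^+ 2 <= g x) ->
  leb.-integrable [set: T] (EFin \o g) -> L2 u.
Proof.
move=> m_u ug ig; split=> //.
have : leb.-integrable [set: T] (EFin \o (fun x => normc (u x) ^+ 2)).
  apply: integrable_le ig; first exact: measurable_sqr_normc.
  by move=> x; rewrite ger0_norm// sqr_ge0.
move/integrableP => [_]; under eq_integral do rewrite /= ger0_norm ?sqr_ge0//.
exact.
Qed.

Lemma L2_dom (c : R) u v : cmeasurable u -> L2 v ->
  (forall x, normc (u x) ^+ 2 <= c * normc (v x) ^+ 2) -> L2 u.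
Proof.
move=> m_u v2 uv; apply: (L2_le m_u uv).
have := integrableZl measurableT c (L2_integrable v2).
by apply: eq_integrable.
Qed.

Lemma L2D u v : L2 u -> L2 v -> L2 (fun x => u x + v x).
Proof.
move=> u2 v2; have [m_u _] := u2; have [mv _] := v2.
apply: (@L2_le _ (fun x => 2 * normc (u x) ^+ 2 + 2 * normc (v x) ^+ 2)).
- exact: cmeasurableD.
- by move=> x; exact: sqr_normcD_le.
have := integrableD measurableT (integrableZl measurableT 2 (L2_integrable u2))
  (integrableZl measurableT 2 (L2_integrable v2)).
by apply: eq_integrable.
Qed.

Lemma L2Z (c : R[i]) u : L2 u -> L2 (fun x => c * u x).
Proof.
move=> u2; have [m_u _] := u2; apply: (@L2_dom (normc c ^+ 2) _ u); [exact: cmeasurableZ|exact: u2|].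
by move=> x; rewrite ComplexField.Normc.normcM exprMn.
Qed.

Lemma L20 : L2 (fun=> 0 : R[i]).
Proof.
split; first exact: cmeasurable_cst.
by rewrite integral0_eq// => x _; rewrite ComplexField.Normc.normc0 expr0n.
Qed.

Lemma L10 : L1 (fun=> 0 : R[i]).
Proof.
split; first exact: cmeasurable_cst.
by rewrite integral0_eq// => x _; rewrite ComplexField.Normc.normc0.
Qed.

Lemma L2B u v : L2 u -> L2 v -> L2 (fun x => u x - v x).
Proof.
move=> u2 v2; rewrite (_ : (fun x => _) = fun x => u x + -1 * v x).
  exact: (L2D u2 (L2Z (-1) v2)).
by apply/funext => x; rewrite mulN1r.
Qed.

Lemma L2J u : L2 u -> L2 (fun x => (u x)^*).
Proof.
move=> u2; have [m_u _] := u2; apply: (@L2_dom 1 _ u); [exact: cmeasurableJ|exact: u2|].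
by move=> x; rewrite normc_conj mul1r.
Qed.

Lemma L2_sum (I : Type) (r : seq I) (f : I -> R -> R[i]) : (forall i, L2 (f i)) ->
  L2 (fun x => \sum_(i <- r) f i x).
Proof.
move=> f2; elim: r => [|i r ih].
  rewrite (_ : (fun x => _) = fun=> 0); first exact: L20.
  by apply/funext => x; rewrite big_nil.
rewrite (_ : (fun x => _) = fun x => f i x + \sum_(j <- r) f j x); last first.
  by apply/funext => x; rewrite big_cons.
exact: (L2D (f2 i) ih).
Qed.

Lemma L2M u v : L2 u -> L2 v -> L1 (fun x => u x * v x).
Proof.
move=> u2 v2; have [m_u _] := u2; have [mv _] := v2.
apply: (@L1_le _ _ (fun x => normc (u x) ^+ 2 + normc (v x) ^+ 2)).
- exact: cmeasurableM.
- by move=> x; exact: normcM_le.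
have := integrableD measurableT (L2_integrable u2) (L2_integrable v2).
by apply: eq_integrable.
Qed.

Lemma L2MJ u v : L2 u -> L2 v -> L1 (fun x => u x * (v x)^*).
Proof. by move=> u2 v2; exact: (L2M u2 (L2J v2)). Qed.

Lemma L2_cmeasurable u : L2 u -> cmeasurable u. Proof. by case. Qed.

Lemma L1_cmeasurable u : L1 u -> cmeasurable u. Proof. by case. Qed.

#[local] Opaque L1 L2 cmeasurable.

Lemma innerDl u v w : L2 u -> L2 v -> L2 w ->
  inner (fun x => u x + v x) w = inner u w + inner v w.
Proof.
move=> u2 v2 w2; rewrite /inner -cintegralD; [|exact: L2MJ|exact: L2MJ].
by apply: eq_cintegral => x; rewrite mulrDl.
Qed.

Lemma innerZl (c : R[i]) u w : L2 u -> L2 w -> inner (fun x => c * u x) w = c * inner u w.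
Proof.
move=> u2 w2; rewrite /inner -cintegralZ; last exact: L2MJ.
by apply: eq_cintegral => x; rewrite mulrA.
Qed.

Lemma innerC u v : L2 u -> L2 v -> inner v u = (inner u v)^*.
Proof.
move=> u2 v2; rewrite /inner -cintegralJ; last exact: L2MJ.
by apply: eq_cintegral => x; rewrite conjcM conjCK mulrC.
Qed.

Lemma innerDr u v w : L2 u -> L2 v -> L2 w ->
  inner w (fun x => u x + v x) = inner w u + inner w v.
Proof.
move=> u2 v2 w2; rewrite (innerC (L2D u2 v2) w2) (innerDl u2 v2 w2) conjcD.
by rewrite -(innerC u2 w2) -(innerC v2 w2).
Qed.

Lemma innerZr (c : R[i]) u w : L2 u -> L2 w -> inner w (fun x => c * u x) = c^* * inner w u.
Proof.
by move=> u2 w2; rewrite (innerC (L2Z c u2) w2) (innerZl c u2 w2) conjcM -(innerC u2 w2).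
Qed.

Lemma inner_suml (I : Type) (r : seq I) (f : I -> R -> R[i]) w : (forall i, L2 (f i)) -> L2 w ->
  inner (fun x => \sum_(i <- r) f i x) w = \sum_(i <- r) inner (f i) w.
Proof.
move=> f2 w2; elim: r => [|i r ih].
  rewrite big_nil /inner (@eq_cintegral _ _ (fun=> 0 * 0)).
    by rewrite cintegralZ ?mul0r//; exact: L10.
  by move=> x; rewrite big_nil !mul0r.
rewrite big_cons -ih -(innerDl (f2 i) (L2_sum r f2) w2).
by congr (inner _ _); apply/funext => x; rewrite big_cons.
Qed.

Lemma inner_sumr (I : Type) (r : seq I) (f : I -> R -> R[i]) w : (forall i, L2 (f i)) -> L2 w ->
  inner w (fun x => \sum_(i <- r) f i x) = \sum_(i <- r) inner w (f i).
Proof.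
move=> f2 w2; rewrite (innerC (L2_sum _ f2) w2) (inner_suml r f2 w2) conjc_sum.
by apply: eq_bigr => i _; rewrite -(innerC (f2 i) w2).
Qed.

Lemma inner_sqn u : inner u u = (sqn u)%:C.
Proof.
rewrite /inner (@eq_cintegral _ _ (fun x => (normc (u x) ^+ 2)%:C)); last by move=> x; exact: mulcJ.
by apply: complexP => //=; rewrite Rintegral_cst// mul0r.
Qed.

Lemma innerBB u v : L2 u -> L2 v ->
  sqn (fun x => u x - v x) = sqn u - 2 * Re (inner u v) + sqn v.
Proof.
move=> u2 v2; have v2' := L2Z (-1) v2.
suff : inner (fun x => u x + -1 * v x) (fun x => u x + -1 * v x) =
   (sqn u - 2 * Re (inner u v) + sqn v)%:C.
  rewrite inner_sqn => -[<-]; congr sqn; apply/funext => x; by rewrite mulN1r.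
rewrite (innerDl u2 v2' (L2D u2 v2')) (innerDr u2 v2' u2) (innerDr u2 v2' v2').
rewrite (innerZr _ v2 u2) (innerZr _ v2 v2') (innerZl _ v2 v2) (innerZl _ v2 u2).
rewrite !inner_sqn (innerC u2 v2).
by apply: complexP; rewrite !(cReD,cImD,cReM,cImM,cReJ,cImJ,cReN,cImN)/=; ring.
Qed.

(** With c = <u, v>, the squared norm of u - s c v is a quadratic polynomial in the real number s; s
    = 1 / |v|^2 minimizes it. *)
Lemma cauchy_schwarz u v : L2 u -> L2 v -> normc (inner u v) ^+ 2 <= sqn u * sqn v.
Proof.
move=> u2 v2; set c := inner u v; set N := normc c ^+ 2.
have H (s : R) : 0 <= sqn u - 2 * s * N + s ^+ 2 * N * sqn v.
  have := sqn_ge0 (fun x => u x - (s%:C * c) * v x).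
  rewrite (innerBB u2 (L2Z _ v2)) (innerZr _ v2 u2) -/c.
  have -> : sqn (fun x => s%:C * c * v x) = s ^+ 2 * N * sqn v.
    have := inner_sqn (fun x => s%:C * c * v x).
    rewrite (innerZr _ v2 (L2Z _ v2)) (innerZl _ v2 v2).
    rewrite inner_sqn mulrA [_^* * _]mulrC mulcJ ComplexField.Normc.normcM exprMn normc_real.
    by rewrite real_normK ?num_real// -/N => /(congr1 (@complex.Re R)) /= <-; ring.
  have -> : Re ((s%:C * c)^* * c) = s * N.
    by rewrite conjcM mulrAC -mulrA mulcJ cReM cReJ cImJ !cReC !cImC mulr0 subr0.
  by rewrite mulrA.
have N0 : 0 <= N := sqr_ge0 _.
have b0 := sqn_ge0 v; have a0 := sqn_ge0 u.
have [b00|bn0] := eqVneq (sqn v) 0.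
  rewrite b00 mulr0; apply/contraT; rewrite -ltNge => Npos.
  (* When |v| = 0 the polynomial is affine in s; this s gives it the value -1. *)
  have := H ((sqn u + 1) / (2 * N)); rewrite b00 mulr0 addr0.
  have -> : 2 * ((sqn u + 1) / (2 * N)) * N = sqn u + 1 by field; rewrite gt_eqF.
  lra.
have bpos : 0 < sqn v by rewrite lt_neqAle eq_sym bn0.
have := H (sqn v)^-1.
have -> : sqn u - 2 * (sqn v)^-1 * N + (sqn v)^-1 ^+ 2 * N * sqn v = sqn u - N / sqn v by field.
by rewrite subr_ge0 ler_pdivrMr.
Qed.

Definition orthonormal_seq (e : nat -> R -> R[i]) :=
  (forall n, L2 (e n)) /\ forall m n, inner (e m) (e n) = (m == n)%:R.

Lemma L2_lincomb (e : nat -> R -> R[i]) (c : nat -> R[i]) n : orthonormal_seq e ->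
  L2 (fun x => \sum_(k < n) c k * e k x).
Proof.
move=> [e2 _]; have ce2 (k : 'I_n) : L2 (fun x => c k * e k x) by exact: L2Z.
exact: (L2_sum _ ce2).
Qed.

Lemma inner_lincomb (e : nat -> R -> R[i]) (c : nat -> R[i]) n u : orthonormal_seq e -> L2 u ->
  inner u (fun x => \sum_(k < n) c k * e k x) = \sum_(k < n) (c k)^* * inner u (e k).
Proof.
move=> [e2 _] u2; have ce2 (k : 'I_n) : L2 (fun x => c k * e k x) by exact: L2Z.
rewrite (inner_sumr _ ce2 u2); apply: eq_bigr => k _.
by rewrite (innerZr _ (e2 k) u2).
Qed.

Lemma sqn_lincomb (e : nat -> R -> R[i]) (c : nat -> R[i]) n : orthonormal_seq e ->
  sqn (fun x => \sum_(k < n) c k * e k x) = \sum_(k < n) normc (c k) ^+ 2.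
Proof.
move=> oe; have [e2 eo] := oe; have p2 := L2_lincomb c n oe.
have ce2 (k : 'I_n) : L2 (fun x => c k * e k x) by exact: L2Z.
apply: complexI; rewrite -inner_sqn (inner_lincomb c n oe p2) rmorph_sum/=.
apply: eq_bigr => k _; rewrite (inner_suml _ ce2 (e2 k)).
rewrite (eq_bigr (fun i : 'I_n => if i == k then c i else 0)).
  by rewrite -big_mkcond/= big_pred1_eq mulrC mulcJ.
move=> i _; rewrite (innerZl _ (e2 i) (e2 k)) eo.
by case: (i =P k) => [->|ik]; rewrite ?eqxx ?mulr1//; case: eqP => [/val_inj/ik|]; rewrite // mulr0.
Qed.

Lemma bessel (e : nat -> R -> R[i]) n u : orthonormal_seq e -> L2 u ->
  \sum_(k < n) normc (inner u (e k)) ^+ 2 <= sqn u.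
Proof.
move=> oe u2; pose c k := inner u (e k).
have p2 := L2_lincomb c n oe.
have := sqn_ge0 (fun x => u x - \sum_(k < n) c k * e k x).
rewrite (innerBB u2 p2) (sqn_lincomb c n oe) (inner_lincomb c n oe u2).
have -> : \sum_(k < n) (c k)^* * inner u (e k) = (\sum_(k < n) normc (c k) ^+ 2)%:C.
  by rewrite rmorph_sum/=; apply: eq_bigr => k _; rewrite mulrC mulcJ.
by rewrite cReC; set S := \sum_(k < n) _; lra.
Qed.

Lemma cvgL2_inner (un : nat -> R -> R[i]) u w : (forall n, L2 (un n)) -> L2 u -> L2 w ->
  cvgL2 un u -> normc (inner (un n) w - inner u w) @[n --> \oo] --> (0 : R).
Proof.
move=> un2 u2 w2 cu.
have B2 n : L2 (fun x => un n x - u x) by exact: L2B.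
have cs : sqn (fun x => un n x - u x) @[n --> \oo] --> (0 : R).
  move: cu; rewrite /cvgL2; under eq_fun do rewrite integral_sqr_normc//.
  by move=> /fine_cvgP[_].
have cs' : Num.sqrt (sqn (fun x => un n x - u x) * sqn w) @[n --> \oo] --> (0 : R).
  rewrite -sqrtr0 -(mul0r (sqn w)); apply: continuous_cvg; first exact: sqrt_continuous.
  by apply: cvgMl.
apply: (@squeeze_cvgr _ _ _ _ (fun=> 0) _ _ _ _ _ cs'); last exact: cvg_cst.
apply: nearW => n; rewrite normc_ge0 andTb.
have -> : inner (un n) w - inner u w = inner (fun x => un n x - u x) w.
  have -> : (fun x => un n x - u x) = (fun x => un n x + -1 * u x).
    by apply/funext => x; rewrite mulN1r.
  by rewrite (innerDl (un2 n) (L2Z _ u2) w2) (innerZl _ u2 w2) mulN1r.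
rewrite -(ger0_norm (normc_ge0 _)) -sqrtr_sqr ler_wsqrtr//.
exact: cauchy_schwarz.
Qed.

End inner_product.

(** * Plancherel's theorem *)

Section fubini_complex.
Context {R : realType}.
Local Notation T := (lebesgueType R).
Local Notation Re := complex.Re.
Local Notation Im := complex.Im.

(** Real iterated integrals pass through [fine], which sends infinite values to 0. An integrable
    function is infinite only on a null set, so nothing is lost. *)
Lemma ae_eq_fine (F : T -> \bar R) : leb.-integrable [set: T] F ->
  (\int[leb]_x (fine (F x))%:E = \int[leb]_x F x)%E.
Proof.
move=> iF; have [mF _] := integrableP _ _ _ iF.
apply: ae_eq_integral; [exact: measurableT| |exact: mF|].
  by apply/measurable_EFinP; exact: (measurableT_comp (@fine_measurable R setT measurableT) mF).
by apply: filterS (integrable_ae measurableT iF) => x /= H xT; rewrite fineK// H.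
Qed.

Lemma Rfubini1 (f : T * T -> R) : (leb \x leb)%E.-integrable [set: T * T] (EFin \o f) ->
  \int[leb]_x \int[leb]_y f (x, y) = \int[(leb \x leb)%E]_p f p.
Proof.
move=> fi; rewrite /Rintegral; congr fine.
rewrite -(integral12_prod_meas1 fi).
exact: (ae_eq_fine (integrable_fubini_F fi)).
Qed.

Lemma integrable_fubini_G (f : T * T -> \bar R) :
  (leb \x leb)%E.-integrable [set: T * T] f ->
  leb.-integrable [set: T] (fun y => (\int[leb]_x f (x, y))%E).
Proof.
move=> fi; have [mf _] := integrableP _ _ _ fi.
have mG := measurable_fubini_G fi.
apply/integrableP; split; first exact: mG.
apply: le_lt_trans ((integrable21ltyP leb leb mf).1 fi).
have maf : measurable_fun [set: T * T] (abse \o f).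
  by apply: measurableT_comp; [exact: abse_measurable|exact: mf].
apply: ge0_le_integral; [exact: measurableT|by []| | |].
- by apply: measurableT_comp; [exact: abse_measurable|exact: mG].
- apply: (@measurable_fun_fubini_tonelli_G _ _ T T R leb (abse \o f) maf).
  by move=> p; exact: abse_ge0.
- move=> y _; apply: le_abse_integral; first exact: measurableT.
  exact: (measurable_fun_pair1 y mf).
Qed.

Lemma Rfubini2 (f : T * T -> R) : (leb \x leb)%E.-integrable [set: T * T] (EFin \o f) ->
  \int[leb]_y \int[leb]_x f (x, y) = \int[(leb \x leb)%E]_p f p.
Proof.
move=> fi; rewrite /Rintegral; congr fine.
rewrite -(integral21_prod_meas1 fi).
exact: (ae_eq_fine (integrable_fubini_G fi)).
Qed.

Definition cmeasurable2 (k : R -> R -> R[i]) :=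
  measurable_fun [set: T * T] (fun p => Re (k p.1 p.2)) /\
  measurable_fun [set: T * T] (fun p => Im (k p.1 p.2)).

Lemma cmeasurable2M k l : cmeasurable2 k -> cmeasurable2 l ->
  cmeasurable2 (fun x y => k x y * l x y).
Proof.
move=> [k1 k2] [l1 l2]; split.
- under eq_fun do rewrite cReM.
  exact: (measurable_funB (measurable_funM k1 l1) (measurable_funM k2 l2)).
- under eq_fun do rewrite cImM.
  exact: (measurable_funD (measurable_funM k1 l2) (measurable_funM k2 l1)).
Qed.

Lemma cmeasurable2_fst u : cmeasurable u -> cmeasurable2 (fun x _ => u x).
Proof. by move=> [u1 u2]; split; [exact: (measurable_fst_leb u1)|exact: (measurable_fst_leb u2)]. Qed.

Lemma cmeasurable2_snd u : cmeasurable u -> cmeasurable2 (fun _ y => u y).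
Proof. by move=> [u1 u2]; split; [exact: (measurable_snd_leb u1)|exact: (measurable_snd_leb u2)]. Qed.

Lemma measurable_sqr_normc2 k : cmeasurable2 k ->
  measurable_fun [set: T * T] (fun p => normc (k p.1 p.2) ^+ 2).
Proof.
move=> [k1 k2]; under eq_fun do rewrite sqr_normcE.
exact: (measurable_funD (measurable_funX 2 k1) (measurable_funX 2 k2)).
Qed.

Lemma measurable_normc2 k : cmeasurable2 k ->
  measurable_fun [set: T * T] (fun p => normc (k p.1 p.2)).
Proof.
move=> mk; under eq_fun do rewrite -(ger0_norm (normc_ge0 _)) -sqrtr_sqr.
have ms : measurable_fun [set: R] (@Num.sqrt R).
  by apply: continuous_measurable_fun; exact: sqrt_continuous.
exact: (measurableT_comp ms (measurable_sqr_normc2 mk)).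
Qed.

Lemma measurable_Rintegral1 (f : T * T -> R) : measurable_fun [set: T * T] f ->
  measurable_fun [set: T] (fun y => \int[leb]_x f (x, y)).
Proof.
move=> mf; have mEf : measurable_fun [set: T * T] (EFin \o f) by exact/measurable_EFinP.
have mG : measurable_fun [set: T] (fun y => \int[leb]_x (EFin \o f) (x, y))%E.
  pose G1 (y : T) := (\int[leb]_x ((EFin \o f)^\+ (x, y)))%E.
  pose G2 (y : T) := (\int[leb]_x ((EFin \o f)^\- (x, y)))%E.
  rewrite (_ : (fun y => _) = (fun y => G1 y - G2 y)%E).
    apply: emeasurable_funB.
      apply: (@measurable_fun_fubini_tonelli_G _ _ T T R leb _ (measurable_funepos mEf)).
      by move=> p; exact: funepos_ge0.
    apply: (@measurable_fun_fubini_tonelli_G _ _ T T R leb _ (measurable_funeneg mEf)).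
    by move=> p; exact: funeneg_ge0.
  apply/funext => y; rewrite integralE /G1 /G2; congr (_ - _)%E.
    by apply: eq_integral => x _; rewrite !funeposE.
  by apply: eq_integral => x _; rewrite !funenegE.
exact: (measurableT_comp (@fine_measurable R setT measurableT) mG).
Qed.

Lemma cmeasurable_cintegral1 k : cmeasurable2 k ->
  cmeasurable (fun y => cintegral (fun x => k x y)).
Proof.
move=> [k1 k2]; split.
- exact: (measurable_Rintegral1 k1).
- exact: (measurable_Rintegral1 k2).
Qed.

Lemma integrable2_le k (f : T * T -> R) : cmeasurable2 k -> measurable_fun [set: T * T] f ->
  (forall x y, `|f (x, y)| <= normc (k x y)) ->
  (\int[leb]_x \int[leb]_y (normc (k x y))%:E < +oo)%E ->
  (leb \x leb)%E.-integrable [set: T * T] (EFin \o f).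
Proof.
move=> mk mf fk kfin; apply/integrableP; split; first exact/measurable_EFinP.
have mn : measurable_fun [set: T * T] (fun p => (normc (k p.1 p.2))%:E).
  by apply/measurable_EFinP; exact: measurable_normc2.
apply: le_lt_trans kfin.
rewrite -(fubini_tonelli1 (fun p : T * T => (normc (k p.1 p.2))%:E)); last 2 first.
- exact: mn.
- by move=> p; rewrite lee_fin normc_ge0.
apply: ge0_le_integral; [exact: measurableT|by []| |exact: mn|].
  by apply: measurableT_comp; [exact: abse_measurable|exact/measurable_EFinP].
by move=> [x y] _; rewrite /= lee_fin.
Qed.

Lemma cfubini k : cmeasurable2 k ->
  (\int[leb]_x \int[leb]_y (normc (k x y))%:E < +oo)%E ->
  cintegral (fun x => cintegral (fun y => k x y)) =
  cintegral (fun y => cintegral (fun x => k x y)).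
Proof.
move=> mk kfin.
have iR : (leb \x leb)%E.-integrable [set: T * T] (EFin \o (fun p => Re (k p.1 p.2))).
  by apply: (integrable2_le mk _ _ kfin); [exact: mk.1|move=> x y; exact: normRe_le].
have iI : (leb \x leb)%E.-integrable [set: T * T] (EFin \o (fun p => Im (k p.1 p.2))).
  by apply: (integrable2_le mk _ _ kfin); [exact: mk.2|move=> x y; exact: normIm_le].
apply: complexP => /=.
- exact: etrans (Rfubini1 iR) (esym (Rfubini2 iR)).
- exact: etrans (Rfubini1 iI) (esym (Rfubini2 iI)).
Qed.

End fubini_complex.

(** * The Fourier kernel and the multiplication formula *)

Section fourier_kernel.
Context {R : realType}.
Local Notation T := (lebesgueType R).
Implicit Types (u v w h : R -> R[i]).

Definition fker (x xi : R) : R[i] := cos (2 * pi * x * xi) -i* sin (2 * pi * x * xi).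

Lemma fourierL1E u xi : fourierL1 u xi = cintegral (fun x => fker x xi * u x).
Proof. by []. Qed.

Lemma fkerC x xi : fker x xi = fker xi x.
Proof. by rewrite /fker mulrAC. Qed.

Lemma sqr_normc_fker x xi : normc (fker x xi) ^+ 2 = 1.
Proof. by rewrite sqr_normcE /= sqrrN cos2Dsin2. Qed.

Lemma normc_fker x xi : normc (fker x xi) = 1.
Proof.
by apply/eqP; rewrite -(@eqrXn2 _ 2)// ?normc_ge0// sqr_normc_fker expr1n.
Qed.

Lemma fkerB x y xi : fker (x - y) xi = fker x xi * (fker y xi)^*.
Proof.
have e : 2 * pi * (x - y) * xi = 2 * pi * x * xi - 2 * pi * y * xi by ring.
apply: complexP; rewrite ?cReM ?cImM ?cReJ ?cImJ /fker /= e.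
  by rewrite cosB; ring.
by rewrite sinB; ring.
Qed.

Lemma fker0 xi : fker 0 xi = 1.
Proof. by rewrite /fker mulr0 mul0r cos0 sin0 oppr0. Qed.

Lemma cmeasurable2_fker : @cmeasurable2 R fker.
Proof.
have m0 : measurable_fun [set: T * T] (fun p => 2 * pi * (p.1 : R) * (p.2 : R)).
  apply: measurable_funM; last exact: (measurable_snd_leb measurable_id_leb).
  apply: measurable_funM; first exact: measurable_cst.
  exact: (measurable_fst_leb measurable_id_leb).
have mc : measurable_fun [set: R] (@cos R).
  by apply: continuous_measurable_fun; exact: continuous_cos.
have ms : measurable_fun [set: R] (fun x : R => - sin x).
  apply: continuous_measurable_fun => x; apply: continuousN; exact: continuous_sin.
by split; [exact: (measurableT_comp mc m0)|exact: (measurableT_comp ms m0)].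
Qed.

Lemma cmeasurable_fker xi : cmeasurable (fun x => fker x xi).
Proof.
have [f1 f2] := cmeasurable2_fker; split.
- exact: (@measurable_fun_pair1 _ _ _ T T R _ xi f1).
- exact: (@measurable_fun_pair1 _ _ _ T T R _ xi f2).
Qed.

Lemma L1_fker u xi : L1 u -> L1 (fun x => fker x xi * u x).
Proof.
move=> u1; apply: (L1_le _ _ (L1_normc u1)).
  exact: (cmeasurableM (cmeasurable_fker xi) (L1_cmeasurable u1)).
by move=> x; rewrite ComplexField.Normc.normcM normc_fker mul1r.
Qed.

Lemma cmeasurable_fourierL1 u : cmeasurable u -> cmeasurable (fourierL1 u).
Proof.
move=> m_u.
exact: (cmeasurable_cintegral1 (cmeasurable2M cmeasurable2_fker (cmeasurable2_fst m_u))).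
Qed.

Definition L1norm u : R := \int[leb]_x normc (u x).

Lemma normc_fourierL1_le u xi : L1 u -> normc (fourierL1 u xi) <= 2 * L1norm u.
Proof.
move=> u1; apply: le_trans (normc_cintegral_le (L1_fker xi u1)) _.
rewrite ler_wpM2l// /L1norm; under eq_Rintegral do rewrite ComplexField.Normc.normcM normc_fker mul1r.
exact: lexx.
Qed.

Lemma tensor_fin (f g : T -> R) : (forall x, 0 <= f x) -> (forall x, 0 <= g x) ->
  leb.-integrable [set: T] (EFin \o f) -> leb.-integrable [set: T] (EFin \o g) ->
  (\int[leb]_x \int[leb]_y (f x * g y)%:E < +oo)%E.
Proof.
move=> f0 g0 fi gi.
have [mf _] := integrableP _ _ _ fi; have [mg _] := integrableP _ _ _ gi.
rewrite (_ : (\int[leb]_x _)%E = (\int[leb]_x (f x)%:E * \int[leb]_y (g y)%:E)%E).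
  have := integrable_fin_num measurableT fi; have := integrable_fin_num measurableT gi.
  rewrite /=; move=> /fineK <- /fineK <-; by rewrite -EFinM ltry.
rewrite -ge0_integralZr; [|exact: measurableT|exact: mf|by move=> x _; rewrite lee_fin|].
  by apply: eq_integral => x _; rewrite -ge0_integralZl; [|exact: measurableT|exact: mg|
     move=> y _; rewrite lee_fin|rewrite lee_fin].
by apply: integral_ge0 => y _; rewrite lee_fin.
Qed.

(** Fubini's theorem for [fker x y * u x * h y], whose modulus is |u(x)| |h(y)|, together with the
    symmetry of the kernel in its two variables. *)
Lemma fourierL1_duality u h : L1 u -> L1 h ->
  cintegral (fun xi => fourierL1 u xi * h xi) = cintegral (fun x => u x * fourierL1 h x).
Proof.
move=> u1 h1.
pose k (x y : R) := fker x y * u x * h y.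
have mk : cmeasurable2 k.
  apply: cmeasurable2M; last exact: (cmeasurable2_snd (L1_cmeasurable h1)).
  apply: cmeasurable2M; first exact: cmeasurable2_fker.
  exact: (cmeasurable2_fst (L1_cmeasurable u1)).
have kfin : (\int[leb]_x \int[leb]_y (normc (k x y))%:E < +oo)%E.
  have := tensor_fin (fun x => normc_ge0 (u x)) (fun y => normc_ge0 (h y)) (L1_normc u1) (L1_normc h1).
  apply: le_lt_trans; rewrite le_eqVlt; apply/orP; left; apply/eqP.
  apply: eq_integral => x _; apply: eq_integral => y _.
  by rewrite /k !ComplexField.Normc.normcM normc_fker mul1r.
transitivity (cintegral (fun y => cintegral (fun x => k x y))).
  apply: eq_cintegral => y; rewrite fourierL1E mulrC -cintegralZ; last exact: L1_fker.
  by apply: eq_cintegral => x; rewrite mulrC.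
rewrite -cfubini//; apply: eq_cintegral => x.
rewrite fourierL1E -cintegralZ; last exact: L1_fker.
by apply: eq_cintegral => y; rewrite /k fkerC mulrA [u x * _]mulrC.
Qed.

End fourier_kernel.

#[local] Opaque L1 L2 cmeasurable.

(** * Plancherel's identity with exponential damping *)

Section plancherel_regularized.
Context {R : realType}.
Local Notation T := (lebesgueType R).
Local Notation Re := complex.Re.
Local Notation Im := complex.Im.
Implicit Types (u v w h : R -> R[i]).
Variables (e : R) (e0 : 0 < e).

Local Notation m := (expabs (2 * pi * e)).

Let c0 : 0 < 2 * pi * e.
Proof. by rewrite !mulr_gt0// pi_gt0. Qed.

Lemma poisson_le t : poisson e t <= (pi * e)^-1.
Proof.
have p0 : (pi : R) != 0 by rewrite gt_eqF ?pi_gt0.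
rewrite /poisson ler_pdivrMr; last first.
  by rewrite mulr_gt0 ?pi_gt0// ltr_pwDl ?sqr_ge0// exprn_gt0.
have -> : (pi * e)^-1 * (pi * (e ^+ 2 + t ^+ 2)) = e + t ^+ 2 / e.
  by move: (pi : R) p0 => q q0; field; rewrite q0 gt_eqF.
by rewrite lerDl divr_ge0 ?sqr_ge0// ltW.
Qed.

Lemma cintegral_expabs_fker t :
  cintegral (fun xi => (m xi)%:C * fker t xi) = (poisson e t)%:C.
Proof.
apply: complexP; rewrite /cintegral ?cReC ?cImC /=.
- transitivity (\int[leb]_xi (m xi * cos (2 * pi * t * xi))).
    by apply: eq_Rintegral => xi _ /=; ring.
  rewrite (Rintegral_expabs_cos _ c0) /poisson.
  have p0 : (pi : R) != 0 by rewrite gt_eqF ?pi_gt0.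
  have d0 : e ^+ 2 + t ^+ 2 != 0.
    by rewrite gt_eqF// ltr_pwDl ?sqr_ge0// exprn_gt0.
  rewrite (_ : (2 * pi * e) ^+ 2 + (2 * pi * t) ^+ 2 = 4 * pi ^+ 2 * (e ^+ 2 + t ^+ 2)); last by ring.
  by move: (pi : R) p0 (e ^+ 2 + t ^+ 2) d0 => q q0 d d0; field; rewrite q0 d0.
- transitivity (\int[leb]_xi (- 1 * (m xi * sin (2 * pi * t * xi)))).
    by apply: eq_Rintegral => xi _ /=; ring.
  rewrite RintegralZl//; last first.
    apply: (integrable_expabs_bounded c0); last by move=> x; exact: sin_max.
    by apply: continuous_measurable_fun; exact: continuous_sinM.
  by rewrite (Rintegral_expabs_sin _ c0) mulr0.
Qed.

Lemma cmeasurable_expabs : cmeasurable (fun xi => (m xi)%:C).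
Proof. by apply: cmeasurable_real; apply: measurable_fun_leb; exact: measurable_expabs. Qed.

Lemma L1_expabs_bounded (M : R) h : cmeasurable h -> (forall x, normc (h x) <= M) ->
  L1 (fun x => (m x)%:C * h x).
Proof.
move=> mh hM; apply: (@L1_le _ _ (fun x => M * m x)).
- exact: (cmeasurableM cmeasurable_expabs mh).
- move=> x; rewrite ComplexField.Normc.normcM normc_real ger0_norm ?expabs_ge0//.
  by rewrite mulrC ler_wpM2r// expabs_ge0.
- have := integrableZl measurableT M (integrable_expabs c0).
  by apply: eq_integrable.
Qed.

Lemma cmeasurable_poisson x : cmeasurable (fun y => (poisson e (x - y))%:C).
Proof.
apply: cmeasurable_real; apply: measurable_fun_leb; apply: continuous_measurable_fun => y.
apply: (@continuous_comp _ _ _ (fun y => x - y) (poisson e)).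
  by apply: cvgB; [exact: cvg_cst|exact: cvg_id].
exact: continuous_poisson.
Qed.

Lemma L1_poisson x u : L1 u -> L1 (fun y => (u y)^* * (poisson e (x - y))%:C).
Proof.
move=> u1; apply: (@L1_le _ _ (fun y => (pi * e)^-1 * normc (u y))).
- exact: (cmeasurableM (cmeasurableJ (L1_cmeasurable u1)) (cmeasurable_poisson x)).
- move=> y; rewrite ComplexField.Normc.normcM normc_real normc_conj mulrC.
  by rewrite ler_wpM2r ?normc_ge0// ger0_norm ?poisson_le// poisson_ge0// ltW.
- have := integrableZl measurableT (pi * e)^-1 (L1_normc u1).
  by apply: eq_integrable.
Qed.

Lemma cmeasurable2J (k : R -> R -> R[i]) : cmeasurable2 k -> cmeasurable2 (fun x y => (k x y)^*).
Proof.
move=> [k1 k2]; split.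
- by under eq_fun do rewrite cReJ; exact: k1.
- under eq_fun do rewrite cImJ.
  exact: (measurableT_comp (@oppr_measurable R setT) k2).
Qed.

(** Damping the transform of u and transforming back convolves u with the Poisson kernel. The
    conjugate lets the forward transform do the work of the inverse one; the damping makes the
    double integral absolutely convergent. *)
Lemma fourierL1_smoothed u x : L1 u ->
  fourierL1 (fun xi => (m xi)%:C * (fourierL1 u xi)^*) x =
  cintegral (fun y => (u y)^* * (poisson e (x - y))%:C).
Proof.
move=> u1.
pose k (xi y : R) := (m xi)%:C * (fker x xi * (fker y xi)^*) * (u y)^*.
have mk : cmeasurable2 k.
  apply: cmeasurable2M; last exact: (cmeasurable2_snd (cmeasurableJ (L1_cmeasurable u1))).
  apply: cmeasurable2M; first exact: (cmeasurable2_fst cmeasurable_expabs).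
  apply: cmeasurable2M.
    by under eq_fun do under eq_fun do rewrite fkerC; exact: (cmeasurable2_fst (cmeasurable_fker x)).
  by under eq_fun do under eq_fun do rewrite fkerC; exact: (cmeasurable2J cmeasurable2_fker).
have kfin : (\int[leb]_xi \int[leb]_y (normc (k xi y))%:E < +oo)%E.
  have := tensor_fin (expabs_ge0 (2 * pi * e)) (fun y => normc_ge0 (u y))
    (integrable_expabs c0) (L1_normc u1).
  apply: le_lt_trans; rewrite le_eqVlt; apply/orP; left; apply/eqP.
  apply: eq_integral => xi _; apply: eq_integral => y _.
  rewrite /k !ComplexField.Normc.normcM !normc_conj !normc_fker normc_real !mulr1.
  by rewrite ger0_norm// expabs_ge0.
transitivity (cintegral (fun xi => cintegral (fun y => k xi y))).
  rewrite fourierL1E; apply: eq_cintegral => xi.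
  rewrite fourierL1E -(cintegralJ (L1_fker xi u1)) mulrA -cintegralZ; last exact: (L1J (L1_fker xi u1)).
  by apply: eq_cintegral => y; rewrite /k conjcM (fkerC xi x); ring.
rewrite cfubini//; apply: eq_cintegral => y.
rewrite -cintegral_expabs_fker -cintegralZ; last first.
  apply: (@L1_expabs_bounded 1).
    rewrite (_ : fker _ = fun xi => fker xi (x - y)); first exact: cmeasurable_fker.
    by apply/funext => xi; rewrite fkerC.
  by move=> xi; rewrite normc_fker.
by apply: eq_cintegral => xi; rewrite /k fkerB; ring.
Qed.

Definition cenergy u : \bar R :=
  (\int[leb]_x \int[leb]_y (poisson e ((x : R) - (y : R))%R * normc (u x - u y) ^+ 2)%:E)%E.

Lemma measurable_poisson_diff' :
  measurable_fun [set: T * T] (fun p => poisson e ((p.1 : R) - (p.2 : R))).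
Proof.
rewrite (_ : (fun p => _) = fun p : T * T => poisson e ((p.2 : R) - (p.1 : R))).
  exact: measurable_poisson_diff.
by apply/funext => p; rewrite -poissonN opprB.
Qed.

Lemma cenergyE u : cmeasurable u ->
  cenergy u = (energy e (fun x : T => Re (u x)) + energy e (fun x : T => Im (u x)))%E.
Proof.
move=> [u1 u2]; rewrite !energy_prod//.
have h0 (v : T -> R) (p : T * T) :
    (0 <= (poisson e ((p.2 : R) - (p.1 : R))%R * (v p.1 - v p.2) ^+ 2)%:E)%E.
  by rewrite lee_fin mulr_ge0 ?sqr_ge0// poisson_ge0// ltW.
rewrite -ge0_integralD; [|exact: measurableT|
  by move=> p _; exact: (h0 (fun x => Re (u x)) p)|
  exact: (measurable_energy_integrand e0 u1)|
  by move=> p _; exact: (h0 (fun x => Im (u x)) p)|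
  exact: (measurable_energy_integrand e0 u2)].
rewrite /cenergy fubini_tonelli1.
- apply: eq_integral => x _; apply: eq_integral => y _; rewrite /= -EFinD -mulrDr.
  by rewrite sqr_normcE cReD cImD cReN cImN -poissonN opprB.
- apply: emeasurable_funD; first exact: (measurable_energy_integrand e0 u1).
  exact: (measurable_energy_integrand e0 u2).
- by move=> p; exact: adde_ge0 (h0 (fun x => Re (u x)) p) (h0 (fun x => Im (u x)) p).
Qed.

(* [|u x - u y|^2 = |u x|^2 + |u y|^2 - 2 Re (u x * conj (u y))], integrated against
   the Poisson kernel *)
Lemma Re_poisson_form u : L1 u -> L2 u ->
  Re (cintegral (fun x => u x * cintegral (fun y => (u y)^* * (poisson e (x - y))%:C))) =
  sqn u - fine (cenergy u) / 2.
Proof.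
move=> u1 u2; have m_u := L2_cmeasurable u2.
pose k (x y : R) := u x * ((u y)^* * (poisson e (x - y))%:C).
have mP := measurable_poisson_diff'.
have P0 (p : T * T) : 0 <= poisson e ((p.1 : R) - (p.2 : R)) by rewrite poisson_ge0// ltW.
have mk : cmeasurable2 k.
  apply: (cmeasurable2M (cmeasurable2_fst m_u)).
  apply: (cmeasurable2M (cmeasurable2_snd (cmeasurableJ m_u))).
  by split; [exact: mP|exact: measurable_cst].
pose w1 (p : T * T) := poisson e ((p.1 : R) - (p.2 : R)) * normc (u p.1) ^+ 2.
pose w2 (p : T * T) := poisson e ((p.1 : R) - (p.2 : R)) * normc (u p.2) ^+ 2.
have w10 p : 0 <= w1 p by exact: mulr_ge0 (P0 p) (sqr_ge0 _).
have w20 p : 0 <= w2 p by exact: mulr_ge0 (P0 p) (sqr_ge0 _).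
have mn := measurable_sqr_normc m_u.
have mEn : measurable_fun [set: T] (fun x => (normc (u x) ^+ 2)%:E) by exact/measurable_EFinP.
have En0 (x : T) : (0 <= (normc (u x) ^+ 2)%:E)%E by rewrite lee_fin sqr_ge0.
have mw1 : measurable_fun [set: T * T] (EFin \o w1).
  by apply/measurable_EFinP; exact: (measurable_funM mP (measurable_fst_leb mn)).
have mw2 : measurable_fun [set: T * T] (EFin \o w2).
  by apply/measurable_EFinP; exact: (measurable_funM mP (measurable_snd_leb mn)).
have E1 : (\int[leb \x leb]_p (w1 p)%:E = (sqn u)%:E)%E.
  rewrite (fubini_tonelli1 (EFin \o w1) mw1); last by move=> p; rewrite lee_fin.
  rewrite -(integral_sqr_normc u2) -[RHS](poisson_weight_fst e0 mEn En0).
  apply: eq_integral => x _; apply: eq_integral => y _.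
  by rewrite /w1 /= -poissonN opprB EFinM.
have E2 : (\int[leb \x leb]_p (w2 p)%:E = (sqn u)%:E)%E.
  rewrite (fubini_tonelli1 (EFin \o w2) mw2); last by move=> p; rewrite lee_fin.
  rewrite -(integral_sqr_normc u2) -[RHS](poisson_weight_snd e0 mEn En0).
  apply: eq_integral => x _; apply: eq_integral => y _.
  by rewrite /w2 /= -poissonN opprB EFinM.
have i1 : (leb \x leb)%E.-integrable [set: T * T] (EFin \o w1).
  apply/integrableP; split; first exact: mw1.
  by under eq_integral do rewrite /= ger0_norm//; rewrite E1 ltry.
have i2 : (leb \x leb)%E.-integrable [set: T * T] (EFin \o w2).
  apply/integrableP; split; first exact: mw2.
  by under eq_integral do rewrite /= ger0_norm//; rewrite E2 ltry.
have i12 : (leb \x leb)%E.-integrable [set: T * T] (EFin \o (fun p => w1 p + w2 p)).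
  by have := integrableD measurableT i1 i2; apply: eq_integrable.
have I1 : \int[(leb \x leb)%E]_p w1 p = sqn u by rewrite /Rintegral E1.
have I2 : \int[(leb \x leb)%E]_p w2 p = sqn u by rewrite /Rintegral E2.
have ik : (leb \x leb)%E.-integrable [set: T * T] (EFin \o (fun p => Re (k p.1 p.2))).
  move: i12; apply: le_integrable; [exact: measurableT|by apply/measurable_EFinP; exact: mk.1|].
  move=> p _; rewrite [X in (X <= _)%E]/= lee_fin.
  apply: le_trans (normRe_le _) _; apply: le_trans (ler_norm _).
  rewrite /k /w1 /w2 !ComplexField.Normc.normcM normc_real normc_conj.
  rewrite (ger0_norm (P0 p)) -mulrDr mulrA mulrC ler_wpM2l//.
  by rewrite -ComplexField.Normc.normcM normcM_le.
have i2k : (leb \x leb)%E.-integrable [set: T * T] (EFin \o (fun p => 2 * Re (k p.1 p.2))).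
  by have := integrableZl measurableT 2 ik; apply: eq_integrable.
have -> : fine (cenergy u) = \int[(leb \x leb)%E]_p (w1 p + w2 p - 2 * Re (k p.1 p.2)).
  rewrite /Rintegral /cenergy; congr fine.
  pose g (p : T * T) := (poisson e ((p.1 : R) - (p.2 : R)) * normc (u p.1 - u p.2) ^+ 2)%:E.
  have gE p : g p = (w1 p + w2 p - 2 * Re (k p.1 p.2))%:E.
    rewrite /g /w1 /w2 /k; congr EFin; rewrite !sqr_normcE !(cReM,cImM,cReD,cImD,cReN,cImN,cReJ,cImJ,cReC,cImC).
    by ring.
  rewrite -(eq_integral _ _ (fun p _ => gE p)) fubini_tonelli1//.
    rewrite (funext gE); apply/measurable_EFinP; apply: measurable_funB.
      by apply: measurable_funD; exact/measurable_EFinP.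
    by apply: measurable_funM; [exact: measurable_cst|exact: mk.1].
  by move=> p; rewrite lee_fin; exact: mulr_ge0 (P0 p) (sqr_ge0 _).
rewrite RintegralB// RintegralD// RintegralZl// I1 I2.
have -> : Re (cintegral (fun x => u x * cintegral (fun y => (u y)^* * (poisson e (x - y))%:C))) =
    \int[(leb \x leb)%E]_p Re (k p.1 p.2).
  rewrite (@eq_cintegral _ _ (fun x => cintegral (k x))); last first.
    by move=> x; rewrite -(cintegralZ (u x) (L1_poisson x u1)).
  exact: (Rfubini1 ik).
by set A := \int[_]_p _; lra.
Qed.

(** The multiplication formula is applied to u and to h = m conj(F u), whose transform is the
    Poisson average of conj(u). *)
Lemma plancherel_regularized u : L1 u -> L2 u ->
  (\int[leb]_xi (m xi * normc (fourierL1 u xi) ^+ 2)%:E = (sqn u - fine (cenergy u) / 2)%:E)%E.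
Proof.
move=> u1 u2; have mF := cmeasurable_fourierL1 (L1_cmeasurable u1).
have mF1 : L1 (fun xi => (m xi)%:C * (fourierL1 u xi)^*).
  apply: (@L1_expabs_bounded (2 * L1norm u)); first exact: cmeasurableJ.
  by move=> xi; rewrite normc_conj normc_fourierL1_le.
have := fourierL1_duality u1 mF1.
under [X in _ = X]eq_cintegral do rewrite (fourierL1_smoothed _ u1).
move/(congr1 (@complex.Re R)); rewrite Re_poisson_form// => <-.
have FE xi : Re (fourierL1 u xi * ((m xi)%:C * (fourierL1 u xi)^*)) =
    m xi * normc (fourierL1 u xi) ^+ 2.
  by rewrite mulrCA mulcJ cReM !cReC !cImC mulr0 subr0.
have FF1 : L1 (fun xi => (m xi)%:C * (fourierL1 u xi * (fourierL1 u xi)^*)).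
  apply: (@L1_expabs_bounded ((2 * L1norm u) ^+ 2)).
    exact: (cmeasurableM mF (cmeasurableJ mF)).
  move=> xi; rewrite ComplexField.Normc.normcM normc_conj -expr2.
  by rewrite ler_pXn2r ?nnegrE ?normc_ge0 ?normc_fourierL1_le// (le_trans (normc_ge0 _) (normc_fourierL1_le 0 u1)).
have iF : leb.-integrable [set: T] (EFin \o (fun xi => m xi * normc (fourierL1 u xi) ^+ 2)).
  have := L1_Re FF1; apply: eq_integrable => // xi _.
  by congr EFin; rewrite -FE; congr complex.Re; exact: mulrCA.
rewrite [in RHS]/cintegral -[LHS]fineK; last exact: (integrable_fin_num measurableT iF).
by congr EFin; apply: eq_Rintegral => xi _; rewrite -FE.
Qed.

End plancherel_regularized.

(** * Removal of the damping *)

Section plancherel.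
Context {R : realType}.
Local Notation T := (lebesgueType R).
Local Notation Re := complex.Re.
Local Notation Im := complex.Im.
Implicit Types (u v w h : R -> R[i]).

Let eps n : R := n.+1%:R^-1.

Let eps0 n : 0 < eps n.
Proof. by rewrite invr_gt0. Qed.

Lemma L2_Re_fin u : L2 u -> (\int[leb]_x ((Re (u x)) ^+ 2)%:E < +oo)%E.
Proof.
move=> u2; have /integrableP[mn] := L2_integrable u2; apply: le_lt_trans.
have [m1 _] := L2_cmeasurable u2.
apply: ge0_le_integral; [exact: measurableT|by move=> x _; rewrite lee_fin sqr_ge0| | |].
- by apply/measurable_EFinP; exact: measurable_funX m1.
- by apply: measurableT_comp; [exact: abse_measurable|exact: mn].
- move=> x _; rewrite [X in (_ <= X)%E]/= lee_fin ger0_norm ?sqr_ge0// sqr_normcE lerDl.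
  exact: sqr_ge0.
Qed.

Lemma L2_Im_fin u : L2 u -> (\int[leb]_x ((Im (u x)) ^+ 2)%:E < +oo)%E.
Proof.
move=> u2; have /integrableP[mn] := L2_integrable u2; apply: le_lt_trans.
have [_ m2] := L2_cmeasurable u2.
apply: ge0_le_integral; [exact: measurableT|by move=> x _; rewrite lee_fin sqr_ge0| | |].
- by apply/measurable_EFinP; exact: measurable_funX m2.
- by apply: measurableT_comp; [exact: abse_measurable|exact: mn].
- move=> x _; rewrite [X in (_ <= X)%E]/= lee_fin ger0_norm ?sqr_ge0// sqr_normcE lerDr.
  exact: sqr_ge0.
Qed.

Lemma cenergy_cvg0 u : L2 u -> cenergy (eps n) u @[n --> \oo] --> 0%E.
Proof.
move=> u2; have [m1 m2] := L2_cmeasurable u2.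
have v1 := vanishing_L2 m1 (L2_Re_fin u2).
have v2 := vanishing_L2 m2 (L2_Im_fin u2).
rewrite (_ : (fun n => _) = (fun n => energy (eps n) (fun x : T => Re (u x)) +
  energy (eps n) (fun x : T => Im (u x)))%E).
  rewrite -[X in _ --> X]adde0; apply: cvgeD; [by []|exact: v1|exact: v2].
by apply/funext => n; rewrite (cenergyE (eps0 n) (L2_cmeasurable u2)).
Qed.

(** As e decreases to 0 the damping factor increases to 1, so the left side converges by monotone
    convergence, while the energy on the right tends to 0. Finiteness of the limit comes out of the
    identity and is not presupposed. *)
Lemma plancherel_norm u : L1 u -> L2 u ->
  (\int[leb]_xi (normc (fourierL1 u xi) ^+ 2)%:E = (sqn u)%:E)%E.
Proof.
move=> u1 u2; have mF := cmeasurable_fourierL1 (L1_cmeasurable u1).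
pose g n (xi : T) := (expabs (2 * pi * eps n) xi * normc (fourierL1 u xi) ^+ 2)%:E.
have g0 n xi : (0 <= g n xi)%E by rewrite lee_fin mulr_ge0 ?expabs_ge0 ?sqr_ge0.
have mg n : measurable_fun [set: T] (g n).
  apply/measurable_EFinP; apply: measurable_funM; last exact: (measurable_sqr_normc mF).
  by apply: measurable_fun_leb; exact: measurable_expabs.
have ndg xi : {homo g ^~ xi : n p / (n <= p)%N >-> (n <= p)%E}.
  move=> n p np; rewrite lee_fin ler_wpM2r ?sqr_ge0// ler_expR lerN2.
  rewrite ler_wpM2r// ler_wpM2l ?mulr_ge0 ?pi_ge0//.
  by rewrite lef_pV2 ?posrE// ler_nat ltnS.
have cg xi : g n xi @[n --> \oo] --> (normc (fourierL1 u xi) ^+ 2)%:E.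
  apply: cvg_EFin; first exact: nearW.
  rewrite -[X in _ --> X]mul1r; apply: cvgMl.
  have e1 : expR (- (2 * pi * 0 * `|xi|)) = 1 by rewrite mulr0 mul0r oppr0 expR0.
  rewrite -[X in _ --> X]e1.
  apply: continuous_cvg; first exact: continuous_expR.
  apply: cvgN; apply: cvgMl; apply: cvgM; [exact: cvg_cst|exact: cvg_harmonic].
have := @cvg_monotone_convergence _ T R leb [set: T] measurableT g mg (fun n xi _ => g0 n xi) (fun xi _ => ndg xi).
have -> : (\int[leb]_xi limn (g ^~ xi) = \int[leb]_xi (normc (fourierL1 u xi) ^+ 2)%:E)%E.
  by apply: eq_integral => xi _; apply/cvg_lim => //; exact: cg.
under eq_fun do rewrite (plancherel_regularized (eps0 _) u1 u2).
move=> H1.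
have H2 : (sqn u - fine (cenergy (eps n) u) / 2)%:E @[n --> \oo] --> (sqn u)%:E.
  apply: cvg_EFin; first exact: nearW.
  rewrite -[X in _ --> X]subr0 -(mul0r 2^-1); apply: cvgB; first exact: cvg_cst.
  apply: cvgMl; have /fine_cvgP[_] := cenergy_cvg0 u2; exact.
exact: (cvg_unique _ H1 H2).
Qed.

End plancherel.

(** * The Fourier transform on L^2 *)

Section fourier_L2.
Context {R : realType}.
Local Notation T := (lebesgueType R).
Local Notation Re := complex.Re.
Implicit Types (u v w h g : R -> R[i]).

Lemma L2_sqn_lt u : cmeasurable u -> (\int[leb]_x (normc (u x) ^+ 2)%:E < +oo)%E -> L2 u.
Proof. by []. Qed.

Lemma L2_fourierL1 u : L1 u -> L2 u -> L2 (fourierL1 u).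
Proof.
move=> u1 u2; apply: L2_sqn_lt; first exact: (cmeasurable_fourierL1 (L1_cmeasurable u1)).
by rewrite (plancherel_norm u1 u2) ltry.
Qed.

Lemma sqn_fourierL1 u : L1 u -> L2 u -> sqn (fourierL1 u) = sqn u.
Proof. by move=> u1 u2; rewrite {1}/sqn /Rintegral (plancherel_norm u1 u2). Qed.

Lemma fourierL1D u v : L1 u -> L1 v ->
  fourierL1 (fun x => u x + v x) = (fun xi => fourierL1 u xi + fourierL1 v xi).
Proof.
move=> u1 v1; apply/funext => xi; rewrite !fourierL1E -(cintegralD (L1_fker xi u1) (L1_fker xi v1)).
by apply: eq_cintegral => x; rewrite mulrDr.
Qed.

Lemma fourierL1Z (c : R[i]) u : L1 u ->
  fourierL1 (fun x => c * u x) = (fun xi => c * fourierL1 u xi).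
Proof.
move=> u1; apply/funext => xi; rewrite !fourierL1E -(cintegralZ c (L1_fker xi u1)).
by apply: eq_cintegral => x; rewrite mulrCA.
Qed.

Lemma L1B u v : L1 u -> L1 v -> L1 (fun x => u x - v x).
Proof.
move=> u1 v1; rewrite (_ : (fun x => _) = fun x => u x + -1 * v x).
  exact: (L1D u1 (L1Z (-1) v1)).
by apply/funext => x; rewrite mulN1r.
Qed.

Lemma fourierL1B u v : L1 u -> L1 v ->
  fourierL1 (fun x => u x - v x) = (fun xi => fourierL1 u xi - fourierL1 v xi).
Proof.
move=> u1 v1; rewrite (_ : (fun x => u x - v x) = fun x => u x + -1 * v x).
  rewrite (fourierL1D u1 (L1Z _ v1)) (fourierL1Z _ v1).
  by apply/funext => x; rewrite mulN1r.
by apply/funext => x; rewrite mulN1r.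
Qed.

Lemma fourierL1_sum (I : Type) (r : seq I) (f : I -> R -> R[i]) : (forall i, L1 (f i)) ->
  L1 (fun x => \sum_(i <- r) f i x) /\
  fourierL1 (fun x => \sum_(i <- r) f i x) = (fun xi => \sum_(i <- r) fourierL1 (f i) xi).
Proof.
move=> f1; elim: r => [|i r [ih1 ih2]].
  have -> : (fun x => \sum_(i <- [::]) f i x) = fun=> 0 by apply/funext => x; rewrite big_nil.
  split; first exact: L10.
  apply/funext => xi; rewrite big_nil fourierL1E (@eq_cintegral _ _ (fun=> 0 * 0)).
    by rewrite (cintegralZ _ L10) mul0r.
  by move=> x; rewrite mulr0 mul0r.
have -> : (fun x => \sum_(j <- i :: r) f j x) = (fun x => f i x + \sum_(j <- r) f j x).
  by apply/funext => x; rewrite big_cons.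
split; first exact: (L1D (f1 i) ih1).
by rewrite (fourierL1D (f1 i) ih1) ih2; apply/funext => xi; rewrite big_cons.
Qed.

Lemma Re_inner_fourierL1 u w : L1 u -> L2 u -> L1 w -> L2 w ->
  Re (inner (fourierL1 u) (fourierL1 w)) = Re (inner u w).
Proof.
move=> u1 u2 w1 w2.
have := sqn_fourierL1 (L1B u1 w1) (L2B u2 w2).
rewrite (fourierL1B u1 w1) (innerBB (L2_fourierL1 u1 u2) (L2_fourierL1 w1 w2)) (innerBB u2 w2).
rewrite !sqn_fourierL1//; lra.
Qed.

Lemma inner_fourierL1 u w : L1 u -> L2 u -> L1 w -> L2 w ->
  inner (fourierL1 u) (fourierL1 w) = inner u w.
Proof.
move=> u1 u2 w1 w2; apply: complexP; first exact: Re_inner_fourierL1.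
(* Replacing w by i w turns the identity of real parts into that of imaginary parts. *)
have := Re_inner_fourierL1 u1 u2 (L1Z (Complex 0 1) w1) (L2Z (Complex 0 1) w2).
rewrite (fourierL1Z _ w1) (innerZr _ (L2_fourierL1 w1 w2) (L2_fourierL1 u1 u2)) (innerZr _ w2 u2).
move: (inner _ _) (inner _ _) => z z'; rewrite !cReM !cReJ !cImJ.
by case: z => a b; case: z' => a' b' /=; rewrite !mul0r !mulN1r !sub0r !opprK.
Qed.

(** The inverse transform, as the conjugate of the forward transform of the conjugate, so that every
    estimate is inherited. *)
Definition fourierL1inv h : R -> R[i] := fun x => (fourierL1 (fun xi => (h xi)^*) x)^*.

Lemma sqnJ u : sqn (fun x => (u x)^*) = sqn u.
Proof. by apply: eq_Rintegral => x _; rewrite normc_conj. Qed.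

Lemma L2_fourierL1inv h : L1 h -> L2 h -> L2 (fourierL1inv h).
Proof. by move=> h1 h2; exact: (L2J (L2_fourierL1 (L1J h1) (L2J h2))). Qed.

Lemma sqn_fourierL1inv h : L1 h -> L2 h -> sqn (fourierL1inv h) = sqn h.
Proof. by move=> h1 h2; rewrite sqnJ (sqn_fourierL1 (L1J h1) (L2J h2)) sqnJ. Qed.

Lemma inner_fourierL1inv u h : L1 u -> L1 h ->
  inner (fourierL1 u) h = inner u (fourierL1inv h).
Proof.
move=> u1 h1; rewrite /inner (fourierL1_duality u1 (L1J h1)).
by apply: eq_cintegral => x; rewrite /fourierL1inv conjCK.
Qed.

Lemma sqn0 : sqn (fun=> 0 : R[i]) = 0.
Proof.
by rewrite /sqn ComplexField.Normc.normc0 expr0n/= Rintegral_cst// mul0r.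
Qed.

Lemma cvgL2P (un : nat -> R -> R[i]) u : (forall n, L2 (un n)) -> L2 u ->
  cvgL2 un u <-> sqn (fun x => un n x - u x) @[n --> \oo] --> (0 : R).
Proof.
move=> un2 u2; have E n : (\int[leb]_x (normc (un n x - u x) ^+ 2)%:E)%E =
    (sqn (fun x => un n x - u x))%:E.
  by rewrite (integral_sqr_normc (L2B (un2 n) u2)).
rewrite /cvgL2 (funext E); split => [/fine_cvgP[_ H]|H]; first exact: H.
by apply: cvg_EFin; [exact: nearW|exact: H].
Qed.

Lemma is_fourier_fourierL1 u : L1 u -> L2 u -> is_fourier u (fourierL1 u).
Proof.
move=> u1 u2; have F2 := L2_fourierL1 u1 u2; split; [exact: u2|exact: F2|].
exists (fun=> u); split; first by split.
  apply/cvgL2P => //; rewrite (_ : (fun n => _) = fun=> 0); first exact: cvg_cst.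
  apply/funext => n; rewrite -[RHS]sqn0; congr sqn; apply/funext => x; exact: subrr.
apply/cvgL2P => //; rewrite (_ : (fun n => _) = fun=> 0); first exact: cvg_cst.
by apply/funext => n; rewrite -[RHS]sqn0; congr sqn; apply/funext => x; exact: subrr.
Qed.

(* Limit of the polarized Plancherel identity along the approximating sequence. *)
Lemma is_fourier_inner u g w : is_fourier u g -> L1 w -> L2 w ->
  inner g (fourierL1 w) = inner u w.
Proof.
move=> [u2 g2 [un [un12 cu cg]]] w1 w2.
have un2 n : L2 (un n) := (un12 n).2.
have F2 n : L2 (fourierL1 (un n)) := L2_fourierL1 (un12 n).1 (un2 n).
have W2 := L2_fourierL1 w1 w2.
have H1 := cvgL2_inner un2 u2 w2 cu.
have H2 := cvgL2_inner F2 g2 W2 cg.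
have H n : normc (inner g (fourierL1 w) - inner u w) <=
    normc (inner (fourierL1 (un n)) (fourierL1 w) - inner g (fourierL1 w)) +
    normc (inner (un n) w - inner u w).
  rewrite -(normcN (inner (fourierL1 (un n)) _ - _)) opprB.
  apply: le_trans (le_normcD _ _).
  by rewrite (inner_fourierL1 (un12 n).1 (un2 n) w1 w2) addrA subrK.
apply/eqP; rewrite -subr_eq0; apply/eqP; apply: ComplexField.Normc.eq0_normc.
apply/eqP; rewrite eq_le normc_ge0 andbT.
have := cvgD H2 H1; rewrite addr0 => H12.
by apply: (cvgr_to_ge (H12 _)); apply: nearW => n; exact: H.
Qed.


Lemma sqnD_le u v : L2 u -> L2 v -> sqn (fun x => u x + v x) <= 2 * sqn u + 2 * sqn v.
Proof.
move=> u2 v2.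
have i2 (f : R -> R[i]) : L2 f ->
    leb.-integrable [set: T] (EFin \o (fun x => 2 * normc (f x) ^+ 2)).
  move=> f2; have := integrableZl measurableT 2 (L2_integrable f2).
  by apply: eq_integrable.
rewrite /sqn -(RintegralZl _ measurableT (L2_integrable u2)) -(RintegralZl _ measurableT (L2_integrable v2)).
rewrite -(RintegralD measurableT (i2 _ u2) (i2 _ v2)).
apply: le_Rintegral; [exact: measurableT|exact: (L2_integrable (L2D u2 v2))| |].
  by have := integrableD measurableT (i2 _ u2) (i2 _ v2); apply: eq_integrable.
by move=> x _; exact: sqr_normcD_le.
Qed.

Lemma sqn_sym u v : sqn (fun x => u x - v x) = sqn (fun x => v x - u x).
Proof. by apply: eq_Rintegral => x _; rewrite -(normcN (u x - v x)) opprB. Qed.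

(** Both functions are L^2 limits of the transforms of the same approximating sequence. Hence, on
    functions that are also in L^1, whatever [fourier] selects agrees almost everywhere with the
    integral formula. *)
Lemma is_fourier_unique u g : L1 u -> is_fourier u g -> sqn (fun x => g x - fourierL1 u x) = 0.
Proof.
move=> u1 [u2 g2 [un [un12 cu cg]]].
have un2 n : L2 (un n) := (un12 n).2.
have F2 n : L2 (fourierL1 (un n)) := L2_fourierL1 (un12 n).1 (un2 n).
have U2 := L2_fourierL1 u1 u2.
have H1 := (cvgL2P un2 u2).1 cu.
have H2 := (cvgL2P F2 g2).1 cg.
have H n : sqn (fun x => g x - fourierL1 u x) <=
    2 * sqn (fun x => fourierL1 (un n) x - g x) + 2 * sqn (fun x => un n x - u x).
  rewrite -(sqn_fourierL1 (L1B (un12 n).1 u1) (L2B (un2 n) u2)) (fourierL1B (un12 n).1 u1).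
  rewrite (sqn_sym (fourierL1 (un n)) g).
  apply: le_trans (sqnD_le (L2B g2 (F2 n)) (L2B (F2 n) U2)).
  rewrite le_eqVlt; apply/orP; left; apply/eqP; congr sqn; apply/funext => x.
  by rewrite addrA subrK.
apply/eqP; rewrite eq_le sqn_ge0 andbT.
have c2 (a : nat -> R) : a n @[n --> \oo] --> (0 : R) -> 2 * a n @[n --> \oo] --> (0 : R).
  by move=> a0; rewrite -[X in _ --> X](mulr0 2); apply: cvgMr.
have := cvgD (c2 _ H2) (c2 _ H1); rewrite addr0 => H12.
by apply: (cvgr_to_ge (H12 _)); apply: nearW => n; exact: H.
Qed.

Definition cindic (A : set R) (x : R) : R[i] := (\1_A x)%:C.

Lemma sqr_normc_cindic (A : set R) x : normc (cindic A x) ^+ 2 = \1_A x.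
Proof. by rewrite normc_real indicE; case: (_ \in _); rewrite /= ?normr1 ?normr0 ?expr1n ?expr0n. Qed.

Lemma cmeasurable_cindic (A : set R) : lebesgue_measurable A -> cmeasurable (cindic A).
Proof. by move=> mA; apply: cmeasurable_real; exact: measurable_indic_leb. Qed.

Lemma L2_cindic (A : set R) : lebesgue_measurable A -> (leb A < +oo)%E -> L2 (cindic A).
Proof.
move=> mA Afin; apply: (L2_le _ _ (integrable_indic_leb mA Afin)).
  exact: cmeasurable_cindic.
by move=> x; rewrite sqr_normc_cindic.
Qed.

Lemma sqn_cindic (A : set R) : lebesgue_measurable A -> (sqn (cindic A)) = fine (leb A).
Proof.
move=> mA; rewrite -(integral_indic_leb mA) /sqn /Rintegral; congr fine.
by apply: eq_integral => x _; rewrite sqr_normc_cindic.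
Qed.

Lemma L2_opP (A : set R) u : lebesgue_measurable A -> L2 u -> L2 (opP A u).
Proof.
move=> mA u2; apply: (@L2_dom _ 1 _ u); [|exact: u2|].
  exact: (cmeasurableM (cmeasurable_cindic mA) (L2_cmeasurable u2)).
move=> x; rewrite mul1r /opP ComplexField.Normc.normcM exprMn sqr_normc_cindic.
by rewrite ler_piMl ?sqr_ge0// indicE; case: (_ \in _).
Qed.

Lemma L1_opP (A : set R) u : lebesgue_measurable A -> (leb A < +oo)%E -> L2 u -> L1 (opP A u).
Proof. by move=> mA Afin u2; exact: (L2M (L2_cindic mA Afin) u2). Qed.

Lemma conjc_realE (a : R) : (a%:C)^* = a%:C.
Proof. by apply: complexP; rewrite ?cReJ// cImJ cImC oppr0. Qed.

Lemma inner_opP (A : set R) u w : inner (opP A u) w = inner u (opP A w).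
Proof.
rewrite /inner; apply: eq_cintegral => x.
by rewrite /opP [in RHS]conjcM conjc_realE mulrA [u x * _]mulrC.
Qed.

End fourier_L2.

(** * The eigenvalues of [S_{A,B}] *)

Section concentration_operator.
Context {R : realType}.
Local Notation T := (lebesgueType R).
Implicit Types (u v w h g : R -> R[i]).

Lemma opP_id (A : set R) u : opP A (opP A u) = opP A u.
Proof.
apply/funext => x; rewrite /opP mulrA -rmorphM/= indicE; congr (_%:C * _).
by case: (_ \in _); rewrite /= ?mulr1 ?mulr0.
Qed.

Lemma inner_opP_self (A : set R) u : inner (opP A u) u = (sqn (opP A u))%:C.
Proof. by rewrite -inner_sqn -{1}opP_id inner_opP. Qed.

Lemma sqn_opPE (A : set R) u : sqn (opP A u) = \int[leb]_x (\1_A x * normc (u x) ^+ 2).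
Proof.
apply: eq_Rintegral => x _.
by rewrite /opP ComplexField.Normc.normcM exprMn; congr (_ * _); exact: sqr_normc_cindic.
Qed.

Definition window (n : nat) : set R := `](- n%:R), n%:R]%classic.

Lemma measurable_window n : lebesgue_measurable (window n).
Proof. by apply: measurable_leb; exact: measurable_itv. Qed.

Lemma leb_window n : leb (window n) = (n%:R + n%:R : R)%:E.
Proof. by rewrite leb_itv_oc ?opprK//; have := ler0n R n; lra. Qed.

Lemma leb_window_fin n : (leb (window n) < +oo)%E.
Proof. by rewrite leb_window ltry. Qed.

Lemma window_near (x : R) : \forall n \near \oo, window n x.
Proof.
have [N xN] : exists N : nat, `|x| < N%:R.
  by exists (Num.trunc `|x|).+1; exact: Num.Theory.truncnS_gt.
exists N => // n /= Nn; rewrite /window /= in_itv /=.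
have : `|x| < n%:R by apply: lt_le_trans xN _; rewrite ler_nat.
by rewrite ltr_norml => /andP[-> /ltW].
Qed.

Lemma cvg_sqn_window u : L2 u -> sqn (opP (window n) u) @[n --> \oo] --> sqn u.
Proof.
move=> u2; have iu := L2_integrable u2; have [mu _] := integrableP _ _ _ iu.
have mi n := measurable_indic_leb (measurable_window n).
have H : (\int[leb]_x (\1_(window n) x * normc (u x) ^+ 2)%:E @[n --> \oo] -->
    \int[leb]_x (normc (u x) ^+ 2)%:E)%E.
  have := @dominated_convergence _ T R leb [set: T] measurableT
    (fun n x => (\1_(window n) x * normc (u x) ^+ 2)%:E)
    (fun x => (normc (u x) ^+ 2)%:E) (fun x => (normc (u x) ^+ 2)%:E).
  case.
  - move=> n; apply/measurable_EFinP.
    exact: (measurable_funM (mi n) (measurable_sqr_normc (L2_cmeasurable u2))).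
  - exact: mu.
  - apply: aeW => x _; apply: cvg_near_cst.
    by apply: filterS (window_near x) => n nx; rewrite indicE mem_set// mul1r.
  - exact: iu.
  - apply: aeW => x n _; rewrite lee_fin normrM ger0_norm ?indicE//.
    by rewrite (ger0_norm (sqr_ge0 _)) ler_piMl ?sqr_ge0//; case: (_ \in _).
  - by move=> _ _; exact.
have E n : (\int[leb]_x (\1_(window n) x * normc (u x) ^+ 2)%:E)%E = (sqn (opP (window n) u))%:E.
  rewrite -(integral_sqr_normc (L2_opP (measurable_window n) u2)); apply: eq_integral => x _.
  congr EFin; rewrite /opP ComplexField.Normc.normcM exprMn; congr (_ * _).
  by rewrite -[RHS]/(normc (cindic (window n) x) ^+ 2) sqr_normc_cindic.
by move: H; rewrite (funext E) (integral_sqr_normc u2) => /fine_cvgP[_].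
Qed.

(** This is Fourier inversion. The function G = [fourierL1inv h] may fail to be in L^1, so it is
    approximated by its truncations G_n. Isometry and <F G_n, h> = <G_n, G> give |F G_n - h|^2 =
    |G|^2 - |G_n|^2, so no pointwise inversion formula enters. *)
Lemma is_fourier_fourierL1inv h : L1 h -> L2 h -> is_fourier (fourierL1inv h) h.
Proof.
move=> h1 h2; have G2 := L2_fourierL1inv h1 h2; set G := fourierL1inv h in G2 *.
pose un n := opP (window n) G.
have un2 n : L2 (un n) := L2_opP (measurable_window n) G2.
have un1 n : L1 (un n) := L1_opP (measurable_window n) (leb_window_fin n) G2.
have F2 n := L2_fourierL1 (un1 n) (un2 n).
have H : sqn G - sqn (un n) @[n --> \oo] --> (0 : R).
  by rewrite -(subrr (sqn G)); apply: cvgB; [exact: cvg_cst|exact: cvg_sqn_window].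
split; [exact: G2|exact: h2|exists un; split; [by move=> n; split| |]].
- apply/(cvgL2P un2 G2); rewrite (_ : (fun n => _) = (fun n => sqn G - sqn (un n)))//.
  apply/funext => n; rewrite (innerBB (un2 n) G2) inner_opP_self cReC; lra.
- apply/(cvgL2P F2 h2); rewrite (_ : (fun n => _) = (fun n => sqn G - sqn (un n)))//.
  apply/funext => n; rewrite (innerBB (F2 n) h2) (inner_fourierL1inv (un1 n) h1).
  rewrite (sqn_fourierL1 (un1 n) (un2 n)) inner_opP_self cReC (sqn_fourierL1inv h1 h2); lra.
Qed.

Lemma fourierP u : L1 u -> L2 u -> is_fourier u (fourier u).
Proof.
move=> u1 u2; apply: (@xgetPex _ (fun=> 0) [set g | is_fourier u g]).
by exists (fourierL1 u); exact: is_fourier_fourierL1.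
Qed.

Lemma inv_fourierP h : L1 h -> L2 h -> is_fourier (inv_fourier h) h.
Proof.
move=> h1 h2; apply: (@xgetPex _ (fun=> 0) [set u | is_fourier u h]).
by exists (fourierL1inv h); exact: is_fourier_fourierL1inv.
Qed.

Lemma sqn_eq0_inner u v w : L2 u -> L2 v -> L2 w -> sqn (fun x => u x - v x) = 0 ->
  inner u w = inner v w.
Proof.
move=> u2 v2 w2 uv0; have := cauchy_schwarz (L2B u2 v2) w2; rewrite uv0 mul0r => H.
have : inner (fun x => u x - v x) w = 0.
  apply: ComplexField.Normc.eq0_normc; apply/eqP; rewrite -sqrf_eq0 eq_le H.
  exact: sqr_ge0.
rewrite (_ : (fun x => u x - v x) = (fun x => u x + -1 * v x)); last first.
  by apply/funext => x; rewrite mulN1r.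
rewrite (innerDl u2 (L2Z _ v2) w2) (innerZl _ v2 w2) mulN1r => /eqP.
by rewrite subr_eq0 => /eqP.
Qed.

Variables A B : set R.
Hypotheses (mA : lebesgue_measurable A) (mB : lebesgue_measurable B).
Hypotheses (Afin : (leb A < +oo)%E) (Bfin : (leb B < +oo)%E).

(** As A has finite measure, 1_A u is in L^1 for u in L^2, and this transform is an honest integral,
    defined at every point. *)
Definition trunc_fourier u := fourierL1 (opP A u).

Lemma L2_trunc_fourier u : L2 u -> L2 (trunc_fourier u).
Proof. by move=> u2; exact: (L2_fourierL1 (L1_opP mA Afin u2) (L2_opP mA u2)). Qed.

(** Testing against w removes the two arbitrary choices: [is_fourier_inner] moves the inverse
    transform onto w, and [is_fourier_unique] replaces the selected transform of 1_A u by the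
    integral. *)
Lemma opS_spec u : L2 u -> L2 (opS A B u) /\
  forall w, L2 w -> inner (opS A B u) w = inner (opP B (trunc_fourier u)) (trunc_fourier w).
Proof.
move=> u2; have a1 := L1_opP mA Afin u2; have a2 := L2_opP mA u2.
have Fa := fourierP a1 a2; set g := fourier (opP A u) in Fa.
have [_ g2 _] := Fa.
have h1 := L1_opP mB Bfin g2; have h2 := L2_opP mB g2.
have FU := inv_fourierP h1 h2.
have [U2 _ _] := FU.
split; first exact: (L2_opP mA U2).
move=> w w2; rewrite /opS inner_opP.
rewrite -(is_fourier_inner FU (L1_opP mA Afin w2) (L2_opP mA w2)) !inner_opP.
apply: sqn_eq0_inner; [exact: g2|exact: (L2_trunc_fourier u2)| |exact: (is_fourier_unique a1 Fa)].
exact: (L2_opP mB (L2_trunc_fourier w2)).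
Qed.

Lemma eqae_inner u v w : L2 u -> L2 v -> L2 w -> eqae u v -> inner u w = inner v w.
Proof.
move=> u2 v2 w2 uv; apply: sqn_eq0_inner; [exact: u2|exact: v2|exact: w2|].
have E0 : (\int[leb]_x (normc (u x - v x) ^+ 2)%:E = 0)%E.
  rewrite -[RHS](@integral0 _ T R leb setT).
  apply: ae_eq_integral; [exact: measurableT| |exact: measurable_cst|].
    apply/measurable_EFinP.
    exact: (measurable_sqr_normc (cmeasurableB (L2_cmeasurable u2) (L2_cmeasurable v2))).
  have [N [mN N0 sN]] := uv; exists N; split; [exact: mN|exact: N0|].
  apply: subset_trans sN => x /= H uvx; apply: H => _.
  by rewrite uvx subrr ComplexField.Normc.normc0 expr0n.
by rewrite /sqn /Rintegral E0.
Qed.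

End concentration_operator.

(** * Spectral systems: the trace bound and the weight of the tail *)

Section spectral.
Context {R : realType}.
Local Notation T := (lebesgueType R).
Implicit Types (u w : R -> R[i]).

Variables A B : set R.
Hypotheses (mA : lebesgue_measurable A) (mB : lebesgue_measurable B).
Hypotheses (Afin : (leb A < +oo)%E) (Bfin : (leb B < +oo)%E).

Local Notation tF := (trunc_fourier A).

Lemma inner_opS_self u : L2 u -> inner (opS A B u) u = (sqn (opP B (tF u)))%:C.
Proof. by move=> u2; rewrite ((opS_spec mA mB Afin Bfin u2).2 _ u2) inner_opP_self. Qed.

Variables (lam : nat -> R) (v : nat -> R -> R[i]).
Hypothesis sys : spectral_system A B lam v.

Lemma realC_sum (I : Type) (r : seq I) (f : I -> R) :
  (\sum_(i <- r) f i)%:C = \sum_(i <- r) (f i)%:C.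
Proof. exact: rmorph_sum. Qed.

Lemma realCB (a b : R) : (a - b)%:C = a%:C - b%:C.
Proof. exact: rmorphB. Qed.

Lemma realCM (a b : R) : (a * b)%:C = a%:C * b%:C.
Proof. exact: rmorphM. Qed.

Let v2 n : L2 (v n). Proof. by case: sys. Qed.
Let lam_ge0 n : 0 <= lam n. Proof. by case: sys => -[/(_ n)/andP[]]. Qed.
Let lam_dec n : lam n.+1 <= lam n. Proof. by case: sys => -[_ /(_ n)]. Qed.
Let ov : orthonormal_seq v. Proof. by case: sys => _ h1 h2 _ _; split. Qed.

Lemma spectral_lamE n : lam n = sqn (opP B (tF (v n))).
Proof.
have [_ _ _ /(_ n) Sv _] := sys.
have S2 := (opS_spec mA mB Afin Bfin (v2 n)).1.
apply: complexI; rewrite -(inner_opS_self (v2 n)).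
rewrite (eqae_inner S2 (L2Z _ (v2 n)) (v2 n) Sv) (innerZl _ (v2 n) (v2 n)).
by rewrite ov.2 eqxx mulr1.
Qed.

Lemma L2_trunc_kernel xi : L2 (opP A (fun x => (fker x xi)^*)).
Proof.
apply: (@L2_dom _ 1 _ (cindic A)); [|exact: (L2_cindic mA Afin)|].
  exact: (cmeasurableM (cmeasurable_cindic mA) (cmeasurableJ (cmeasurable_fker xi))).
move=> x; rewrite /opP ComplexField.Normc.normcM exprMn normc_conj sqr_normc_fker mulr1 mul1r.
exact: lexx.
Qed.

Lemma sqn_trunc_kernel xi : sqn (opP A (fun x => (fker x xi)^*)) = fine (leb A).
Proof.
rewrite -(sqn_cindic mA); apply: eq_Rintegral => x _.
by rewrite /opP ComplexField.Normc.normcM exprMn normc_conj sqr_normc_fker mulr1.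
Qed.

Lemma trunc_fourier_inner u xi : tF u xi = inner u (opP A (fun x => (fker x xi)^*)).
Proof.
rewrite -inner_opP /inner; apply: eq_cintegral => x.
by rewrite conjCK mulrC.
Qed.

(** At fixed xi, the values F (1_A v_k)(xi) are the coefficients on v_k, up to conjugation, of the
    function 1_A(x) exp (2 i pi x xi), whose squared norm is |A|; Bessel's inequality concludes. *)
Lemma sum_trunc_fourier_le n xi : \sum_(k < n) normc (tF (v k) xi) ^+ 2 <= fine (leb A).
Proof.
rewrite -(sqn_trunc_kernel xi).
apply: le_trans (bessel n ov (L2_trunc_kernel xi)).
rewrite le_eqVlt; apply/orP; left; apply/eqP; apply: eq_bigr => k _.
by rewrite trunc_fourier_inner (innerC (L2_trunc_kernel xi) (v2 k)) normc_conj.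
Qed.

Lemma Rintegral_sum (I : Type) (r : seq I) (f : I -> T -> R) :
  (forall i, leb.-integrable [set: T] (EFin \o f i)) ->
  leb.-integrable [set: T] (EFin \o (fun x => \sum_(i <- r) f i x)) /\
  \int[leb]_x (\sum_(i <- r) f i x) = \sum_(i <- r) \int[leb]_x f i x.
Proof.
move=> fi; elim: r => [|i r [ih1 ih2]].
  have -> : (fun x : T => \sum_(i <- [::]) f i x) = fun=> 0.
    by apply/funext => x; rewrite big_nil.
  split; first exact: integrable0.
  by rewrite big_nil Rintegral_cst// mul0r.
have -> : (fun x : T => \sum_(j <- i :: r) f j x) = (fun x => f i x + \sum_(j <- r) f j x).
  by apply/funext => x; rewrite big_cons.
split; first by have := integrableD measurableT (fi i) ih1; apply: eq_integrable.
by rewrite big_cons -ih2 (RintegralD measurableT (fi i) ih1).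
Qed.

Lemma integrable_opP u : L2 u ->
  leb.-integrable [set: T] (EFin \o (fun x => \1_B x * normc (u x) ^+ 2)).
Proof.
move=> u2; have := L2_integrable (L2_opP mB u2); apply: eq_integrable => // x _.
congr EFin; rewrite /opP ComplexField.Normc.normcM exprMn; congr (_ * _).
by rewrite -[LHS]/(normc (cindic B x) ^+ 2) sqr_normc_cindic.
Qed.

(** Since lam_k is the integral over B of |F (1_A v_k)|^2, it suffices to integrate the pointwise
    Bessel bound over B. This is one half of the trace formula tr S = |A| |B|. *)
Lemma sum_lam_le n : \sum_(k < n) lam k <= fine (leb A) * fine (leb B).
Proof.
have i (k : 'I_n) := integrable_opP (L2_trunc_fourier mA Afin (v2 k)).
have [is_ Es] := Rintegral_sum (index_enum 'I_n) i.
rewrite (eq_bigr (fun k : 'I_n => \int[leb]_x (\1_B x * normc (tF (v k) x) ^+ 2))); last first.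
  by move=> k _; rewrite spectral_lamE sqn_opPE.
rewrite -Es.
have iB := integrable_indic_leb mB Bfin.
have -> : fine (leb A) * fine (leb B) = \int[leb]_x (fine (leb A) * \1_B x).
  by rewrite (RintegralZl _ measurableT iB) /Rintegral integral_indic_leb.
apply: le_Rintegral; [exact: measurableT|exact: is_| |].
  by have := integrableZl measurableT (fine (leb A)) iB; apply: eq_integrable.
move=> x _; rewrite -mulr_sumr mulrC ler_wpM2r ?indicE//.
exact: sum_trunc_fourier_le.
Qed.

Lemma lam_nonincreasing m n : (m <= n)%N -> lam n <= lam m.
Proof.
move=> /subnK <-; elim: (n - m)%N => [|d ih]; first by rewrite add0n.
by rewrite addSn; apply: le_trans ih.
Qed.

Lemma lam_decay n : n.+1%:R * lam n <= fine (leb A) * fine (leb B).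
Proof.
apply: le_trans (sum_lam_le n.+1).
rewrite mulr_natl -[X in _ *+ X]card_ord -sumr_const.
by apply: ler_sum => k _; apply: lam_nonincreasing; rewrite -ltnS.
Qed.

(** The L^2 expansion of S w is paired with w; the partial sums become real because each coefficient
    meets its conjugate. *)
Lemma cvg_spectral_form w : L2 w ->
  \sum_(k < n) lam k * normc (inner w (v k)) ^+ 2 @[n --> \oo] --> sqn (opP B (tF w)).
Proof.
move=> w2; have [_ _ _ _ /(_ _ w2) cS] := sys.
have S2 := (opS_spec mA mB Afin Bfin w2).1.
pose p n x := \sum_(k < n) (lam k)%:C * inner w (v k) * v k x.
have p2 n : L2 (p n) := L2_lincomb (fun k => (lam k)%:C * inner w (v k)) n ov.
have pw n : inner (p n) w = (\sum_(k < n) lam k * normc (inner w (v k)) ^+ 2)%:C.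
  rewrite (innerC w2 (p2 n)) (inner_lincomb (fun k => (lam k)%:C * inner w (v k)) n ov w2).
  rewrite conjc_sum realC_sum; apply: eq_bigr => k _.
  by rewrite (conjcM (((lam k)%:C * inner w (v k))^*)) conjCK -mulrA mulcJ realCM.
have H := cvgL2_inner p2 S2 w2 cS.
apply/cvgrPdist_le => e e0; move/cvgr0Pnorm_le : H => /(_ _ e0).
apply: filterS => n; rewrite pw (inner_opS_self w2) -realCB normc_real normr_id => H.
by rewrite distrC.
Qed.

Lemma spectral_form_le w n : L2 w ->
  \sum_(k < n) lam k * normc (inner w (v k)) ^+ 2 <= sqn (opP B (tF w)).
Proof.
move=> w2; apply: (cvgr_to_ge (cvg_spectral_form w2)).
exists n => // m /= nm.
rewrite -!(big_mkord xpredT (fun k => lam k * normc (inner w (v k)) ^+ 2)).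
rewrite (big_cat_nat (leq0n n) nm)/= lerDl sumr_ge0// => k _.
by rewrite mulr_ge0 ?sqr_ge0.
Qed.

(* Each eigenvalue contributes at most [eta] to the sum of the S-forms of the [phi j]: test the
   spectral expansion on the projection of the eigenvector onto the span of the family. *)
Lemma tail_lower_bound (phi : nat -> R -> R[i]) (N r : nat) (eta M : R) :
  orthonormal_seq phi -> 0 <= eta ->
  (forall c : nat -> R[i], sqn (opP B (tF (fun x => \sum_(j < N) c j * phi j x))) <=
     eta * \sum_(j < N) normc (c j) ^+ 2) ->
  M <= \sum_(j < N) sqn (opP B (tF (phi j))) ->
  forall s, s < M - r%:R * eta -> exists n, s <= \sum_(r <= k < n) lam k.
Proof.
move=> oph eta0 Heta HM s sM.
pose wt k := \sum_(j < N) normc (inner (v k) (phi j)) ^+ 2.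
have wt0 k : 0 <= wt k by apply: sumr_ge0 => j _; exact: sqr_ge0.
have wt1 k : wt k <= 1.
  apply: le_trans (bessel N oph (v2 k)) _.
  suff -> : sqn (v k) = 1 by [].
  by apply: complexI; rewrite -inner_sqn ov.2 eqxx.
have lamwt k : lam k * wt k <= eta.
  have [w0|wn0] := eqVneq (wt k) 0; first by rewrite w0 mulr0.
  have wpos : 0 < wt k by rewrite lt_neqAle eq_sym wn0 wt0.
  pose c j := inner (v k) (phi j).
  pose g x := \sum_(j < N) c j * phi j x.
  have g2 : L2 g := L2_lincomb c N oph.
  have gv : normc (inner g (v k)) ^+ 2 = wt k ^+ 2.
    rewrite (innerC (v2 k) g2) normc_conj (inner_lincomb c N oph (v2 k)).
    have -> : \sum_(j < N) (c j)^* * inner (v k) (phi j) = (wt k)%:C.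
      by rewrite realC_sum; apply: eq_bigr => j _; rewrite mulrC mulcJ.
    by rewrite normc_real ger0_norm.
  (* For the projection g of v_k, both |g|^2 and <g, v_k> equal [wt k]. Keeping only the k-th term
     of the form gives lam_k wt_k^2 <= eta wt_k. *)
  have := le_trans (spectral_form_le k.+1 g2) (Heta c).
  rewrite big_ord_recr/= gv -/(wt k) => H.
  rewrite -(ler_pM2r wpos) -mulrA -expr2; apply: le_trans H.
  by rewrite lerDr; apply: sumr_ge0 => j _; rewrite mulr_ge0 ?sqr_ge0.
have cS : \sum_(k < n) lam k * wt k @[n --> \oo] --> \sum_(j < N) sqn (opP B (tF (phi j))).
  have cs : \sum_(j < N) \sum_(k < n) lam k * normc (inner (phi j) (v k)) ^+ 2 @[n --> \oo] -->
      \sum_(j < N) sqn (opP B (tF (phi j))).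
    elim: (index_enum 'I_N) => [|j s' ih].
      rewrite big_nil; under eq_fun do rewrite big_nil; exact: cvg_cst.
    rewrite big_cons; under eq_fun do rewrite big_cons.
    by apply: cvgD; [exact: (cvg_spectral_form (oph.1 j))|exact: ih].
  rewrite (_ : (fun n => _) = (fun n => \sum_(j < N) \sum_(k < n) lam k * normc (inner (phi j) (v k)) ^+ 2))//.
  apply/funext => n; rewrite exchange_big/=; apply: eq_bigr => k _.
  rewrite mulr_sumr; apply: eq_bigr => j _.
  by rewrite (innerC (oph.1 j) (v2 k)) normc_conj.
have [n [rn sn]] : exists n, (r <= n)%N /\ s + r%:R * eta <= \sum_(k < n) lam k * wt k.
  have sM' : s + r%:R * eta < \sum_(j < N) sqn (opP B (tF (phi j))).
    by apply: lt_le_trans HM; rewrite -ltrBrDr.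
  have := cvgr_ge _ cS _ sM'.
  move=> [n0 _ Hn0]; exists (maxn n0 r); split; first exact: leq_maxr.
  by apply: Hn0 => /=; exact: leq_maxl.
exists n; rewrite -(lerD2r (r%:R * eta)); apply: le_trans sn _.
(* The first r terms cost at most eta each; in the others the weight is at most 1 and is dropped. *)
rewrite -(big_mkord xpredT (fun k => lam k * wt k)) (big_cat_nat (leq0n r) rn)/= addrC lerD//.
- by apply: ler_sum => k _; rewrite ler_piMr.
- rewrite big_mkord mulr_natl -[X in _ *+ X]card_ord -sumr_const.
  by apply: ler_sum => k _.
Qed.

End spectral.

(** * Short intervals along an arithmetic progression *)

Section exponentials.
Context {R : realType}.
Local Notation T := (lebesgueType R).

Lemma integrable_itv_bounded (a b M : R) (f : R -> R) : a <= b -> continuous f ->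
  (forall x, `|f x| <= M) ->
  leb.-integrable [set: T] (EFin \o (fun x => \1_`]a, b] x * f x)).
Proof.
move=> ab cf fM.
have mI : lebesgue_measurable `]a, b] by apply: measurable_leb; exact: measurable_itv.
have iI : leb.-integrable [set: T] (fun x => (\1_`]a, b] x : R)%:E).
  by apply: (integrable_indic_leb mI); rewrite leb_itv_oc// ltry.
have := integrableZl measurableT M iI; apply: integrable_le => [|x].
  apply: measurable_funM; first exact: measurable_indic_leb.
  by apply: measurable_fun_leb; exact: continuous_measurable_fun.
rewrite normrM ger0_norm ?indicE// mulrC ler_wpM2r//.
Qed.

Lemma Rintegral_itv_FTC (a b M : R) (f F : R -> R) : a < b -> continuous f ->
  (forall x, `|f x| <= M) -> (forall x : R, is_derive x 1 F (f x)) ->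
  \int[leb]_x (\1_`]a, b] x * f x) = F b - F a.
Proof.
move=> ab cf fM dF.
have mf : measurable_fun [set: R] f by exact: continuous_measurable_fun.
have mI : measurable_fun [set: R] (\1_`]a, b] : R -> R) by exact: measurable_indic.
have mIf : measurable_fun [set: R] (EFin \o (fun x => \1_`]a, b] x * f x)).
  by apply/measurable_EFinP; exact: measurable_funM.
have cF : continuous F.
  move=> x; apply: differentiable_continuous; apply/derivable1_diffP; exact: ex_derive.
rewrite /Rintegral (integral_leb mIf (integrable_itv_bounded (ltW ab) cf fM)).
rewrite (_ : (\int[lebesgue_measure]_x _)%E = (\int[lebesgue_measure]_(x in `]a, b]) (f x)%:E)%E).
  rewrite integral_itv_obnd_cbnd; last by apply/measurable_EFinP; exact: measurable_funTS.
  rewrite (@continuous_FTC2 _ f F)//.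
  - exact: continuous_subspaceT.
  - by split=> [y _| |]; [exact: ex_derive|apply: cvg_at_right_filter; exact: cF|
      apply: cvg_at_left_filter; exact: cF].
  - by move=> y _; rewrite derive1E derive_val.
rewrite [RHS]integral_mkcond; apply: eq_integral => x _.
by rewrite patchE /= indicE; case: (x \in _); rewrite ?mul1r ?mul0r.
Qed.

Lemma Rintegral_itv_cos (K w : R) : 0 < K -> w != 0 ->
  \int[leb]_x (\1_`](- K), K] x * cos (w * x)) = 2 * sin (w * K) / w.
Proof.
move=> K0 w0.
have dF (x : R) : is_derive x 1 (fun y => sin (w * y) / w) (cos (w * x)).
  by apply: is_derive_eq; rewrite /GRing.scale/=; field.
rewrite (@Rintegral_itv_FTC _ _ 1 _ _ _ _ _ dF); last 3 first.
- by rewrite -subr_gt0; lra.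
- exact: continuous_cosM.
- by move=> x; exact: cos_max.
by rewrite mulrN sinN; field.
Qed.

Lemma Rintegral_itv_sin (K w : R) : 0 < K -> w != 0 ->
  \int[leb]_x (\1_`](- K), K] x * sin (w * x)) = 0.
Proof.
move=> K0 w0.
have dF (x : R) : is_derive x 1 (fun y => - cos (w * y) / w) (sin (w * x)).
  by apply: is_derive_eq; rewrite /GRing.scale/=; field.
rewrite (@Rintegral_itv_FTC _ _ 1 _ _ _ _ _ dF); last 3 first.
- by rewrite -subr_gt0; lra.
- exact: continuous_sinM.
- by move=> x; exact: sin_max.
by rewrite mulrN cosN subrr.
Qed.

Lemma sin_natpi n : sin (pi * n%:R) = 0 :> R.
Proof.
elim: n => [|n ih]; first by rewrite mulr0 sin0.
by rewrite -natr1 mulrDr mulr1 sinD ih sinpi mul0r mulr0 addr0.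
Qed.

Lemma sin_diff_natpi (m n : nat) : sin (pi * (m%:R - n%:R)) = 0 :> R.
Proof. by rewrite mulrBr sinB !sin_natpi mul0r mulr0 subrr. Qed.

Variable K : nat.
Hypothesis K0 : (0 < K)%N.

Let K0' : 0 < K%:R :> R. Proof. by rewrite ltr0n. Qed.

(** The window has length 2K, so exponentials with frequencies in the multiples of 1/(2K) are
    orthogonal on it; this dictates the spacing of the intervals of A. The scalar factor normalizes
    them. *)
Definition wexp (j : nat) (xi : R) : R[i] :=
  ((Num.sqrt (2 * K%:R))^-1)%:C * opP (window K) (fker (j%:R * (2 * K%:R)^-1)) xi.

Lemma L2_opP_fker (t : R) : L2 (opP (window K) (fker t)).
Proof.
apply: (@L2_dom _ 1 _ (cindic (window K))).
- apply: (cmeasurableM (cmeasurable_cindic (measurable_window K))).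
  rewrite (_ : fker t = fun xi => fker xi t); first exact: cmeasurable_fker.
  by apply/funext => xi; rewrite fkerC.
- exact: (L2_cindic (measurable_window K) (leb_window_fin K)).
- move=> x; rewrite /opP ComplexField.Normc.normcM exprMn sqr_normc_fker mulr1 mul1r.
  exact: lexx.
Qed.

(** Off the diagonal the integral is a multiple of sin (w K) with w K = pi (m - n), hence 0. *)
Lemma inner_window_fker (m n : nat) :
  inner (opP (window K) (fker (m%:R * (2 * K%:R)^-1 : R)))
    (opP (window K) (fker (n%:R * (2 * K%:R)^-1 : R))) =
  ((m == n)%:R * (2 * K%:R) : R)%:C.
Proof.
set a := m%:R * _; set b := n%:R * _.
have -> : inner (opP (window K) (fker a)) (opP (window K) (fker b)) =
    cintegral (fun xi => cindic (window K) xi * fker (a - b) xi).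
  rewrite inner_opP opP_id -inner_opP /inner; apply: eq_cintegral => xi.
  by rewrite /opP fkerB mulrA.
have [mn|mn] := eqVneq m n.
  rewrite mul1r; have -> : a - b = 0 by rewrite /a /b mn subrr.
  rewrite (@eq_cintegral _ _ (cindic (window K))); last by move=> xi; rewrite fker0 mulr1.
  apply: complexP; last by rewrite /cintegral /= Rintegral_cst// mul0r.
  rewrite /cintegral /= /Rintegral (integral_indic_leb (measurable_window K)) leb_window /=.
  by rewrite mulr2n mulrDl !mul1r.
rewrite mul0r.
pose w := 2 * pi * (a - b).
have ab : a - b = (m%:R - n%:R) / (2 * K%:R) by rewrite /a /b -mulrBl.
have mn0 : m%:R - n%:R != 0 :> R by rewrite subr_eq0 eqr_nat.
have w0 : w != 0.
  rewrite /w ab; apply: mulf_neq0; first by rewrite gt_eqF// mulr_gt0// pi_gt0.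
  by apply: mulf_neq0; [exact: mn0|rewrite invr_eq0 gt_eqF// mulr_gt0].
have wK : w * K%:R = pi * (m%:R - n%:R).
  by rewrite /w ab; move: (pi : R) => q; field; rewrite gt_eqF.
apply: complexP; rewrite /cintegral /= ?cReC ?cImC.
- transitivity (\int[leb]_x (\1_(window K) x * cos (w * x))).
    by apply: eq_Rintegral => x _ /=; ring.
  by rewrite (Rintegral_itv_cos K0' w0) wK sin_diff_natpi mulr0 mul0r.
- have KK : - K%:R <= K%:R :> R by have := K0'; lra.
  have iS := integrable_itv_bounded KK (@continuous_sinM R w) (fun x => sin_max (w * x)).
  transitivity (\int[leb]_x (-1 * (\1_(window K) x * sin (w * x)))).
    by apply: eq_Rintegral => x _ /=; ring.
  rewrite (RintegralZl _ measurableT iS).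
  by rewrite (Rintegral_itv_sin K0' w0) mulr0.
Qed.

Lemma orthonormal_wexp : orthonormal_seq wexp.
Proof.
split=> [n|m n]; first exact: (L2Z _ (L2_opP_fker _)).
rewrite (innerZl _ (L2_opP_fker _) (L2Z _ (L2_opP_fker _))) (innerZr _ (L2_opP_fker _) (L2_opP_fker _)).
rewrite inner_window_fker conjc_realE -!realCM.
have k0 : 0 < 2 * K%:R :> R by rewrite mulr_gt0.
have -> : (Num.sqrt (2 * K%:R))^-1 * ((Num.sqrt (2 * K%:R))^-1 * ((m == n)%:R * (2 * K%:R))) = (m == n)%:R :> R.
  rewrite mulrA -invfM -expr2 sqr_sqrtr ?ltW// mulrCA mulVf ?mulr1// gt_eqF//.
by case: (m == n).
Qed.

End exponentials.

(** * Normalized indicators of short intervals *)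

Section spikes.
Context {R : realType}.
Local Notation Re := complex.Re.
Local Notation Im := complex.Im.

Lemma cintegral_shift (u : R -> R[i]) (h : R) : L1 u ->
  measurable_fun [set: R] (fun x => Re (u x)) -> measurable_fun [set: R] (fun x => Im (u x)) ->
  cintegral (fun x => u (x + h)) = cintegral u.
Proof.
move=> u1 mR mI; rewrite /cintegral /Rintegral; congr (fine _ +i* fine _).
- apply: (@integral_shift R (EFin \o (fun x => Re (u x))) h); last exact: (L1_Re u1).
  exact/measurable_EFinP.
- apply: (@integral_shift R (EFin \o (fun x => Im (u x))) h); last exact: (L1_Im u1).
  exact/measurable_EFinP.
Qed.

Lemma fkerD (x y xi : R) : fker (x + y) xi = fker x xi * fker y xi.
Proof.
have e : 2 * pi * (x + y) * xi = 2 * pi * x * xi + 2 * pi * y * xi by ring.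
apply: complexP; rewrite ?cReM ?cImM /fker /= e.
  by rewrite cosD; ring.
by rewrite sinD; ring.
Qed.

Lemma normc_sum_le (I : Type) (r : seq I) (F : I -> R[i]) :
  normc (\sum_(i <- r) F i) <= \sum_(i <- r) normc (F i).
Proof.
elim: r => [|i r ih]; first by rewrite !big_nil normc_real normr0.
by rewrite !big_cons; apply: le_trans (le_normcD _ _) _; rewrite lerD2l.
Qed.

Lemma sqr_sum_le (a : nat -> R) N :
  (\sum_(j < N) a j) ^+ 2 <= N%:R * \sum_(j < N) a j ^+ 2.
Proof.
elim: N => [|N ih]; first by rewrite !big_ord0 expr0n mul0r.
have S0 : 0 <= \sum_(j < N) a j ^+ 2 by apply: sumr_ge0 => j _; exact: sqr_ge0.
rewrite !big_ord_recr/=; move: (\sum_(i < N) a i) (\sum_(i < N) a i ^+ 2) (a N) ih S0 => s S b ih S0.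
rewrite -natr1; have : 0 <= N%:R :> R by exact: ler0n.
move: (N%:R : R) ih => n ih; rewrite le_eqVlt => /orP[/eqP n0|n0].
  move: ih; rewrite -n0 mul0r => ih.
  have -> : s = 0 by apply/eqP; rewrite -sqrf_eq0 eq_le ih sqr_ge0.
  by nra.
suff : 0 <= n * (S + n * b ^+ 2 - 2 * s * b) by rewrite pmulr_rge0//; nra.
by have := sqr_ge0 (s - n * b); nra.
Qed.

Lemma L1_cindic (A : set R) : lebesgue_measurable A -> (leb A < +oo)%E -> L1 (cindic A).
Proof.
move=> mA Afin; apply: (L1_le _ _ (integrable_indic_leb mA Afin)).
  exact: cmeasurable_cindic.
by move=> x; rewrite normc_real indicE; case: (_ \in _); rewrite ?normr1 ?normr0.
Qed.

Variable d : R.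
Hypothesis d0 : 0 < d.

Definition slot (t : R) : set R := `]t, t + d]%classic.

Lemma measurable_slot t : lebesgue_measurable (slot t).
Proof. by apply: measurable_leb; exact: measurable_itv. Qed.

Lemma leb_slot t : leb (slot t) = d%:E.
Proof. by rewrite leb_itv_oc ?lerDl ?ltW// addrC addKr. Qed.

Lemma leb_slot_fin t : (leb (slot t) < +oo)%E.
Proof. by rewrite leb_slot ltry. Qed.

Lemma slot_shift t x : \1_(slot t) (x + t) = \1_(slot 0) x :> R.
Proof.
rewrite !indicE; congr (_%:R); congr nat_of_bool; apply/idP/idP; rewrite !inE /slot /= !in_itv /=; lra.
Qed.

Definition spike (t x : R) : R[i] := ((Num.sqrt d)^-1)%:C * cindic (slot t) x.

Lemma L2_spike t : L2 (spike t).
Proof. exact: (L2Z _ (L2_cindic (measurable_slot t) (leb_slot_fin t))). Qed.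

Lemma L1_spike t : L1 (spike t).
Proof. exact: (L1Z _ (L1_cindic (measurable_slot t) (leb_slot_fin t))). Qed.

Lemma opP_spike (A : set R) t : slot t `<=` A -> opP A (spike t) = spike t.
Proof.
move=> sA; apply/funext => x; rewrite /opP /spike mulrCA; congr (_ * _).
rewrite /cindic -realCM; congr (_%:C); rewrite !indicE.
case: (boolP (x \in slot t)) => [|_]; last by rewrite mulr0.
by rewrite inE => /sA; rewrite -inE => ->; rewrite mulr1.
Qed.

Lemma normc_spike t x : normc (spike t x) ^+ 2 = d^-1 * \1_(slot t) x.
Proof.
rewrite /spike ComplexField.Normc.normcM exprMn sqr_normc_cindic normc_real.
by rewrite real_normK ?num_real// exprVn sqr_sqrtr// ltW.
Qed.

Lemma sqn_spike t : sqn (spike t) = 1.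
Proof.
have E : sqn (spike t) = \int[leb]_x (d^-1 * \1_(slot t) x).
  by apply: eq_Rintegral => x _; rewrite normc_spike.
rewrite E (RintegralZl _ measurableT (integrable_indic_leb (measurable_slot t) (leb_slot_fin t))).
by rewrite /Rintegral (integral_indic_leb (measurable_slot t)) leb_slot/= mulVf// gt_eqF.
Qed.

Lemma inner_spike_disjoint s t : s + d <= t -> inner (spike s) (spike t) = 0.
Proof.
move=> st; rewrite -[RHS](mul0r (cintegral (spike s))) -(cintegralZ 0 (L1_spike s)).
apply: eq_cintegral => x; rewrite mul0r.
have [xs|xs] := boolP (x \in slot s); last first.
  by rewrite /spike /cindic [\1_(slot s) x]indicE (negPf xs) mulr0 mul0r.
have xt : (x \in slot t) = false.
  apply/negP; move: xs; rewrite !inE /slot /= !in_itv /=; lra.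
by rewrite /spike /cindic [\1_(slot t) x]indicE xt mulr0 conjc_realE mulr0.
Qed.

Lemma fourierL1_spike_shift t xi :
  fourierL1 (spike t) xi = fker t xi * fourierL1 (spike 0) xi.
Proof.
have mk (c : R) (b : R -> R) : continuous b ->
    measurable_fun [set: R] (fun x => c * b x * \1_(slot t) x).
  move=> cb; apply: measurable_funM; last by apply: measurable_indic; exact: measurable_itv.
  by apply: measurable_funM; [exact: measurable_cst|exact: continuous_measurable_fun].
rewrite !fourierL1E -(cintegral_shift t (L1_fker xi (L1_spike t))).
- rewrite -(cintegralZ _ (L1_fker xi (L1_spike 0))); apply: eq_cintegral => x.
  by rewrite fkerD /spike /cindic slot_shift; ring.
- rewrite (_ : (fun x => _) = fun x => (Num.sqrt d)^-1 * cos (2 * pi * xi * x) * \1_(slot t) x).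
    exact: (mk _ _ (@continuous_cosM R _)).
  by apply/funext => x; rewrite /spike /cindic /fker -realCM !cReM cReC cImC /= (mulrAC _ x); ring.
- rewrite (_ : (fun x => _) = fun x => - (Num.sqrt d)^-1 * sin (2 * pi * xi * x) * \1_(slot t) x).
    exact: (mk _ _ (@continuous_sinM R _)).
  by apply/funext => x; rewrite /spike /cindic /fker -realCM !cImM cReC cImC /= (mulrAC _ x); ring.
Qed.

Lemma normc_fourierL1_spike t xi : normc (fourierL1 (spike t) xi) = normc (fourierL1 (spike 0) xi).
Proof. by rewrite fourierL1_spike_shift ComplexField.Normc.normcM normc_fker mul1r. Qed.

Lemma fourierL1_spikeE t xi :
  fourierL1 (spike t) xi = ((Num.sqrt d)^-1)%:C * fourierL1 (cindic (slot t)) xi.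
Proof. by rewrite (fourierL1Z _ (L1_cindic (measurable_slot t) (leb_slot_fin t))). Qed.

(** The transform at xi is the inner product of a unit vector with an exponential cut to an interval
    of length d. *)
Lemma sqr_normc_fourierL1_spike_le t xi : normc (fourierL1 (spike t) xi) ^+ 2 <= d.
Proof.
have m_ := measurable_slot t; have f_ := leb_slot_fin t.
have E : fourierL1 (spike t) xi = inner (spike t) (opP (slot t) (fun x => (fker x xi)^*)).
  by rewrite -trunc_fourier_inner /trunc_fourier opP_spike.
have := cauchy_schwarz (L2_spike t) (L2_trunc_kernel m_ f_ xi).
by rewrite -E sqn_spike sqn_trunc_kernel// leb_slot mul1r.
Qed.

(** The modulus does not depend on t, so take t = 0: the phase stays below rho on ]0, d], the real
    part of the transform of the indicator is at least d/2, and the normalization turns (d/2)^2 into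
    d/4. *)
Lemma sqr_normc_fourierL1_spike_ge (t xi rho : R) : (forall x, `|x| <= rho -> 2^-1 <= cos x) ->
  2 * pi * d * `|xi| <= rho -> d / 4 <= normc (fourierL1 (spike t) xi) ^+ 2.
Proof.
move=> hrho hd; rewrite normc_fourierL1_spike fourierL1_spikeE ComplexField.Normc.normcM exprMn.
rewrite normc_real real_normK ?num_real// exprVn sqr_sqrtr ?(ltW d0)//.
have m_ := measurable_slot 0; have f_ := leb_slot_fin 0; have i_ := integrable_indic_leb m_ f_.
suff H : d / 2 <= Re (fourierL1 (cindic (slot 0)) xi).
  rewrite ler_pdivlMl// sqr_normcE; have := sqr_ge0 (Im (fourierL1 (cindic (slot 0)) xi)).
  move: (Re _) (Im _) H => a b H b0.
  have d2 : 0 <= d / 2 by rewrite divr_ge0// ltW.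
  by have := ler_pM d2 d2 H H; move: b0; rewrite !expr2; lra.
have -> : Re (fourierL1 (cindic (slot 0)) xi) = \int[leb]_x (\1_(slot 0) x * cos (2 * pi * xi * x)).
  rewrite -[LHS]/(\int[leb]_x Re (fker x xi * cindic (slot 0) x)); apply: eq_Rintegral => x _.
  by rewrite cReM cReC cImC /= (mulrAC _ (x : R)); ring.
have -> : d / 2 = \int[leb]_x (2^-1 * \1_(slot 0) x).
  rewrite (RintegralZl _ measurableT i_) /Rintegral (integral_indic_leb m_) leb_slot/=; lra.
apply: le_Rintegral; [exact: measurableT| | |].
- by have := integrableZl measurableT 2^-1 i_; apply: eq_integrable.
- apply: (@integrable_itv_bounded _ _ _ 1); first by rewrite add0r ltW.
    exact: continuous_cosM.
  by move=> x; exact: cos_max.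
move=> x _; rewrite mulrC [X in _ <= X * _]indicE [X in X * _]indicE.
have [xs|_] := boolP (_ \in _); last by rewrite !mul0r.
rewrite !mul1r; apply: hrho.
move: xs; rewrite inE /slot /= in_itv /= add0r => /andP[x0 xd].
rewrite !normrM (ger0_norm (ltW x0)) (ger0_norm (pi_ge0 R)) ger0_norm//.
by apply: le_trans hd; rewrite mulrAC ler_wpM2r// ler_wpM2l// mulr_ge0// pi_ge0.
Qed.

End spikes.

(** * The spans of the families, tested on B *)

Section comb.
Context {R : realType}.
Local Notation T := (lebesgueType R).

Variables (B : set R) (mB : lebesgue_measurable B) (Bfin : (leb B < +oo)%E).

(** The measure of the part of B inside the window, written as a squared norm so that
    [cvg_sqn_window] gives its convergence to |B|. *)
Definition wpart K := sqn (opP (window K) (cindic B)).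

Lemma wpartE K : wpart K = \int[leb]_x (\1_(window K) x * \1_B x).
Proof. by rewrite /wpart sqn_opPE; apply: eq_Rintegral => x _; rewrite sqr_normc_cindic. Qed.

Lemma integrable_wpart K : leb.-integrable [set: T] (EFin \o (fun x => \1_(window K) x * \1_B x)).
Proof.
apply: (integrable_le _ _ (integrable_indic_leb mB Bfin)).
  by apply: measurable_funM; apply: measurable_indic_leb; [exact: measurable_window|].
by move=> x; rewrite !indicE; do 2 case: (_ \in _); rewrite /= ?mulr1 ?mulr0 ?normr1 ?normr0.
Qed.

Variables (d : R) (K : nat).
Hypotheses (d0 : 0 < d) (K0 : (0 < K)%N) (dK : d <= (2 * K%:R)^-1).

Definition comb (j : nat) : R -> R[i] := spike d (j%:R * (2 * K%:R)^-1).

Lemma orthonormal_comb : orthonormal_seq comb.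
Proof.
split=> [n|m n]; first exact: (L2_spike d0).
have H p q : (p < q)%N -> inner (comb p) (comb q) = 0.
  move=> pq; apply: inner_spike_disjoint => //.
  have : p.+1%:R <= q%:R :> R by rewrite ler_nat.
  have k0 : 0 <= (2 * K%:R)^-1 :> R by rewrite invr_ge0 mulr_ge0.
  rewrite -natr1 => /(ler_wpM2r k0); rewrite mulrDl mul1r.
  by apply: le_trans; rewrite lerD2l.
have [mn|nm|->] := ltngtP m n.
- by rewrite H.
- by rewrite (innerC (L2_spike d0 _) (L2_spike d0 _)) H// conjc_realE.
- by rewrite inner_sqn (sqn_spike d0).
Qed.

Lemma fourierL1_comb_lincomb (c : nat -> R[i]) N :
  L1 (fun x => \sum_(j < N) c j * comb j x) /\
  fourierL1 (fun x => \sum_(j < N) c j * comb j x) =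
    fun xi => fourierL1 (spike d 0) xi * \sum_(j < N) c j * fker (j%:R * (2 * K%:R)^-1) xi.
Proof.
have f1 (j : 'I_N) : L1 (fun x => c j * comb j x) by exact: (L1Z _ (L1_spike d0 _)).
have [l1 E] := fourierL1_sum (index_enum 'I_N) f1.
split; first exact: l1.
rewrite E; apply/funext => xi; rewrite mulr_sumr; apply: eq_bigr => j _.
rewrite (fourierL1Z _ (L1_spike d0 _)) (fourierL1_spike_shift d0); ring.
Qed.

Lemma sqr_normc_comb_le (c : nat -> R[i]) N xi :
  normc (\sum_(j < N) c j * fker (j%:R * (2 * K%:R)^-1) xi) ^+ 2 <=
  N%:R * \sum_(j < N) normc (c j) ^+ 2.
Proof.
apply: le_trans (sqr_sum_le (fun j => normc (c j)) N).
rewrite ler_pXn2r// ?nnegrE ?normc_ge0 ?sumr_ge0// => [|j _]; last exact: normc_ge0.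
apply: le_trans (normc_sum_le _ _) _; apply: ler_sum => j _.
by rewrite ComplexField.Normc.normcM normc_fker mulr1.
Qed.

(** The transform is F phi_0 times a trigonometric polynomial P, and |F phi_0|^2 <= d. On the
    window, B is forgotten and the integral of |P|^2 is 2K times the sum of the |c_j|^2, by
    orthonormality of [wexp]. On the rest of B, Cauchy-Schwarz bounds |P|^2 by N times that sum. The
    auxiliary [Q] is P cut to the window and divided by sqrt (2K). *)
Lemma sqn_opP_comb_le (c : nat -> R[i]) N :
  sqn (opP B (fourierL1 (fun x => \sum_(j < N) c j * comb j x))) <=
  (2 * K%:R * d + (fine (leb B) - wpart K) * N%:R * d) * \sum_(j < N) normc (c j) ^+ 2.
Proof.
have [g1 Eg] := fourierL1_comb_lincomb c N.
have g2 := L2_lincomb c N orthonormal_comb.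
set C := \sum_(j < N) normc (c j) ^+ 2.
have C0 : 0 <= C by apply: sumr_ge0 => j _; exact: sqr_ge0.
pose Q xi := \sum_(j < N) c j * wexp K j xi.
have Q2 : L2 Q := L2_lincomb c N (orthonormal_wexp K0).
have Qn : sqn Q = C := sqn_lincomb c N (orthonormal_wexp K0).
have k0 : 0 < 2 * K%:R :> R by rewrite mulr_gt0// ltr0n.
have QE xi : 2 * K%:R * normc (Q xi) ^+ 2 = \1_(window K) xi *
    normc (\sum_(j < N) c j * fker (j%:R * (2 * K%:R)^-1) xi) ^+ 2.
  have -> : Q xi = ((Num.sqrt (2 * K%:R))^-1)%:C * (cindic (window K) xi *
      \sum_(j < N) c j * fker (j%:R * (2 * K%:R)^-1) xi).
    rewrite /Q !mulr_sumr; apply: eq_bigr => j _.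
    by rewrite /wexp /opP -/(cindic _ _); ring.
  rewrite ComplexField.Normc.normcM ComplexField.Normc.normcM !exprMn sqr_normc_cindic normc_real.
  rewrite real_normK ?num_real// exprVn sqr_sqrtr ?(ltW k0)//.
  by rewrite (mulVKf (lt0r_neq0 k0)).
rewrite sqn_opPE.
have iQ := integrableZl measurableT (2 * K%:R * d) (L2_integrable Q2).
have iB := integrable_indic_leb mB Bfin.
have iD := integrableB measurableT iB (integrable_wpart K).
have iT := integrableZl measurableT (N%:R * d * C) iD.
have -> : (2 * K%:R * d + (fine (leb B) - wpart K) * N%:R * d) * C =
   \int[leb]_x (2 * K%:R * d * normc (Q x) ^+ 2 + N%:R * d * C * (\1_B x - \1_(window K) x * \1_B x)).
  rewrite (RintegralD measurableT iQ iT) (RintegralZl _ measurableT (L2_integrable Q2)).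
  rewrite (RintegralZl _ measurableT iD) (RintegralB measurableT iB (integrable_wpart K)).
  rewrite -[\int[leb]_x (normc (Q x) ^+ 2)]/(sqn Q) Qn wpartE.
  rewrite [\int[leb]_x \1_B x]/Rintegral (integral_indic_leb mB).
  by ring.
apply: le_Rintegral; [exact: measurableT| | |].
- exact: (integrable_opP mB (L2_fourierL1 g1 g2)).
- by have := integrableD measurableT iQ iT; apply: eq_integrable.
move=> x _; rewrite Eg ComplexField.Normc.normcM exprMn.
rewrite (mulrAC _ d) QE.
set P2 := normc (\sum_(j < N) _) ^+ 2.
have P20 : 0 <= P2 by exact: sqr_ge0.
have HP : P2 <= N%:R * C by exact: sqr_normc_comb_le.
have Hb : normc (fourierL1 (spike d 0) x) ^+ 2 <= d := sqr_normc_fourierL1_spike_le d0 0 x.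
have dP : normc (fourierL1 (spike d 0) x) ^+ 2 * P2 <= d * P2 by rewrite ler_wpM2r.
have dPC : d * P2 <= d * (N%:R * C) by rewrite ler_wpM2l// ltW.
have dP0 : 0 <= d * P2 by rewrite mulr_ge0// ltW.
move: (normc _ ^+ 2) P2 C (N%:R : R) P20 HP Hb dP dPC dP0 {Qn C0 iT}.
move=> nb P2 C n P20 HP Hb dP dPC dP0.
rewrite !indicE; do 2 case: (_ \in _); rewrite ?mulr1n ?mulr0n; lra.
Qed.

Lemma sqn_opP_comb_ge j (rho : R) : (forall x, `|x| <= rho -> 2^-1 <= cos x) ->
  2 * pi * d * K%:R <= rho -> d / 4 * wpart K <= sqn (opP B (fourierL1 (comb j))).
Proof.
move=> hrho hd; have F2 := L2_fourierL1 (L1_spike d0 (j%:R * (2 * K%:R)^-1)) (L2_spike d0 _).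
rewrite wpartE sqn_opPE -(RintegralZl _ measurableT (integrable_wpart K)).
apply: le_Rintegral; [exact: measurableT| |exact: (integrable_opP mB F2)|].
  by have := integrableZl measurableT (d / 4) (integrable_wpart K); apply: eq_integrable.
move=> x _; rewrite [\1_(window K) x]indicE.
have [xw|_] := boolP (_ \in _); last first.
  by rewrite mul0r mulr0 mulr_ge0 ?sqr_ge0// indicE.
rewrite mul1r mulrC ler_wpM2l ?indicE//.
rewrite /comb; apply: (@sqr_normc_fourierL1_spike_ge _ _ d0 _ _ rho hrho); apply: le_trans hd.
apply: ler_wpM2l; first by rewrite !mulr_ge0// ?pi_ge0 ?ltW.
by move: xw; rewrite inE /window /= in_itv /= ler_norml => /andP[/ltW -> ->].
Qed.

End comb.

(** * Choice of N, K and d *)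

Section choice_of_A.
Context {R : realType}.

Lemma cos_ge_half : exists2 rho : R, 0 < rho & forall x, `|x| <= rho -> 2^-1 <= cos x.
Proof.
have H : 2^-1 < cos (0 : R) by rewrite cos0; lra.
have [e /= e0 He] := cvgr_ge _ (@continuous_cos R 0) _ H.
exists (e / 2) => [|x xe]; first by rewrite divr_gt0.
apply: He; rewrite /= sub0r normrN; apply: le_lt_trans xe _; lra.
Qed.

(** K is chosen so that B has little mass outside the window; then, with N d = a held fixed, N is
    taken large. The term of the window tends to 0 with d, whereas that of the complement depends
    only on a and K. *)
Lemma small_scales (B : set R) (a eta : R) : lebesgue_measurable B -> (0 < leb B < +oo)%E ->
  0 < a -> 0 < eta -> exists p : nat * nat * R, let: (N, K, d) := p in
  [/\ (0 < d) /\ (0 < K)%N, d <= (2 * K%:R)^-1, N%:R * d = a,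
      forall c : nat -> R[i], sqn (opP B (fourierL1 (fun x => \sum_(j < N) c j * comb d K j x))) <=
        eta * \sum_(j < N) normc (c j) ^+ 2 &
      forall j, d / 8 * fine (leb B) <= sqn (opP B (fourierL1 (comb d K j)))].
Proof.
move=> mB /andP[Bpos Bfin] a0 eta0; have [rho rho0 hrho] := cos_ge_half.
have b0 : 0 < fine (leb B) by rewrite fine_gt0// Bpos.
set b := fine (leb B) in b0 *.
(* The value b/2 keeps half of B in the window, which turns d/4 into d/8 below; eta / (2a) makes the
   mass outside contribute at most eta/2. *)
pose tol := Num.min (b / 2) (eta / (2 * a)).
have tol0 : 0 < tol by rewrite lt_min !divr_gt0// mulr_gt0.
have [K [K0 hK]] : exists K, (0 < K)%N /\ b - tol <= wpart B K.
  have H := cvg_sqn_window (L2_cindic mB Bfin); rewrite (sqn_cindic mB) in H.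
  have lt_b : b - tol < b by rewrite ltrBlDr ltrDl.
  have [n0 _ Hn0] := cvgr_ge _ H _ lt_b.
  by exists (maxn n0 1); split; [exact: leq_maxr|apply: Hn0; exact: leq_maxl].
have k0 : 0 < K%:R :> R by rewrite ltr0n.
have tolb : tol <= b / 2 by rewrite ge_min lexx.
have tole : tol * (2 * a) <= eta.
  by rewrite -ler_pdivlMr ?mulr_gt0// ge_min lexx orbT.
(* With d = a/N, the three terms ensure in turn that d <= 1/(2K), that 2Kd <= eta/2, and that 2 pi d
   K <= rho. *)
pose bound := a * (2 * K%:R) + 2 * K%:R * a * 2 / eta + 2 * pi * a * K%:R / rho.
pose N := (Num.trunc bound).+1; have N0 : 0 < N%:R :> R by rewrite ltr0n.
have boundN : bound < N%:R by exact: Num.Theory.truncnS_gt.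
have t1 : 0 <= a * (2 * K%:R) by rewrite !mulr_ge0// ltW.
have t2 : 0 <= 2 * K%:R * a * 2 / eta by rewrite divr_ge0 ?mulr_ge0// ltW.
have t3 : 0 <= 2 * pi * a * K%:R / rho by rewrite divr_ge0 ?mulr_ge0 ?pi_ge0// ltW.
have b1 : a * (2 * K%:R) <= N%:R by move: boundN; rewrite /bound; lra.
have b2 : 2 * K%:R * a * 2 / eta <= N%:R by move: boundN; rewrite /bound; lra.
have b3 : 2 * pi * a * K%:R / rho <= N%:R by move: boundN; rewrite /bound; lra.
have d0 : 0 < a / N%:R by rewrite divr_gt0.
have NdE : N%:R * (a / N%:R) = a by rewrite mulrC divfK// gt_eqF.
have dK : a / N%:R <= (2 * K%:R)^-1.
  by rewrite ler_pdivrMr// -ler_pdivrMl ?invr_gt0 ?mulr_gt0// invrK mulrC.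
exists (N, K, a / N%:R); split => //.
- move=> c; apply: le_trans (sqn_opP_comb_le mB Bfin d0 K0 dK c N) _.
  rewrite ler_wpM2r//; first by apply: sumr_ge0 => j _; exact: sqr_ge0.
  rewrite -[_ * N%:R * _]mulrA NdE -/b.
  have e1 : 2 * K%:R * (a / N%:R) <= eta / 2.
    rewrite mulrA ler_pdivrMr//; move: b2; rewrite ler_pdivrMr//; lra.
  have e2 : (b - wpart B K) * a <= eta / 2.
    apply: le_trans (_ : tol * a <= _); last lra.
    by rewrite ler_wpM2r ?(ltW a0)//; lra.
  lra.
- move=> j; have hd : 2 * pi * (a / N%:R) * K%:R <= rho.
    rewrite mulrA mulrAC ler_pdivrMr//; move: b3; rewrite ler_pdivrMr//.
    by rewrite [X in _ -> _ <= X]mulrC.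
  apply: le_trans (sqn_opP_comb_ge mB Bfin d0 j hrho hd).
  have -> : a / N%:R / 8 * b = a / N%:R / 4 * (b / 2) by lra.
  by apply: ler_wpM2l; [rewrite divr_ge0// ltW|lra].
Qed.

End choice_of_A.

(** * The union of the families and the contradiction *)

Section assembly.
Context {R : realType}.
Local Notation T := (lebesgueType R).

(** The point 0 is included because eigenvalues may vanish. *)
Lemma superlinear_near0 (f : R -> R[i]) (M : R) : f 0 = 0 ->
  normc (f x) / x @[x --> 0^'+] --> +oo ->
  exists2 e, 0 < e & forall x, 0 <= x <= e -> M * x <= normc (f x).
Proof.
move=> f0 /cvgryPge/(_ M)[e /= e0 He].
exists (e / 2) => [|x]; first by rewrite divr_gt0.
rewrite le_eqVlt => /andP[/orP[/eqP <-|x0] xe].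
  by rewrite mulr0 normc_ge0.
rewrite -ler_pdivlMr//; apply: He => //=.
by rewrite sub0r normrN gtr0_norm//; lra.
Qed.

Lemma trunc_fourier_supp (A : set R) u : opP A u = u -> trunc_fourier A u = fourierL1 u.
Proof. by rewrite /trunc_fourier => ->. Qed.

Lemma opP_lincomb (A : set R) (phi : nat -> R -> R[i]) (c : nat -> R[i]) N :
  (forall j : 'I_N, opP A (phi j) = phi j) ->
  opP A (fun x => \sum_(j < N) c j * phi j x) = fun x => \sum_(j < N) c j * phi j x.
Proof.
move=> H; apply/funext => x; rewrite /opP mulr_sumr; apply: eq_bigr => j _.
by rewrite -[in RHS]H /opP; ring.
Qed.

Definition slots (p : nat * nat * R) : set R :=
  let: (N, K, d) := p in \big[setU/set0]_(j < N) slot d (j%:R * (2 * K%:R)^-1).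

Lemma measurable_slots p : lebesgue_measurable (slots p).
Proof.
case: p => -[N K] d; rewrite /slots.
by apply: (@bigsetU_measurable _ T) => j _; exact: measurable_slot.
Qed.

Lemma leb_slots_le N K (d : R) : 0 < d -> (leb (slots (N, K, d)) <= (N%:R * d)%:E)%E.
Proof.
move=> d0.
have mS (j : nat) := measurable_slot d (j%:R * (2 * K%:R)^-1).
apply: le_trans (@content_subadditive _ R T leb _ (fun j : nat => slot d (j%:R * (2 * K%:R)^-1) : set T) N _ _ _) _.
- by move=> k _; exact: mS.
- exact: (measurable_slots (N, K, d)).
- by [].
rewrite (eq_bigr (fun=> d%:E)) => [|j _]; last exact: leb_slot.
by rewrite sumEFin sumr_const card_ord mulr_natl lexx.
Qed.

Lemma pow2_unbounded (s c : R) : 0 < c -> exists m, s < 2 ^+ m * c / 32.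
Proof.
move=> c0; exists (Num.trunc (32 * s / c)).+1.
have sc : 32 * s / c < 2 ^+ (Num.trunc (32 * s / c)).+1.
  apply: lt_trans (Num.Theory.truncnS_gt _) _.
  by rewrite -natrX ltr_nat ltn_expl.
by move: sc; rewrite (ltr_pdivrMr _ _ c0); lra.
Qed.

End assembly.

Theorem proposition1p17 (R : realType) (f : R -> R[i]) (B : set R) :
  f 0 = 0 ->
  normc (f x) / x @[x --> 0^'+] --> +oo ->
  lebesgue_measurable B -> (0 < leb B < +oo)%E ->
  exists A : set R,
    [/\ lebesgue_measurable A, (leb A < +oo)%E & ~ fS_trace_class f A B].
Proof.
move=> f0 fsup mB Bpos; have /andP[B0 Bfin] := Bpos.
have b0 : 0 < fine (leb B) by rewrite fine_gt0// B0.
set b := fine (leb B) in b0.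
(* Written in the shape of the terms of [epsilon_trick0], so that |A| <= 1. *)
pose a m : R := 1 / (2 ^ m.+1)%:R.
have a0 m : 0 < a m by rewrite divr_gt0// ltr0n expn_gt0.
have near0 m : exists e : R, 0 < e /\ forall x, 0 <= x <= e -> 4 ^+ m * x <= normc (f x).
  by have [e e0 He] := superlinear_near0 (4 ^+ m) f0 fsup; exists e.
have [eps /all_and2[eps0 Heps]] := choice near0.
(* As |A| <= 1, the trace bound gives r lam_r <= b, hence lam_k <= [eps m] for all k >= [r m]. *)
pose r m := (Num.trunc (b / eps m)).+1.
(* Discarding the first [r m] eigenvalues then costs a b / 32, a quarter of the total a b / 8. *)
pose eta m := a m * b / (32 * (r m)%:R).
have r0 m : 0 < (r m)%:R :> R by rewrite ltr0n.
have eta0 m : 0 < eta m by rewrite divr_gt0 ?mulr_gt0.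
have [p Hp] := choice (fun m => small_scales mB Bpos (a0 m) (eta0 m)).
pose A : set R := \bigcup_m slots (p m).
have mA : lebesgue_measurable A.
  by apply: (@bigcupT_measurable _ (lebesgueType R)) => m; exact: measurable_slots.
have A1 : (leb A <= 1%:E)%E.
  apply: le_trans (epsilon_trick0 xpredT ler01).
  apply: le_trans (measure_sigma_subadditive leb (fun m => measurable_slots (p m)) mA _) _ => //.
  apply: lee_nneseries => // m _; move: (Hp m); case: (p m) => -[N K] d [[d0 _] _ Nd _ _].
  by apply: le_trans (leb_slots_le N K d0) _; rewrite Nd lexx.
have Afin : (leb A < +oo)%E by apply: le_lt_trans A1 _; rewrite ltry.
exists A; split => // -[lam [v [sys S_fin]]].
set S := (\sum_(0 <= n <oo) _)%E in S_fin.
have SE : S = (fine S)%:E.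
  rewrite fineK// ge0_fin_numE//; apply: nneseries_ge0 => n _ _; rewrite lee_fin; exact: normc_ge0.
have partial m n : (m <= n)%N -> \sum_(m <= k < n) normc (f (lam k)) <= fine S.
  move=> mn; apply: le_trans (_ : \sum_(0 <= k < n) normc (f (lam k)) <= _).
    by rewrite [leRHS](big_cat_nat (leq0n m) mn)/= lerDr sumr_ge0// => k _; exact: normc_ge0.
  rewrite -lee_fin -SE -sumEFin.
  by apply: nneseries_lim_ge => k _ _; rewrite lee_fin; exact: normc_ge0.
have fA1 : fine (leb A) <= 1.
  by rewrite -lee_fin fineK// ge0_fin_numE.
have lam_small m k : (r m <= k)%N -> 0 <= lam k <= eps m.
  move=> rk; have [[/(_ k)/andP[-> _] _] _ _ _ _] := sys.
  rewrite andTb; apply: le_trans (lam_nonincreasing sys rk) _.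
  have rlam := lam_decay mA mB Afin Bfin sys (r m).
  have lr : (r m)%:R * lam (r m) <= b.
    apply: le_trans (_ : (r m).+1%:R * lam (r m) <= _); last first.
      by apply: le_trans rlam _; rewrite ler_piMl ?(ltW b0).
    have [[/(_ (r m))/andP[l0 _] _] _ _ _ _] := sys.
    by rewrite ler_wpM2r// ler_nat.
  have br : b <= eps m * (r m)%:R.
    by rewrite mulrC -ler_pdivrMr// ltW// Num.Theory.truncnS_gt.
  by rewrite -(ler_pM2l (r0 m)) [leRHS]mulrC (le_trans lr).
have key m : 2 ^+ m * b / 32 <= fine S.
  move: (Hp m); case Ep : (p m) => [[N K] d] [[d0 K0] dK Nd up low].
  have slotA (j : 'I_N) : opP A (comb d K j) = comb d K j.
    apply: opP_spike => x xj; exists m => //; rewrite Ep /slots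
      -(bigcup_mkord N (fun j => slot d (j%:R * (2 * K%:R)^-1))).
    by exists j => //=.
  have ab0 : 0 < a m * b by rewrite mulr_gt0.
  (* Any value below a b / 8 - a b / 32 = 3 a b / 32 would do. *)
  have [n Hn] : exists n, a m * b / 16 <= \sum_(r m <= k < n) lam k.
    apply: (tail_lower_bound mA mB Afin Bfin sys (orthonormal_comb d0 dK) (ltW (eta0 m))
      (N := N) (M := a m * b / 8)).
    - by move=> c; rewrite (trunc_fourier_supp (opP_lincomb c slotA)).
    - apply: le_trans (_ : \sum_(j < N) d / 8 * b <= _).
        rewrite sumr_const card_ord -mulr_natl -Nd; lra.
      apply: ler_sum => j _; rewrite (trunc_fourier_supp (slotA j)); exact: low.
    - have -> : (r m)%:R * eta m = a m * b / 32 by rewrite /eta; field; rewrite gt_eqF.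
      lra.
  have [nr|rn] := leqP n (r m); first by move: Hn; rewrite big_geq//; lra.
  apply: le_trans (partial _ _ (ltnW rn)).
  apply: le_trans (_ : 4 ^+ m * \sum_(r m <= k < n) lam k <= _).
    (* Here the gain 4^m meets a = 2^-(m+1), which leaves 2^m / 2. *)
    have -> : 2 ^+ m * b / 32 = 4 ^+ m * (a m * b / 16).
      rewrite /a natrX exprS (_ : 4 = 2 * 2 :> R) ?exprMn; last by lra.
      by field; rewrite expf_neq0.
    by rewrite ler_wpM2l ?exprn_ge0.
  rewrite mulr_sumr !big_nat; apply: ler_sum => k /andP[rk _].
  by apply: Heps; exact: lam_small.
have [m /lt_geF] := pow2_unbounded (fine S) b0.
by rewrite key.
Qed.
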